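(* Let $\kappa$ be a strongly compact cardinal and let $f$ be $V$-generic for the fast function forcing $\mathbb{F}_\kappa$. Then $\kappa$ remains strongly compact in $V[f]$. Indeed, for every $\lambda\ge\kappa$, every $\kappa$-complete fine ultrafilter $\mu_0$ on $P_\kappa\lambda$ in $V$ extends to a $\kappa$-complete fine ultrafilter on $P_\kappa\lambda$ in $V[f]$.
   Context: Fast function forcing $\mathbb{F}_\kappa$: conditions are partial functions $p:\kappa\to\kappa$ such that $\mathrm{dom}(p)$ is a set of inaccessible cardinals below $\kappa$ of size less than $\kappa$, and for every $\gamma\in\mathrm{dom}(p)$, $p``\gamma\subseteq\gamma$ and $|p\upharpoonright\gamma|<\gamma$; ordered by inclusion. The union $f$ of the generic filter is the fast function. A fine measure on $P_\kappa\lambda$ (a strong compactness measure) is a $\kappa$-complete ultrafilter on $P_\kappa\lambda=\{x\subseteq\lambda: |x|<\kappa\}$ containing $\{x: \alpha\in x\}$ for each $\alpha<\lambda$. *)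

(* Defs.v *)
Set Implicit Arguments.
Unset Strict Implicit.

(** A structure for the language of set theory. It is an arbitrary
    type with a binary relation; being a model of ZFC is a hypothesis
    ([ZFC] below). Every notion defined over a structure [M] quantifies only
    over [M], so it is the internal notion "as computed in [M]". *)
Record set_structure : Type := SetStructure {
  carrier :> Type;
  mem : carrier -> carrier -> Prop
}.

Declare Scope set_scope.
Delimit Scope set_scope with set.
Local Open Scope set_scope.
Notation "x ∈ y" := (mem x y) (at level 70, no associativity) : set_scope.

Definition subset (M : set_structure) (x y : M) : Prop :=
  forall z : M, z ∈ x -> z ∈ y.
Notation "x ⊆ y" := (subset x y) (at level 70, no associativity) : set_scope.

(** First-order formulas in the language {=, ∈}, with de Bruijn indices. The
    axiom schemes must range over these, and not over arbitrary Rocq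
    predicates: a model of the latter, second-order, schemes has no proper
    generic extension. *)
Inductive formula : Type :=
| fEq  (m n : nat)
| fMem (m n : nat)
| fFalse
| fImp (p q : formula)
| fAll (p : formula).

Definition scons (A : Type) (a : A) (e : nat -> A) (n : nat) : A :=
  match n with O => a | S m => e m end.

Fixpoint sat (M : set_structure) (e : nat -> M) (p : formula) : Prop :=
  match p with
  | fEq m n  => e m = e n
  | fMem m n => e m ∈ e n
  | fFalse   => False
  | fImp p q => sat e p -> sat e q
  | fAll p   => forall a : M, sat (scons a e) p
  end.

Definition is_empty (M : set_structure) (x : M) : Prop :=
  forall z : M, ~ z ∈ x.

Definition is_upair (M : set_structure) (z a b : M) : Prop :=
  forall w : M, w ∈ z <-> w = a \/ w = b.

(** [y = x ∪ {x}] *)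
Definition is_succ (M : set_structure) (y x : M) : Prop :=
  forall w : M, w ∈ y <-> w ∈ x \/ w = x.

Definition is_union (M : set_structure) (u x : M) : Prop :=
  forall w : M, w ∈ u <-> exists y : M, y ∈ x /\ w ∈ y.

Definition is_power (M : set_structure) (P x : M) : Prop :=
  forall w : M, w ∈ P <-> w ⊆ x.

Record ZFC (M : set_structure) : Prop := {
  zfc_extensionality : forall x y : M, (forall z : M, z ∈ x <-> z ∈ y) -> x = y;
  zfc_foundation : forall x : M, ~ is_empty x ->
    exists y : M, y ∈ x /\ forall z : M, z ∈ x -> ~ z ∈ y;
  zfc_pairing : forall a b : M, exists z : M, is_upair z a b;
  zfc_union : forall x : M, exists u : M, is_union u x;
  zfc_power : forall x : M, exists P : M, is_power P x;
  zfc_infinity : exists x : M,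
    (exists o : M, is_empty o /\ o ∈ x) /\
    (forall y : M, y ∈ x -> exists s : M, is_succ s y /\ s ∈ x);
  zfc_separation : forall (p : formula) (e : nat -> M) (a : M),
    exists b : M, forall x : M, x ∈ b <-> x ∈ a /\ sat (scons x e) p;
  zfc_replacement : forall (p : formula) (e : nat -> M) (a : M),
    (forall x : M, x ∈ a -> exists! y : M, sat (scons y (scons x e)) p) ->
    exists b : M, forall y : M,
      y ∈ b <-> exists x : M, x ∈ a /\ sat (scons y (scons x e)) p;
  zfc_choice : forall x : M,
    (forall y : M, y ∈ x -> ~ is_empty y) ->
    (forall y z : M, y ∈ x -> z ∈ x -> y <> z -> forall w : M, ~ (w ∈ y /\ w ∈ z)) ->
    exists c : M, forall y : M, y ∈ x -> exists! w : M, w ∈ y /\ w ∈ c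
}.

(** [z = (a, b) = {{a}, {a, b}}] *)
Definition is_opair (M : set_structure) (z a b : M) : Prop :=
  exists s t : M, is_upair s a a /\ is_upair t a b /\ is_upair z s t.

(** [(a, b) ∈ f] *)
Definition app (M : set_structure) (f a b : M) : Prop :=
  exists z : M, is_opair z a b /\ z ∈ f.

Definition is_function (M : set_structure) (f : M) : Prop :=
  (forall z : M, z ∈ f -> exists a b : M, is_opair z a b) /\
  (forall a b c : M, app f a b -> app f a c -> b = c).

Definition is_dom (M : set_structure) (d f : M) : Prop :=
  forall a : M, a ∈ d <-> exists b : M, app f a b.

Definition is_map (M : set_structure) (f x y : M) : Prop :=
  is_function f /\ is_dom x f /\ forall a b : M, app f a b -> b ∈ y.

Definition is_injection (M : set_structure) (f x y : M) : Prop :=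
  is_map f x y /\ forall a b c : M, app f a c -> app f b c -> a = b.

Definition card_le (M : set_structure) (x y : M) : Prop :=
  exists f : M, is_injection f x y.

Definition card_lt (M : set_structure) (x y : M) : Prop :=
  card_le x y /\ ~ card_le y x.

Definition is_transitive (M : set_structure) (x : M) : Prop :=
  forall y : M, y ∈ x -> y ⊆ x.

(** Correct in the presence of foundation. *)
Definition is_ordinal (M : set_structure) (x : M) : Prop :=
  is_transitive x /\
  forall y z : M, y ∈ x -> z ∈ x -> y ∈ z \/ y = z \/ z ∈ y.

Definition is_limit (M : set_structure) (x : M) : Prop :=
  is_ordinal x /\ ~ is_empty x /\
  forall y : M, y ∈ x -> exists z : M, z ∈ x /\ y ∈ z.

Definition is_omega (M : set_structure) (w : M) : Prop :=
  is_limit w /\ forall n : M, n ∈ w -> ~ is_limit n.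

Definition is_cardinal (M : set_structure) (k : M) : Prop :=
  is_ordinal k /\ forall a : M, a ∈ k -> card_lt a k.

Definition uncountable_cardinal (M : set_structure) (k : M) : Prop :=
  is_cardinal k /\ exists w : M, is_omega w /\ w ∈ k.

(** For an infinite cardinal [k]: no function from a smaller ordinal to [k] is
    cofinal. *)
Definition is_regular (M : set_structure) (k : M) : Prop :=
  forall a f : M, a ∈ k -> is_map f a k ->
  exists b : M, b ∈ k /\ forall x y : M, app f x y -> y ∈ b.

Definition is_strong_limit (M : set_structure) (k : M) : Prop :=
  forall a P : M, a ∈ k -> is_power P a -> card_lt P k.

Definition inaccessible (M : set_structure) (k : M) : Prop :=
  uncountable_cardinal k /\ is_regular k /\ is_strong_limit k.

(** [P = P_k l = {x ⊆ l : |x| < k}] *)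
Definition is_Pkl (M : set_structure) (P k l : M) : Prop :=
  forall x : M, x ∈ P <-> x ⊆ l /\ card_lt x k.

Record is_ultrafilter (M : set_structure) (U I : M) : Prop := {
  uf_sub : forall X : M, X ∈ U -> X ⊆ I;
  uf_full : I ∈ U;
  uf_proper : forall X : M, X ∈ U -> ~ is_empty X;
  uf_up : forall X Y : M, X ∈ U -> X ⊆ Y -> Y ⊆ I -> Y ∈ U;
  uf_inter : forall X Y Z : M, X ∈ U -> Y ∈ U ->
    (forall x : M, x ∈ Z <-> x ∈ X /\ x ∈ Y) -> Z ∈ U;
  uf_ultra : forall X Y : M, X ⊆ I ->
    (forall x : M, x ∈ Y <-> x ∈ I /\ ~ x ∈ X) -> X ∈ U \/ Y ∈ U
}.

Definition is_complete (M : set_structure) (k U : M) : Prop :=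
  forall A Z : M, A ⊆ U -> ~ is_empty A -> card_lt A k ->
    (forall x : M, x ∈ Z <-> forall X : M, X ∈ A -> x ∈ X) -> Z ∈ U.

Definition fine_measure (M : set_structure) (k l U : M) : Prop :=
  exists P : M, is_Pkl P k l /\ is_ultrafilter U P /\ is_complete k U /\
    forall a X : M, a ∈ l -> (forall x : M, x ∈ X <-> x ∈ P /\ a ∈ x) -> X ∈ U.

Definition strongly_compact (M : set_structure) (k : M) : Prop :=
  uncountable_cardinal k /\ is_regular k /\
  forall l : M, is_ordinal l -> k ⊆ l -> exists U : M, fine_measure k l U.

Definition is_restriction (M : set_structure) (r p g : M) : Prop :=
  forall z : M, z ∈ r <-> z ∈ p /\ exists a b : M, a ∈ g /\ is_opair z a b.

Record fast_condition (M : set_structure) (k p : M) : Prop := {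
  fc_function : is_function p;
  fc_range : forall a b : M, app p a b -> b ∈ k;
  fc_dom : exists d : M, is_dom d p /\ card_lt d k /\
    forall g : M, g ∈ d -> g ∈ k /\ inaccessible g;
  fc_closed : forall g : M, (exists c : M, app p g c) ->
    forall a b : M, a ∈ g -> app p a b -> b ∈ g;
  fc_small : forall g : M, (exists c : M, app p g c) ->
    exists r : M, is_restriction r p g /\ card_lt r g
}.

Definition is_fast_function_forcing (M : set_structure) (k F : M) : Prop :=
  forall p : M, p ∈ F <-> fast_condition k p.

(** Forcing notions are sets of conditions ordered by inclusion, a condition
    being stronger when it is larger. *)
Definition is_dense (M : set_structure) (P D : M) : Prop :=
  D ⊆ P /\ forall p : M, p ∈ P -> exists q : M, q ∈ D /\ p ⊆ q.

Definition is_filter (M : set_structure) (P G : M) : Prop :=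
  G ⊆ P /\ ~ is_empty G /\
  (forall p q : M, q ∈ G -> p ∈ P -> p ⊆ q -> p ∈ G) /\
  (forall p q : M, p ∈ G -> q ∈ G -> exists r : M, r ∈ G /\ p ⊆ r /\ q ⊆ r).

(** [x] is the value of the name [s] by [G], i.e. the result at [s] of the
    ∈-recursion [val u = {val v : exists p ∈ G, (v, p) ∈ u}]; [h] is a set
    approximation to this recursion. *)
Definition name_value (M : set_structure) (G s x : M) : Prop :=
  exists h : M, is_function h /\ app h s x /\
  forall u y : M, app h u y ->
    (forall v p : M, p ∈ G -> app u v p -> exists z : M, app h v z) /\
    (forall z : M, z ∈ y <->
       exists v p : M, p ∈ G /\ app u v p /\ app h v z).

(** [i] identifies [V] with a transitive class of [W], [G] is a [V]-generic
    filter on [P], and [W = V[G] = {val s : s ∈ V}]. *)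
Record forcing_extension (V W : set_structure) (i : V -> W) (P : V) (G : W)
  : Prop := {
  fe_zfc : ZFC W;
  fe_mem : forall x y : V, i x ∈ i y <-> x ∈ y;
  fe_transitive : forall (x : W) (y : V), x ∈ i y -> exists z : V, x = i z;
  fe_filter : is_filter (i P) G;
  fe_generic : forall D : V, is_dense P D -> exists p : W, p ∈ G /\ p ∈ i D;
  fe_generated : forall x : W, exists s : V, name_value G (i s) x
}.

(** [f] is [V]-generic for the fast function forcing at [k], and [W = V[f]]:
    [f] is the union of a generic filter [G], and [V[f]] is [V[G]]. *)
Definition fast_function_extension
  (V W : set_structure) (i : V -> W) (k : V) (f : W) : Prop :=
  exists (F : V) (G : W), is_fast_function_forcing k F /\
    forcing_extension i F G /\ is_union f G.

(* Main.v *)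
(** Fix in [V] a fine measure [mu0] on [P = P_kappa lambda], and let [nu] be a
    fine measure on [P_kappa theta], with [theta] so large that a point [y] of
    [P_kappa theta] codes fewer than [kappa] elements of [mu0] and fewer than
    [kappa] names; almost every [y] codes any given one. Choose [pi y] in all
    the elements of [mu0] coded by [y], and let [g y] represent [kappa] in the
    ultrapower by [nu]: almost every [g y] is inaccessible. Conditions that map
    [g y] to a large enough ordinal factor as a condition of the forcing at
    [g y] and a tail, and the tails are closed enough that one tail [t y]
    decides all the names coded by [y] at the point [pi y], modulo a dense set
    of conditions of the forcing at [g y]. A function of [y] that picks such a
    condition is constant almost everywhere, hence for every name [n] for a
    function on [P], densely many [p] are such that [p ∪ t y] decides the value
    of [n] at [pi y] for almost every [y]. In [V[G]], let a set named by [n]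
    have measure one when some [p] in [G] is such that [p ∪ t y] forces [pi y]
    into it for almost every [y]. Two sets of measure one meet, and if fewer
    than [kappa] sets cover [P], then one of them has measure one; this yields
    the extension of [mu0], and also the regularity of [kappa] in [V[G]].

    Only names for subsets of ground model sets matter. Such names exist
    because "the name [u] evaluates to [b]" is forced according to a monotone
    inductive definition. *)

From Corelib Require Import ssreflect.
From Stdlib Require Import Classical ClassicalEpsilon FunctionalExtensionality PeanoNat.
Require Import Defs.
Local Open Scope set_scope.
Set Implicit Arguments.
Unset Strict Implicit.
Set Bullet Behavior "None".

(** In terms of embeddings one would lift an ultrapower map through the forcing. For a strong
    compactness measure the target need not be closed under long sequences, so no generic for the
    tail can be built by meeting dense sets one at a time along a sequence from outside. Covering
    replaces closure: all requirements attached to [y] form a set of size less than [kappa], and a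
    single tail handles them together.

    The order of the last part is forced. [big_cover] mentions only ground model ordinals [d ∈ k],
    so it is available before anything is known about [kappa] in the extension. It yields
    regularity, regularity yields that [kappa] is still a cardinal, and only then does [card_lt]
    relative to [i k] unfold to an injection into a ground model ordinal, as completeness requires.

    Since the axiom schemes are first-order, every predicate that forms a set comes with a
    definability proof, and a notion computed in [V] must be a set of [V] before [W] can refer to
    it. *)

Record zfc_model : Type := ZfcModel { zm :> set_structure; zm_ax : ZFC zm }.

(** * Definability with parameters *)

Fixpoint ren (r : nat -> nat) (p : formula) : formula :=
  match p with
  | fEq m n => fEq (r m) (r n)
  | fMem m n => fMem (r m) (r n)
  | fFalse => fFalse
  | fImp p q => fImp (ren r p) (ren r q)
  | fAll p => fAll (ren (fun n => match n with O => O | S m => S (r m) end) p)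
  end.

Lemma sat_ren (M : set_structure) p : forall (r : nat -> nat) (e : nat -> M),
  sat e (ren r p) <-> sat (fun n => e (r n)) p.
Proof.
elim: p => /= [m n|m n||p IHp q IHq|p IH] r e; try tauto.
- by rewrite IHp IHq.
- have E : forall a : M, (fun n => scons a e (match n with O => O | S m => S (r m) end))
      = scons a (fun n => e (r n)) by move=> a; apply: functional_extensionality; case.
  by split=> H a; [rewrite -E -IH | rewrite IH E].
Qed.

Section Definability.
Context {M : set_structure}.
Implicit Types (P Q : (nat -> M) -> Prop) (t a b c d : (nat -> M) -> M).

(** Each free variable of the formula is bound to a variable of the
    environment or to a parameter. *)
Definition look (v : nat -> nat + M) (e : nat -> M) (n : nat) : M :=
  match v n with inl k => e k | inr c => c end.

(** Predicates on whole environments treat all arities at once, and binders become shifts of the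
    environment. *)
Definition Dfn P : Prop :=
  exists p v, forall e, sat (look v e) p <-> P e.

(** A term is definable through its graph: slot 0 holds the value and the arguments are shifted by
    one. *)
Definition Dt t : Prop := Dfn (fun e => e 0 = t (fun n => e (S n))).

Lemma Dfn_ext P Q : (forall e, P e <-> Q e) -> Dfn P -> Dfn Q.
Proof. by move=> H [p [v E]]; exists p, v => e; rewrite E H. Qed.

Lemma Dfn_remap f P : Dfn P -> Dfn (fun e => P (fun n => e (f n))).
Proof.
move=> [p [v E]].
exists p, (fun n => match v n with inl k => inl (f k) | inr c => inr c end) => e.
rewrite -E.
have -> // : look (fun n => match v n with inl k => inl (f k) | inr c => inr c end) e
  = look v (fun n => e (f n)).
by apply: functional_extensionality => n; rewrite /look; case: (v n).
Qed.

Lemma Dfn_const (A : Prop) : Dfn (fun _ => A).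
Proof.
case: (classic A) => HA.
- by exists (fImp fFalse fFalse), (fun _ => inl 0) => e /=; tauto.
- by exists fFalse, (fun _ => inl 0) => e /=; tauto.
Qed.

Lemma Dfn_imp P Q : Dfn P -> Dfn Q -> Dfn (fun e => P e -> Q e).
Proof.
move=> [p [v Ep]] [q [w Eq]].
(* The two formulas carry separate parameter lists. Even variables serve [p] and odd ones [q], so
   that one valuation holds both. *)
exists (fImp (ren (fun n => 2 * n) p) (ren (fun n => S (2 * n)) q)),
  (fun n => if Nat.even n then v (Nat.div2 n) else w (Nat.div2 n)) => e.
set u := (fun n => _).
have E1 : (fun n => look u e (2 * n)) = look v e.
  apply: functional_extensionality => n.
  by rewrite /look /u Nat.even_mul Nat.div2_double.
have E2 : (fun n => look u e (S (2 * n))) = look w e.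
  apply: functional_extensionality => n.
  by rewrite /look /u Nat.even_succ -Nat.negb_even Nat.even_mul Nat.div2_succ_double.
by rewrite [sat _ _]/= !sat_ren E1 E2 Ep Eq.
Qed.

Lemma Dfn_all (P : M -> (nat -> M) -> Prop) :
  Dfn (fun e => P (e 0) (fun n => e (S n))) -> Dfn (fun e => forall x, P x e).
Proof.
move=> [p [v E]].
(* Several formula variables may point to slot 0; all of them become the bound variable, and the
   others move past the binder. *)
exists (fAll (ren (fun n => match v n with inl O => O | _ => S n end) p)),
  (fun n => match v n with inl (S k) => inl k | z => z end) => e /=.
set u := (fun n => _).
have EE x : (fun n => scons x (look u e) (match v n with inl O => O | _ => S n end))
   = look v (scons x e).
  apply: functional_extensionality => n; rewrite /look /u.
  by case E1 : (v n) => [[|k]|c] //=; rewrite E1.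
by split=> H x; move: (H x); rewrite sat_ren EE E.
Qed.

Lemma Dfn_false : Dfn (fun _ => False).
Proof. exact: Dfn_const. Qed.

Lemma Dfn_not P : Dfn P -> Dfn (fun e => ~ P e).
Proof. by move=> H; apply: Dfn_imp => //; apply: Dfn_false. Qed.

Lemma Dfn_or P Q : Dfn P -> Dfn Q -> Dfn (fun e => P e \/ Q e).
Proof.
move=> HP HQ; apply: (Dfn_ext _ (Dfn_imp (Dfn_not HP) HQ)) => e.
by have := classic (P e); tauto.
Qed.

Lemma Dfn_and P Q : Dfn P -> Dfn Q -> Dfn (fun e => P e /\ Q e).
Proof.
move=> HP HQ; apply: (Dfn_ext _ (Dfn_not (Dfn_imp HP (Dfn_not HQ)))) => e.
by have := classic (P e); have := classic (Q e); tauto.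
Qed.

Lemma Dfn_iff P Q : Dfn P -> Dfn Q -> Dfn (fun e => P e <-> Q e).
Proof. by move=> HP HQ; apply: Dfn_and; apply: Dfn_imp. Qed.

Lemma Dfn_ex (P : M -> (nat -> M) -> Prop) :
  Dfn (fun e => P (e 0) (fun n => e (S n))) -> Dfn (fun e => exists x, P x e).
Proof.
move=> H; apply: (Dfn_ext _ (Dfn_not (Dfn_all (P := fun x e => ~ P x e) (Dfn_not H)))) => e.
split; last by move=> [x Hx] Hn; apply: (Hn x).
by move=> Hn; apply: NNPP => Hx; apply: Hn => x Px; apply: Hx; exists x.
Qed.

Lemma Dt_var k : Dt (fun e => e k).
Proof. by exists (fEq 0 (S k)), inl => e. Qed.

Lemma Dt_const (c : M) : Dt (fun _ => c).
Proof.
by exists (fEq 0 1), (fun n => match n with 0 => inl 0 | _ => inr c end) => e.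
Qed.

Lemma Dt_remap f t : Dt t -> Dt (fun e => t (fun n => e (f n))).
Proof.
move=> H.
exact: (Dfn_remap (fun n => match n with 0 => 0 | S m => S (f m) end) H).
Qed.

Lemma Dfn_subst (P : M -> (nat -> M) -> Prop) t :
  Dfn (fun e => P (e 0) (fun n => e (S n))) -> Dt t -> Dfn (fun e => P (t e) e).
Proof.
move=> HP Ht.
apply: (Dfn_ext _ (Dfn_ex (P := fun x e => x = t e /\ P x e) (Dfn_and Ht HP))) => e.
by split=> [[x [-> ?]] //|?]; exists (t e).
Qed.

Lemma Dfn_sub1 (R : M -> Prop) a :
  Dfn (fun e => R (e 0)) -> Dt a -> Dfn (fun e => R (a e)).
Proof. by move=> HR Ha; apply: (Dfn_subst (P := fun x _ => R x)). Qed.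

Lemma Dfn_sub2 (R : M -> M -> Prop) a b :
  Dfn (fun e => R (e 0) (e 1)) -> Dt a -> Dt b -> Dfn (fun e => R (a e) (b e)).
Proof.
move=> HR Ha Hb; apply: (Dfn_subst (P := fun x e => R x (b e))) => //.
apply: (Dfn_subst (P := fun y e => R (e 0) y) (t := fun e => b (fun n => e (S n)))).
  exact: (Dfn_remap (fun n => match n with 0 => 1 | _ => 0 end) HR).
exact: (Dt_remap S Hb).
Qed.

Lemma Dfn_sub3 (R : M -> M -> M -> Prop) a b c :
  Dfn (fun e => R (e 0) (e 1) (e 2)) -> Dt a -> Dt b -> Dt c ->
  Dfn (fun e => R (a e) (b e) (c e)).
Proof.
move=> HR Ha Hb Hc; apply: (Dfn_subst (P := fun x e => R x (b e) (c e))) => //.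
apply: (Dfn_subst (P := fun y e => R (e 0) y (c (fun n => e (S n))))
   (t := fun e => b (fun n => e (S n)))); last exact: (Dt_remap S Hb).
apply: (Dfn_subst (P := fun z e => R (e 1) (e 0) z)
   (t := fun e => c (fun n => e (S (S n))))); last exact: (Dt_remap (fun n => S (S n)) Hc).
exact: (Dfn_remap (fun n => match n with 0 => 2 | 1 => 1 | _ => 0 end) HR).
Qed.

Lemma Dt_sub1 (F : M -> M) a : Dt (fun e => F (e 0)) -> Dt a -> Dt (fun e => F (a e)).
Proof.
move=> HF Ha; apply: (Dfn_sub2 (R := fun z x => z = F x) HF (Dt_var 0)).
exact: (Dt_remap S Ha).
Qed.

Lemma Dt_sub2 (F : M -> M -> M) a b :
  Dt (fun e => F (e 0) (e 1)) -> Dt a -> Dt b -> Dt (fun e => F (a e) (b e)).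
Proof.
move=> HF Ha Hb; apply: (Dfn_sub3 (R := fun z x y => z = F x y) HF (Dt_var 0)).
  exact: (Dt_remap S Ha).
exact: (Dt_remap S Hb).
Qed.

Lemma Dfn_mem a b : Dt a -> Dt b -> Dfn (fun e => a e ∈ b e).
Proof.
apply: (Dfn_sub2 (R := fun x y => x ∈ y)).
by exists (fMem 0 1), inl => e.
Qed.

Lemma Dfn_eq a b : Dt a -> Dt b -> Dfn (fun e => a e = b e).
Proof.
apply: (Dfn_sub2 (R := fun x y => x = y)).
by exists (fEq 0 1), inl => e.
Qed.

Lemma Dfn_subset a b : Dt a -> Dt b -> Dfn (fun e => a e ⊆ b e).
Proof.
apply: (Dfn_sub2 (R := fun x y => x ⊆ y)).
apply: Dfn_all; apply: Dfn_imp; apply: Dfn_mem; exact: Dt_var.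
Qed.

End Definability.

(** An extension point: it is redefined whenever new operations acquire closure lemmas. [dfn] also
    uses definability facts about variables found in the context, instantiating them at terms. *)
Ltac dfn_reg := fail.
Ltac dfn_step :=
  cbv beta;
  first
  [ match goal with
    | |- Dfn (fun _ => ?A) => exact (Dfn_const A)
    | |- Dt (fun _ => ?c) => exact (Dt_const c)
    | |- Dt (fun e => e ?k) => exact (Dt_var k)
    | H : _ |- _ => exact H
    end
  | simple apply Dfn_mem | simple apply Dfn_eq | simple apply Dfn_subset
  | simple apply Dfn_and | simple apply Dfn_or | simple apply Dfn_iff
  | simple apply Dfn_not | simple apply Dfn_imp
  | simple apply Dfn_all | simple apply Dfn_ex
  | dfn_reg
  | match goal with
    | H : Dfn (fun e => ?Q (e 0)) |- Dfn (fun e => ?Q (@?a e)) =>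
      refine (@Dfn_sub1 _ Q a H _)
    | H : Dfn (fun e => ?Q (e 0) (e 1)) |- Dfn (fun e => ?Q (@?a e) (@?b e)) =>
      refine (@Dfn_sub2 _ Q a b H _ _)
    | H : Dfn (fun e => ?Q (e 0) (e 1) (e 2)) |- Dfn (fun e => ?Q (@?a e) (@?b e) (@?c e)) =>
      refine (@Dfn_sub3 _ Q a b c H _ _ _)
    | H : Dt (fun e => ?Q (e 0)) |- Dt (fun e => ?Q (@?a e)) =>
      refine (@Dt_sub1 _ Q a H _)
    | H : Dt (fun e => ?Q (e 0) (e 1)) |- Dt (fun e => ?Q (@?a e) (@?b e)) =>
      refine (@Dt_sub2 _ Q a b H _ _)
    end
  ].
Ltac dfn := solve [repeat dfn_step].

(** * Set operations as terms in a model of ZFC *)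

Section Zfc.
Context {M : zfc_model}.
Implicit Types (x y z : M) (Q : M -> Prop).

Lemma ext x y : (forall z, z ∈ x <-> z ∈ y) -> x = y.
Proof. exact: (zfc_extensionality (zm_ax M)). Qed.

Lemma sub_antisym x y : x ⊆ y -> y ⊆ x -> x = y.
Proof. by move=> H1 H2; apply: ext => z; split; [apply: H1|apply: H2]. Qed.

Lemma sep_ex (a : M) Q : Dfn (fun e => Q (e 0)) ->
  exists b : M, forall x, x ∈ b <-> x ∈ a /\ Q x.
Proof.
move=> [p [v E]].
have [b Hb] := zfc_separation (zm_ax M) (ren (fun n => match v n with inl O => O | _ => S n end) p)
  (fun n => match v n with inl _ => a | inr c => c end) a.
exists b => x; rewrite Hb sat_ren.
have -> : (fun n => scons x (fun n => match v n with inl _ => a | inr c => c end)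
    (match v n with inl O => O | _ => S n end)) = look v (scons x (fun _ => a)).
  apply: functional_extensionality => n; rewrite /look.
  by case E1 : (v n) => [[|k]|c] //=; rewrite E1.
by rewrite E.
Qed.

Lemma repl_ex (a : M) (F : M -> M) : Dt (fun e => F (e 0)) ->
  exists b : M, forall y, y ∈ b <-> exists x, x ∈ a /\ y = F x.
Proof.
move=> [p [v E]].
pose r n := match v n with inl O => O | inl 1 => 1 | _ => S (S n) end.
pose c n := match v n with inl _ => a | inr c => c end.
have HH x y : sat (scons y (scons x c)) (ren r p) <-> y = F x.
  rewrite sat_ren.
  have -> : (fun n => scons y (scons x c) (r n)) = look v (scons y (scons x (fun _ => a))).
    apply: functional_extensionality => n; rewrite /look /r.
    by case E1 : (v n) => [[|[|k]]|d] //=; rewrite /c E1.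
  by rewrite E.
have [x Hx|b Hb] := zfc_replacement (zm_ax M) (p := ren r p) (e := c) (a := a).
  by exists (F x); split=> [|y]; rewrite HH.
by exists b => y; rewrite Hb; split=> -[x [? /HH ?]]; exists x.
Qed.

Lemma zfc_inhabited : inhabited M.
Proof. by have [x _] := zfc_infinity (zm_ax M); constructor. Qed.

(** [compr Q] is the set [{x | Q x}], or the empty set if [Q] is a proper
    class. *)
Definition compr Q : M :=
  epsilon zfc_inhabited (fun z => (forall x, x ∈ z <-> Q x)
     \/ ~ (exists z, forall x, x ∈ z <-> Q x) /\ is_empty z).

(** A value of [epsilon] has no evident first-order definition, but extensionality makes this value
    unique, so its specification is also its graph. That is what makes [compr] definable. *)
Lemma compr_graph Q z : z = compr Q <-> (forall x, x ∈ z <-> Q x)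
     \/ ~ (exists z, forall x, x ∈ z <-> Q x) /\ is_empty z.
Proof.
have H : exists z, (forall x, x ∈ z <-> Q x)
     \/ ~ (exists z, forall x, x ∈ z <-> Q x) /\ is_empty z.
  case: (classic (exists z, forall x, x ∈ z <-> Q x)) => [[w Hw]|Hn].
    by exists w; left.
  have [a] := zfc_inhabited.
  have [b Hb] := sep_ex (Q := fun _ => False) a (Dfn_const False).
  by exists b; right; split=> // x /Hb[].
have Hs := epsilon_spec zfc_inhabited _ H; rewrite -/(compr Q) in Hs.
split=> [-> //|]; move=> Hz.
case: Hz Hs => [Hz|[Hn Hz]] [Hs|[Hn' Hs]].
- by apply: ext => x; rewrite Hz Hs.
- by case: Hn'; exists z.
- by case: Hn; exists (compr Q).
- by apply: ext => x; split=> Hx; [case: (Hz x)|case: (Hs x)].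
Qed.

Lemma comprP Q : (exists z, forall x, x ∈ z <-> Q x) -> forall x, x ∈ compr Q <-> Q x.
Proof. by move=> H; have [/(_ eq_refl)[]] := compr_graph Q (compr Q); tauto. Qed.

Lemma Dt_compr (P : M -> (nat -> M) -> Prop) :
  Dfn (fun e => P (e 0) (fun n => e (S n))) -> Dt (fun e => compr (fun x => P x e)).
Proof.
move=> H; rewrite /Dt.
apply: (Dfn_ext (fun e => iff_sym (compr_graph _ _))).
have H1 : Dfn (fun e => forall x, x ∈ e 0 <-> P x (fun n => e (S n))).
  apply: (@Dfn_all M (fun x e => x ∈ e 0 <-> P x (fun n => e (S n)))).
  apply: Dfn_iff; first by apply: Dfn_mem; apply: Dt_var.
  exact: (Dfn_remap (fun n => match n with 0 => 0 | S m => S (S m) end) H).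
apply: Dfn_or => //; apply: Dfn_and.
  apply: Dfn_not.
  apply: (@Dfn_ex M (fun z e => forall x, x ∈ z <-> P x (fun n => e (S n)))).
  exact: (Dfn_remap (fun n => match n with 0 => 0 | S m => S (S m) end) H1).
rewrite /is_empty; dfn.
Qed.

Definition emp : M := compr (fun _ => False).
Definition upair x y : M := compr (fun z => z = x \/ z = y).
Definition opair x y : M := upair (upair x x) (upair x y).
Definition bigU x : M := compr (fun z => exists y, y ∈ x /\ z ∈ y).
Definition pow x : M := compr (fun z => z ⊆ x).
Definition sep x Q : M := compr (fun z => z ∈ x /\ Q z).
Definition img x (F : M -> M) : M := compr (fun y => exists z, z ∈ x /\ y = F z).
Definition cup x y : M := bigU (upair x y).
Definition succ x : M := cup x (upair x x).
Definition prod x y : M := compr (fun z => exists a b, a ∈ x /\ b ∈ y /\ z = opair a b).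
Definition lam x (F : M -> M) : M := img x (fun z => opair z (F z)).
(** The union of all values at [x]: the value itself for a function, and the empty set outside the
    domain, so application is total. *)
Definition ap f x : M := compr (fun z => exists y, opair x y ∈ f /\ z ∈ y).

(** The unique [z] such that [Q z], or the empty set. *)
Definition the Q : M :=
  compr (fun x => exists z, (Q z /\ forall z', Q z' -> z' = z) /\ x ∈ z).

Lemma theP Q z : Q z -> (forall z', Q z' -> z' = z) -> the Q = z.
Proof.
move=> Hz Hu.
have H x : (exists z, (Q z /\ forall z', Q z' -> z' = z) /\ x ∈ z) <-> x ∈ z.
  by split=> [[w [[Hw _] Hx]]|Hx]; [rewrite -(Hu _ Hw)|exists z].
have HH : exists y, forall x, x ∈ y <-> exists z, (Q z /\ forall z', Q z' -> z' = z) /\ x ∈ z.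
  by exists z => w; rewrite H.
by apply: ext => x; rewrite -H; apply: (comprP HH).
Qed.

Lemma Dt_the (P : M -> (nat -> M) -> Prop) :
  Dfn (fun e => P (e 0) (fun n => e (S n))) -> Dt (fun e => the (fun x => P x e)).
Proof.
move=> H; apply: Dt_compr.
apply: (@Dfn_ex M (fun z e => (P z (fun n => e (S n)) /\ forall z', P z' (fun n => e (S n)) -> z' = z) /\ e 0 ∈ z)).
apply: Dfn_and; last by dfn.
apply: Dfn_and.
  exact: (Dfn_remap (fun n => match n with 0 => 0 | S m => S (S m) end) H).
apply: (@Dfn_all M (fun z' e => P z' (fun n => e (S (S n))) -> z' = e 0)).
apply: Dfn_imp; last by dfn.
exact: (Dfn_remap (fun n => match n with 0 => 0 | S m => S (S (S m)) end) H).
Qed.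

Lemma in_emp x : ~ x ∈ emp.
Proof.
have [a] := zfc_inhabited.
have [b Hb] := sep_ex (Q := fun _ => False) a (Dfn_const False).
rewrite /emp comprP //; exists b => z; rewrite Hb; tauto.
Qed.

Lemma in_upair x y z : z ∈ upair x y <-> z = x \/ z = y.
Proof. by apply: comprP; exact: (zfc_pairing (zm_ax M)). Qed.

Lemma in_bigU x z : z ∈ bigU x <-> exists y, y ∈ x /\ z ∈ y.
Proof. by apply: (comprP (Q := fun z => exists y, y ∈ x /\ z ∈ y)); exact: (zfc_union (zm_ax M)). Qed.

Lemma in_pow x z : z ∈ pow x <-> z ⊆ x.
Proof. by apply: (comprP (Q := fun z => z ⊆ x)); exact: (zfc_power (zm_ax M)). Qed.

Lemma in_sep x Q z : Dfn (fun e => Q (e 0)) -> z ∈ sep x Q <-> z ∈ x /\ Q z.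
Proof. by move=> H; apply: (comprP (Q := fun z => z ∈ x /\ Q z)); exact: sep_ex. Qed.

Lemma in_img x F z : Dt (fun e => F (e 0)) -> z ∈ img x F <-> exists y, y ∈ x /\ z = F y.
Proof.
by move=> H; apply: (comprP (Q := fun z => exists y, y ∈ x /\ z = F y)); exact: repl_ex.
Qed.

Lemma in_cup x y z : z ∈ cup x y <-> z ∈ x \/ z ∈ y.
Proof.
rewrite in_bigU; split=> [[w [/in_upair[->|->]]]|[H|H]]; try tauto.
- by exists x; split=> //; apply/in_upair; left.
- by exists y; split=> //; apply/in_upair; right.
Qed.

Lemma in_succ x z : z ∈ succ x <-> z ∈ x \/ z = x.
Proof. rewrite in_cup in_upair; tauto. Qed.

Lemma is_upairE z x y : is_upair z x y <-> z = upair x y.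
Proof.
by split=> [H|->] => [|w]; [apply: ext => w; rewrite in_upair|rewrite in_upair].
Qed.

Lemma is_opairE z x y : is_opair z x y <-> z = opair x y.
Proof.
split=> [[s [t [/is_upairE -> [/is_upairE -> /is_upairE]]]] //|->].
by exists (upair x x), (upair x y); rewrite !is_upairE.
Qed.

Lemma opair_inj x y x' y' : opair x y = opair x' y' -> x = x' /\ y = y'.
Proof.
move=> E.
have H1 : upair x x ∈ opair x' y' by rewrite -E; apply/in_upair; left.
have Ex : x = x'.
  case/in_upair: H1 => E1.
    by have /in_upair[] : x ∈ upair x' x' by rewrite -E1; apply/in_upair; left.
  by have /in_upair[] : x' ∈ upair x x by rewrite E1; apply/in_upair; left.
split=> //; subst x'.
have H2 : upair x y ∈ opair x y' by rewrite -E; apply/in_upair; right.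
have H3 : upair x y' ∈ opair x y by rewrite E; apply/in_upair; right.
case/in_upair: H2 => E2.
  have Ey : y = x by have /in_upair[] : y ∈ upair x x by rewrite -E2; apply/in_upair; right.
  subst y; case/in_upair: H3 => E3;
    by have /in_upair[] : y' ∈ upair x x by rewrite -E3; apply/in_upair; right.
have /in_upair[E3|//] : y ∈ upair x y' by rewrite -E2; apply/in_upair; right.
have /in_upair[E4|E4] : y' ∈ upair x y by rewrite E2; apply/in_upair; right.
  by rewrite E3 E4.
by [].
Qed.

Lemma appE f x y : app f x y <-> opair x y ∈ f.
Proof.
by split=> [[z [/is_opairE -> //]]|H]; exists (opair x y); rewrite is_opairE.
Qed.

End Zfc.

Ltac dfn_reg ::= first [simple apply Dt_compr | simple apply Dt_the].

Section Terms.
Context {M : zfc_model}.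
Implicit Types (a b c : (nat -> M) -> M).

Lemma Dt_upair a b : Dt a -> Dt b -> Dt (fun e => upair (a e) (b e)).
Proof. apply: Dt_sub2; rewrite /upair; dfn. Qed.

Lemma Dt_opair a b : Dt a -> Dt b -> Dt (fun e => opair (a e) (b e)).
Proof. by move=> Ha Hb; do !apply: Dt_upair. Qed.

Lemma Dt_bigU a : Dt a -> Dt (fun e => bigU (a e)).
Proof. apply: Dt_sub1; rewrite /bigU; dfn. Qed.

Lemma Dt_pow a : Dt a -> Dt (fun e => pow (a e)).
Proof. apply: Dt_sub1; rewrite /pow; dfn. Qed.

Lemma Dt_cup a b : Dt a -> Dt b -> Dt (fun e => cup (a e) (b e)).
Proof. by move=> Ha Hb; apply: Dt_bigU; apply: Dt_upair. Qed.

Lemma Dt_succ a : Dt a -> Dt (fun e => succ (a e)).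
Proof. by move=> Ha; apply: Dt_cup => //; apply: Dt_upair. Qed.

Lemma Dt_sep a (Q : M -> (nat -> M) -> Prop) : Dt a ->
  Dfn (fun e => Q (e 0) (fun n => e (S n))) -> Dt (fun e => sep (a e) (fun x => Q x e)).
Proof.
move=> Ha HQ; rewrite /sep.
apply: (@Dt_compr _ (fun x e => x ∈ a e /\ Q x e)); apply: Dfn_and => //.
by apply: Dfn_mem; [apply: Dt_var|apply: (Dt_remap S Ha)].
Qed.

Lemma Dt_img a (F : M -> (nat -> M) -> M) : Dt a ->
  Dt (fun e => F (e 0) (fun n => e (S n))) -> Dt (fun e => img (a e) (fun x => F x e)).
Proof.
move=> Ha HF; rewrite /img.
apply: (@Dt_compr _ (fun y e => exists x, x ∈ a e /\ y = F x e)).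
apply: (@Dfn_ex _ (fun x e => x ∈ a (fun n => e (S n)) /\ e 0 = F x (fun n => e (S n)))).
apply: Dfn_and.
  apply: Dfn_mem; first exact: Dt_var.
  exact: (Dt_remap (fun n => S (S n)) Ha).
apply: Dfn_eq; first exact: Dt_var.
exact: (Dt_remap (fun n => match n with 0 => 0 | S m => S (S m) end) HF).
Qed.

Lemma Dt_lam a (F : M -> (nat -> M) -> M) : Dt a ->
  Dt (fun e => F (e 0) (fun n => e (S n))) -> Dt (fun e => lam (a e) (fun x => F x e)).
Proof.
move=> Ha HF; apply: (@Dt_img a (fun x e => opair x (F x e))) => //.
by apply: Dt_opair => //; exact: Dt_var.
Qed.

End Terms.

Ltac dfn_reg ::= first [simple apply Dt_upair | simple apply Dt_opair | simple apply Dt_bigU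
  | simple apply Dt_pow | simple apply Dt_cup | simple apply Dt_succ
  | simple apply Dt_sep | simple apply Dt_img | simple apply Dt_lam
  | simple apply Dt_compr | simple apply Dt_the].

Section Terms2.
Context {M : zfc_model}.
Implicit Types (a b c : (nat -> M) -> M).

Lemma Dt_prod a b : Dt a -> Dt b -> Dt (fun e => prod (a e) (b e)).
Proof. apply: Dt_sub2; rewrite /prod; dfn. Qed.

Lemma Dt_ap a b : Dt a -> Dt b -> Dt (fun e => ap (a e) (b e)).
Proof. apply: Dt_sub2; rewrite /ap; dfn. Qed.

Lemma Dfn_empty a : Dt a -> Dfn (fun e => is_empty (a e)).
Proof. apply: Dfn_sub1; rewrite /is_empty; dfn. Qed.

Lemma Dfn_ordinal a : Dt a -> Dfn (fun e => is_ordinal (a e)).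
Proof. apply: Dfn_sub1; rewrite /is_ordinal /is_transitive; dfn. Qed.

Lemma Dfn_app a b c : Dt a -> Dt b -> Dt c -> Dfn (fun e => app (a e) (b e) (c e)).
Proof. apply: Dfn_sub3; rewrite /app /is_opair /is_upair; dfn. Qed.

Lemma Dfn_opair a b c : Dt a -> Dt b -> Dt c -> Dfn (fun e => is_opair (a e) (b e) (c e)).
Proof. apply: Dfn_sub3; rewrite /is_opair /is_upair; dfn. Qed.

End Terms2.

Ltac dfn_reg1 := first [simple apply Dt_upair | simple apply Dt_opair | simple apply Dt_bigU
  | simple apply Dt_pow | simple apply Dt_cup | simple apply Dt_succ
  | simple apply Dt_prod | simple apply Dt_ap
  | simple apply Dfn_empty | simple apply Dfn_ordinal | simple apply Dfn_app | simple apply Dfn_opair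
  | simple apply Dt_sep | simple apply Dt_img | simple apply Dt_lam
  | simple apply Dt_compr | simple apply Dt_the].
Ltac dfn_reg ::= dfn_reg1.

Section Terms3.
Context {M : zfc_model}.
Implicit Types (a b c : (nat -> M) -> M).

Lemma Dfn_function a : Dt a -> Dfn (fun e => is_function (a e)).
Proof. apply: Dfn_sub1; rewrite /is_function; dfn. Qed.

Lemma Dfn_map a b c : Dt a -> Dt b -> Dt c -> Dfn (fun e => is_map (a e) (b e) (c e)).
Proof. apply: Dfn_sub3; rewrite /is_map /is_function /is_dom; dfn. Qed.

Lemma Dfn_card_le a b : Dt a -> Dt b -> Dfn (fun e => card_le (a e) (b e)).
Proof.
apply: Dfn_sub2; rewrite /card_le /is_injection /is_map /is_function /is_dom; dfn.
Qed.

Lemma Dfn_card_lt a b : Dt a -> Dt b -> Dfn (fun e => card_lt (a e) (b e)).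
Proof. by move=> Ha Hb; apply: Dfn_and; [|apply: Dfn_not]; apply: Dfn_card_le. Qed.
End Terms3.

Ltac dfn_reg2 := first [simple apply Dfn_function | simple apply Dfn_map
  | simple apply Dfn_card_le | simple apply Dfn_card_lt | dfn_reg1].
Ltac dfn_reg ::= dfn_reg2.

(** * Functions, choice and cardinality inside a model *)

Section Functions.
Context {M : zfc_model}.
Implicit Types (x y z A B f g : M) (F : M -> M).

Lemma in_prod A B z : z ∈ prod A B <-> exists a b, a ∈ A /\ b ∈ B /\ z = opair a b.
Proof.
apply: (comprP (Q := fun z => exists a b, a ∈ A /\ b ∈ B /\ z = opair a b)).
exists (bigU (img A (fun a => img B (fun b => opair a b)))) => w.
rewrite in_bigU; split.
- move=> [y [/in_img]]; case; first dfn.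
  move=> a [Ha ->] /in_img; case; first dfn.
  by move=> b [Hb ->]; exists a, b.
- move=> [a [b [Ha [Hb ->]]]]; exists (img B (fun b => opair a b)); split.
    by apply/in_img; [dfn|exists a].
  by apply/in_img; [dfn|exists b].
Qed.

Lemma in_prod2 A B x y : opair x y ∈ prod A B <-> x ∈ A /\ y ∈ B.
Proof.
rewrite in_prod; split=> [[a [b [Ha [Hb /opair_inj[-> ->]]]]] //|[Ha Hb]].
by exists x, y.
Qed.

Lemma in_lam A F z : Dt (fun e => F (e 0)) ->
  z ∈ lam A F <-> exists x, x ∈ A /\ z = opair x (F x).
Proof. by move=> HF; apply: in_img; dfn. Qed.

Lemma in_lam2 A F x y : Dt (fun e => F (e 0)) ->
  opair x y ∈ lam A F <-> x ∈ A /\ y = F x.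
Proof.
move=> HF; rewrite in_lam //; split=> [[a [Ha /opair_inj[-> ->]]] //|[Ha ->]].
by exists x.
Qed.

Lemma in_ap f x z : z ∈ ap f x <-> exists y, opair x y ∈ f /\ z ∈ y.
Proof.
apply: (comprP (Q := fun z => exists y, opair x y ∈ f /\ z ∈ y)).
exists (sep (bigU (bigU (bigU f))) (fun z => exists y, opair x y ∈ f /\ z ∈ y)) => w.
rewrite in_sep; first dfn.
split=> [[] //|[y [H1 H2]]]; split; last by exists y.
apply/in_bigU; exists y; split=> //; apply/in_bigU; exists (upair x y); split.
  by apply/in_bigU; exists (opair x y); split=> //; apply/in_upair; right.
by apply/in_upair; right.
Qed.

Lemma ap_eq f x y : opair x y ∈ f -> (forall y', opair x y' ∈ f -> y' = y) -> ap f x = y.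
Proof.
move=> H Hu; apply: ext => z; rewrite in_ap; split=> [[w [/Hu -> //]]|Hz].
by exists y.
Qed.

Lemma ap_lam A F x : Dt (fun e => F (e 0)) -> x ∈ A -> ap (lam A F) x = F x.
Proof.
by move=> HF Hx; apply: ap_eq => [|y'] /=; rewrite in_lam2 //; tauto.
Qed.

Lemma ap_fun f x y : is_function f -> opair x y ∈ f -> ap f x = y.
Proof.
by move=> [_ Hf] H; apply: ap_eq => // y' H'; apply: (Hf x); apply/appE.
Qed.

Lemma fun_pair f z : is_function f -> z ∈ f -> exists x y, z = opair x y.
Proof. by move=> [Hf _] /Hf [a [b /is_opairE ->]]; exists a, b. Qed.

Lemma map_app f A B x : is_map f A B -> x ∈ A -> opair x (ap f x) ∈ f.
Proof.
by move=> [Hf [Hd _]] /Hd [y /appE H]; rewrite (ap_fun Hf H).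
Qed.

Lemma map_ap f A B x : is_map f A B -> x ∈ A -> ap f x ∈ B.
Proof. by move=> Hf Hx; have [_ [_ H]] := Hf; apply: (H x); apply/appE; exact: (map_app Hf Hx). Qed.

Lemma map_val f A B x y : is_map f A B -> opair x y ∈ f -> x ∈ A /\ y = ap f x.
Proof.
move=> [Hf [Hd _]] H; split; last by rewrite (ap_fun Hf H).
by apply/Hd; exists y; apply/appE.
Qed.

Lemma lam_map A B F : Dt (fun e => F (e 0)) ->
  (forall x, x ∈ A -> F x ∈ B) -> is_map (lam A F) A B.
Proof.
move=> HF H; split; [split|split].
- by move=> z /in_lam [] // x [Hx ->]; exists x, (F x); apply/is_opairE.
- by move=> x y y' /appE /in_lam2 [] // _ -> /appE /in_lam2 [] // _ ->.
- move=> x; split=> [Hx|[y /appE /in_lam2 []] //].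
  by exists (F x); apply/appE/in_lam2.
- by move=> x y /appE /in_lam2 [] // Hx ->; apply: H.
Qed.

Lemma map_lam f A B : is_map f A B -> f = lam A (ap f).
Proof.
have HD : Dt (fun e => ap f (e 0)) by dfn.
move=> Hf; apply: ext => z; rewrite in_lam //; split.
  move=> Hz; have [Hff _] := Hf; have [x [y E]] := fun_pair Hff Hz; subst z.
  by exists x; have [? ->] := map_val Hf Hz.
by move=> [x [Hx ->]]; exact: (map_app Hf Hx).
Qed.

Lemma choice A B (Q : M -> M -> Prop) : Dfn (fun e => Q (e 0) (e 1)) ->
  (forall x, x ∈ A -> exists y, y ∈ B /\ Q x y) ->
  exists f, is_map f A B /\ forall x, x ∈ A -> Q x (ap f x).
Proof.
move=> HQ H.
(* The axiom of choice is stated for disjoint families; tagging the witnesses with [x] makes the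
   sets [S x] disjoint. *)
pose (S x := sep (prod (upair x x) B) (fun z => exists y, z = opair x y /\ Q x y)).
have HS x z : z ∈ S x <-> exists y, y ∈ B /\ Q x y /\ z = opair x y.
  rewrite in_sep; first dfn; rewrite in_prod; split.
  - move=> [[a [b [_ [Hb E]]]] [y [E2 Hy]]]; exists y; split=> //.
    by move: E; rewrite E2 => /opair_inj[_ ->].
  - move=> [y [Hy [Hq ->]]]; split; last by exists y.
    by exists x, y; split=> //; apply/in_upair; left.
have HDS : Dt (fun e => S (e 0)) by rewrite /S; dfn.
have [y /in_img []|y z /in_img [] // x [Hx ->] /in_img [] // x' [Hx' ->] Hne w|c Hc] :=
    zfc_choice (zm_ax M) (x := img A S).
- by [].
- by move=> x [Hx ->] He; have [w [Hw Hq]] := H _ Hx; apply: (He (opair x w)); apply/HS; exists w.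
- rewrite !HS => -[[y1 [_ [_ ->]]] [y2 [_ [_ /opair_inj[E _]]]]].
  by apply: Hne; rewrite E.
pose (F x := the (fun y => opair x y ∈ c /\ opair x y ∈ S x)).
have HF x : x ∈ A -> opair x (F x) ∈ S x.
  move=> Hx; have [|z [[Hz1 Hz2] Hu]] := Hc (S x); first by apply/in_img; [|exists x].
  have [y [_ [_ E]]] := proj1 (HS _ _) Hz1; subst z.
  rewrite /F (@theP M _ y) //.
  by move=> y' [H1 H2]; have /opair_inj[_ ->] := Hu _ (conj H2 H1).
have HDF : Dt (fun e => F (e 0)) by rewrite /F; dfn.
have HF' x : x ∈ A -> F x ∈ B /\ Q x (F x).
  by move=> /HF /HS [y [Hy [Hq /opair_inj[_ ->]]]].
exists (lam A F); split; first by apply: lam_map => // x /HF' [].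
by move=> x Hx; rewrite ap_lam //; case: (HF' x Hx).
Qed.

Lemma card_leE A B : card_le A B <-> exists f, is_map f A B /\
  forall x x', x ∈ A -> x' ∈ A -> ap f x = ap f x' -> x = x'.
Proof.
split=> -[f [Hf Hi]]; exists f; split=> //.
- move=> x x' Hx Hx' E; apply: (Hi _ _ (ap f x)); apply/appE; first exact: (map_app Hf Hx).
  by rewrite E; exact: (map_app Hf Hx').
- move=> x x' y /appE /(map_val Hf) [Hx ->] /appE /(map_val Hf) [Hx' E].
  exact: Hi.
Qed.

(** A choice function for [Q] is the injection. Cardinality bounds can thus be proved from a
    relation, without defining a map. *)
Lemma card_le_rel A B (Q : M -> M -> Prop) : Dfn (fun e => Q (e 0) (e 1)) ->
  (forall x, x ∈ A -> exists y, y ∈ B /\ Q x y) ->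
  (forall x x' y, x ∈ A -> x' ∈ A -> y ∈ B -> Q x y -> Q x' y -> x = x') -> card_le A B.
Proof.
move=> HQ H Hi; have [f [Hf Hq]] := choice HQ H; apply/card_leE; exists f; split=> //.
move=> x x' Hx Hx' E; apply: (Hi _ _ (ap f x)) => //; first exact: (map_ap Hf Hx).
  exact: Hq.
by rewrite E; apply: Hq.
Qed.

Lemma card_le_sub A B : A ⊆ B -> card_le A B.
Proof.
move=> H; apply: (@card_le_rel A B (fun x y => x = y)); first dfn.
  by move=> x Hx; exists x; split=> //; apply: H.
by move=> x x' y _ _ _ -> ->.
Qed.

Lemma card_le_trans A B C : card_le A B -> card_le B C -> card_le A C.
Proof.
move=> /card_leE [f [Hf If]] /card_leE [g [Hg Ig]].
apply: (@card_le_rel A C (fun x y => y = ap g (ap f x))); first dfn.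
  by move=> x Hx; exists (ap g (ap f x)); split=> //; apply: (map_ap Hg); apply: (map_ap Hf).
move=> x x' y Hx Hx' _ -> E; apply: If => //; apply: Ig => //; exact: (map_ap Hf).
Qed.

Lemma card_le_img A F : Dt (fun e => F (e 0)) -> card_le (img A F) A.
Proof.
move=> HF; apply: (@card_le_rel _ A (fun x y => x = F y)); first dfn.
  by move=> x /in_img [] // y ?; exists y.
by move=> x x' y _ _ _ -> ->.
Qed.

Lemma cantor A : ~ card_le (pow A) A.
Proof.
move=> /card_leE [f [Hf Hi]].
pose (D := sep A (fun x => exists X, X ∈ pow A /\ x = ap f X /\ ~ x ∈ X)).
have HD : D ∈ pow A by apply/in_pow => x; rewrite in_sep; [dfn|case].
have Dx x : x ∈ D <-> x ∈ A /\ exists X, X ∈ pow A /\ x = ap f X /\ ~ x ∈ X.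
  by apply: in_sep; dfn.
have H : ~ ap f D ∈ D.
  by move=> HfD; have /Dx [_ [X [HX [E]]]] := HfD; rewrite -(Hi _ _ HD HX E).
apply: (H); apply/Dx; split; first exact: (map_ap Hf HD).
by exists D.
Qed.

End Functions.

(** * Ordinals and transfinite recursion *)

Section Ordinals.
Context {M : zfc_model}.
Implicit Types (x y z A B f g : M) (F : M -> M) (Q : M -> Prop).

Lemma foundation A x : x ∈ A -> exists y, y ∈ A /\ forall z, z ∈ A -> ~ z ∈ y.
Proof. by move=> Hx; apply: (zfc_foundation (zm_ax M)) => H; apply: (H x). Qed.

Lemma min_elt A x Q : Dfn (fun e => Q (e 0)) -> x ∈ A -> Q x ->
  exists y, y ∈ A /\ Q y /\ forall z, z ∈ A -> z ∈ y -> ~ Q z.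
Proof.
move=> HQ Hx Qx; have [|y [/in_sep]] := @foundation (sep A Q) x; first by apply/in_sep.
case=> // Hy Qy H; exists y; split=> //; split=> // z Hz Hzy Qz.
by apply: (H z) => //; apply/in_sep.
Qed.

Lemma mem_irrefl x : ~ x ∈ x.
Proof.
move=> H; have [|y [/in_upair Hy Hn]] := @foundation (upair x x) x; first by apply/in_upair; left.
have E : y = x by tauto.
by subst y; apply: (Hn x) => //; apply/in_upair; left.
Qed.

Lemma mem_asym x y : x ∈ y -> ~ y ∈ x.
Proof.
move=> H1 H2.
have [|w [/in_upair Hw Hn]] := @foundation (upair x y) x; first by apply/in_upair; left.
case: Hw => E; subst w.
- by apply: (Hn y) => //; apply/in_upair; right.
- by apply: (Hn x) => //; apply/in_upair; left.
Qed.

Lemma mem_asym3 x y z : x ∈ y -> y ∈ z -> ~ z ∈ x.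
Proof.
move=> H1 H2 H3.
have [|w [Hw Hn]] := @foundation (cup (upair x y) (upair z z)) x.
  by apply/in_cup; left; apply/in_upair; left.
have Hx : x ∈ cup (upair x y) (upair z z) by apply/in_cup; left; apply/in_upair; left.
have Hy : y ∈ cup (upair x y) (upair z z) by apply/in_cup; left; apply/in_upair; right.
have Hz : z ∈ cup (upair x y) (upair z z) by apply/in_cup; right; apply/in_upair; left.
move: Hw; rewrite in_cup !in_upair => -[[E|E]|[E|E]]; subst w.
- exact: (Hn z).
- exact: (Hn x).
- exact: (Hn y).
- exact: (Hn y).
Qed.

Lemma ord_trans x y z : is_ordinal x -> y ∈ x -> z ∈ y -> z ∈ x.
Proof. by move=> [H _] Hy Hz; apply: (H y). Qed.

Lemma ord_sub x y : is_ordinal x -> y ∈ x -> y ⊆ x.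
Proof. by move=> [H _] /H. Qed.

Lemma ord_el x y : is_ordinal x -> y ∈ x -> is_ordinal y.
Proof.
move=> Hx Hy; have [Ht Hl] := Hx; split.
- move=> z Hz w Hw.
  have Hzx := ord_trans Hx Hy Hz; have Hwx := ord_trans Hx Hzx Hw.
  case: (Hl w y Hwx Hy) => [//|[E|H]].
    by subst w; case: (mem_asym Hz Hw).
  by case: (mem_asym3 Hz H Hw).
- by move=> z w Hz Hw; apply: Hl; apply: ord_trans Hy _.
Qed.

Lemma ord_psub x y : is_ordinal x -> is_ordinal y -> y ⊆ x -> y <> x -> y ∈ x.
Proof.
move=> Hx Hy Hs Hne.
have [w [Hw Hwy]] : exists w, w ∈ x /\ ~ w ∈ y.
  apply: NNPP => Hn; apply: Hne; apply: sub_antisym => // z Hz.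
  by apply: NNPP => Hzy; apply: Hn; exists z.
have [|m [Hm [Hmy Hmin]]] := @min_elt x w (fun w => ~ w ∈ y) _ Hw Hwy; first dfn.
suff -> : y = m by [].
apply: sub_antisym => z Hz.
- case: (proj2 Hx z m (Hs _ Hz) Hm) => [//|[E|Hmz]]; first by subst z.
  by case: Hmy; apply: ord_trans Hy Hz Hmz.
- by apply: NNPP; apply: Hmin => //; apply: ord_trans Hx Hm Hz.
Qed.

Lemma ord_trich x y : is_ordinal x -> is_ordinal y -> x ∈ y \/ x = y \/ y ∈ x.
Proof.
move=> Hx Hy; pose (m := sep x (fun z => z ∈ y)).
have Hm z : z ∈ m <-> z ∈ x /\ z ∈ y by apply: in_sep; dfn.
have Om : is_ordinal m.
  split=> [z /Hm [Hzx Hzy] w Hw|z w /Hm [Hz _] /Hm [Hw _]].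
    by apply/Hm; split; [apply: ord_trans Hx Hzx Hw|apply: ord_trans Hy Hzy Hw].
  by apply: (proj2 Hx).
case: (classic (m = x)) => [E|Nx]; case: (classic (m = y)) => [E'|Ny].
- by right; left; rewrite -E.
- by left; rewrite -E; apply: ord_psub => // z /Hm [].
- by right; right; rewrite -E'; apply: ord_psub => // z /Hm [].
- have H1 : m ∈ x by apply: ord_psub => // z /Hm [].
  have H2 : m ∈ y by apply: ord_psub => // z /Hm [].
  by case: (@mem_irrefl m); apply/Hm.
Qed.

Lemma ord_lt_or_le x y : is_ordinal x -> is_ordinal y -> x ∈ y \/ y ⊆ x.
Proof.
move=> Hx Hy; case: (ord_trich Hx Hy) => [|[->|H]]; [by left|by right|right].
exact: ord_sub.
Qed.

Lemma ord_le_lt x y z : is_ordinal x -> is_ordinal y -> is_ordinal z ->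
  x ⊆ y -> y ∈ z -> x ∈ z.
Proof.
move=> Hx Hy Hz Hs Hyz; case: (classic (x = y)) => [-> //|N].
by apply: ord_trans Hyz _ => //; apply: ord_psub.
Qed.

Lemma ord_succ x : is_ordinal x -> is_ordinal (succ x).
Proof.
move=> Hx; split.
- move=> y /in_succ [Hy|->] z Hz; apply/in_succ; left => //.
  exact: ord_trans Hx Hy Hz.
- move=> y z /in_succ [Hy|->] /in_succ [Hz|->]; try tauto.
  by apply: (proj2 Hx).
Qed.

Lemma ord_emp : is_ordinal (emp : M).
Proof. by split=> [x /in_emp|x y /in_emp]. Qed.

Lemma ord_bigU A : (forall x, x ∈ A -> is_ordinal x) -> is_ordinal (bigU A).
Proof.
move=> H; split.
- move=> y /in_bigU [x [Hx Hy]] z Hz; apply/in_bigU; exists x; split=> //.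
  exact: ord_trans (H _ Hx) Hy Hz.
- move=> y z /in_bigU [x [Hx Hy]] /in_bigU [x' [Hx' Hz]].
  by apply: ord_trich; [apply: ord_el (H _ Hx) Hy|apply: ord_el (H _ Hx') Hz].
Qed.

Lemma ord_not_set A : exists x, is_ordinal x /\ ~ x ∈ A.
Proof.
pose (B := sep A (@is_ordinal M)).
have HB x : x ∈ B <-> x ∈ A /\ is_ordinal x by apply: in_sep; dfn.
have O : is_ordinal (succ (bigU B)) by apply: ord_succ; apply: ord_bigU => x /HB [].
exists (succ (bigU B)); split=> // H.
apply: (@mem_irrefl (bigU B)); apply/in_bigU; exists (succ (bigU B)).
by split; [apply/HB|apply/in_succ; right].
Qed.

Lemma ord_least Q x : Dfn (fun e => Q (e 0)) -> is_ordinal x -> Q x ->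
  exists y, is_ordinal y /\ Q y /\ y ⊆ x /\ forall z, z ∈ y -> ~ Q z.
Proof.
move=> HQ Hx Qx; have Os := ord_succ Hx.
have [|y [Hy [Qy Hmin]]] := @min_elt (succ x) x Q HQ _ Qx; first by apply/in_succ; right.
have Oy := ord_el Os Hy; exists y; split=> //; split=> //; split.
  by move: Hy => /in_succ [/(ord_sub Hx)|->].
move=> z Hz; apply: Hmin => //; exact: ord_trans Os Hy Hz.
Qed.

Lemma ord_ind Q : Dfn (fun e => Q (e 0)) ->
  (forall x, is_ordinal x -> (forall y, y ∈ x -> Q y) -> Q x) ->
  forall x, is_ordinal x -> Q x.
Proof.
move=> HQ H x Hx; apply: NNPP => N.
have [|y [Oy [Ny [_ Hmin]]]] := @ord_least (fun x => ~ Q x) x _ Hx N; first dfn.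
by apply: Ny; apply: H => // z Hz; apply: NNPP; apply: Hmin.
Qed.

Definition least Q : M := the (fun x => is_ordinal x /\ Q x /\ forall y, y ∈ x -> ~ Q y).

Lemma leastP Q x : Dfn (fun e => Q (e 0)) -> is_ordinal x -> Q x ->
  is_ordinal (least Q) /\ Q (least Q) /\ least Q ⊆ x /\ forall y, y ∈ least Q -> ~ Q y.
Proof.
move=> HQ Hx Qx; have [y [Oy [Qy [Hyx Hmin]]]] := ord_least HQ Hx Qx.
suff -> : least Q = y by [].
apply: theP => // z [Oz [Qz Hz]].
by case: (ord_trich Oz Oy) => [/Hmin //|[//|/Hz]].
Qed.

Section Recursion.
Variable G : M -> M -> M.
Hypothesis HG : Dt (fun e => G (e 0) (e 1)).

(** The first conjunct says that [f] is a function with domain exactly [a], which makes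
    approximations unique and lets [the] select them. *)
Definition rec_good a f : Prop :=
  f = lam a (fun x => ap f x) /\ forall x, x ∈ a -> ap f x = G x (lam x (fun y => ap f y)).

Definition rec_approx a : M := the (rec_good a).

Definition trec a : M := G a (rec_approx a).

Lemma Dfn_rec_good : Dfn (fun e => rec_good (e 0) (e 1)).
Proof. rewrite /rec_good; dfn. Qed.

Lemma Dt_rec_approx : Dt (fun e => rec_approx (e 0)).
Proof. have H := Dfn_rec_good; rewrite /rec_approx; dfn. Qed.

Lemma Dt_trec a : Dt a -> Dt (fun e => trec (a e)).
Proof. have H := Dt_rec_approx; apply: Dt_sub1; rewrite /trec; dfn. Qed.

Lemma lam_eq A F F' : Dt (fun e => F (e 0)) -> Dt (fun e => F' (e 0)) ->
  (forall x, x ∈ A -> F x = F' x) -> lam A F = lam A F'.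
Proof.
move=> HF HF' H; apply: ext => z; rewrite !in_lam //.
by split=> -[x [Hx ->]]; exists x; rewrite H.
Qed.

Lemma rec_good_uniq a : is_ordinal a -> forall f g, rec_good a f -> rec_good a g -> f = g.
Proof.
move=> Oa f g [Ef Hf] [Eg Hg].
have H : forall x, is_ordinal x -> x ∈ a -> ap f x = ap g x.
  apply: ord_ind; first dfn.
  move=> x Ox IH Hx; rewrite Hf // Hg //; congr (G x _).
  apply: lam_eq; try dfn.
  by move=> y Hy; apply: IH => //; apply: ord_trans Hx Hy.
rewrite Ef Eg; apply: lam_eq; try dfn.
by move=> x Hx; apply: H => //; apply: ord_el Hx.
Qed.

Lemma rec_approxE a : is_ordinal a -> rec_approx a = lam a trec /\ rec_good a (rec_approx a).
Proof.
have HR := Dt_rec_approx; have HgD := Dfn_rec_good.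
have HT : Dt (fun e => trec (e 0)) by apply: Dt_trec; dfn.
have H : forall a, is_ordinal a -> rec_good a (lam a trec).
  apply: ord_ind; first dfn.
  move=> {}a Oa IH; split.
    by apply: lam_eq; try dfn; move=> x Hx; rewrite ap_lam //; dfn.
  move=> x Hx; rewrite ap_lam //.
  rewrite {1}/trec; congr (G x _).
  have Ox := ord_el Oa Hx.
  have -> : lam x (fun y => ap (lam a trec) y) = lam x trec.
    apply: lam_eq; try dfn.
    by move=> y Hy; rewrite ap_lam //; apply: ord_trans Hx Hy.
  apply: theP; first exact: IH.
  by move=> f Hf; apply: (rec_good_uniq Ox) => //; apply: IH.
move=> Oa; have E : rec_approx a = lam a trec.
  by apply: theP => [|f Hf]; [apply: H|apply: (rec_good_uniq Oa) => //; apply: H].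
by rewrite E; split=> //; apply: H.
Qed.

Lemma trecE a : is_ordinal a -> trec a = G a (lam a trec).
Proof. by move=> Oa; rewrite {1}/trec (proj1 (rec_approxE Oa)). Qed.

End Recursion.

Lemma well_order A : exists x f, is_ordinal x /\ is_map f x A /\
  (forall y y', y ∈ x -> y' ∈ x -> ap f y = ap f y' -> y = y') /\
  (forall a, a ∈ A -> exists y, y ∈ x /\ ap f y = a).
Proof.
have [||c [Hc Hcc]] := @choice _ (sep (pow A) (fun X => exists a, a ∈ X)) A (fun X a => a ∈ X).
- dfn.
- move=> X /in_sep; case; first dfn.
  by move=> /in_pow HX [a Ha]; exists a; split=> //; apply: HX.
have {}Hcc X : X ⊆ A -> (exists a, a ∈ X) -> ap c X ∈ X.
  by move=> HX Ha; apply: Hcc; apply/in_sep; [dfn|split=> //; apply/in_pow].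
pose (rest r := sep A (fun a => ~ exists y, opair y a ∈ r)).
have Hrest r a : a ∈ rest r <-> a ∈ A /\ ~ exists y, opair y a ∈ r by apply: in_sep; dfn.
pose (G := fun x r : M => ap c (rest r)).
have HG : Dt (fun e => G (e 0) (e 1)) by rewrite /G /rest; dfn.
pose (h := trec G).
have Hh : Dt (fun e => h (e 0)) by apply: Dt_trec => //; dfn.
have HR x a : a ∈ rest (lam x h) <-> a ∈ A /\ forall y, y ∈ x -> h y <> a.
  rewrite Hrest; split=> -[Ha Hn]; split=> //.
  - by move=> y Hy E; apply: Hn; exists y; apply/in_lam2.
  - by move=> [y /in_lam2 [] // Hy E]; apply: (Hn y).
have Hstep x : is_ordinal x -> (exists a, a ∈ rest (lam x h)) -> h x ∈ rest (lam x h).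
  move=> Ox Hx; rewrite /h trecE // /G; apply: Hcc => // a.
  by rewrite Hrest; case.
pose (full x := ~ exists a, a ∈ rest (lam x h)).
have Dfull : Dfn (fun e => full (e 0)) by rewrite /full /rest; dfn.
have Hinj x y : is_ordinal x -> ~ full x -> y ∈ x -> h y <> h x.
  by move=> Ox /NNPP /(Hstep _ Ox) /HR [_ H] /H.
case: (classic (exists x, is_ordinal x /\ full x)) => [[x [Ox Fx]]|N].
- have {x Ox Fx} [x [Ox [Fx [_ Hmin]]]] := ord_least Dfull Ox Fx.
  exists x, (lam x h); split=> //; split.
    apply: lam_map => // y Hy.
    by have /HR [] := Hstep _ (ord_el Ox Hy) (NNPP _ (Hmin _ Hy)).
  split.
    move=> y y' Hy Hy'; rewrite !ap_lam // => E.
    have Oy := ord_el Ox Hy; have Oy' := ord_el Ox Hy'.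
    case: (ord_trich Oy Oy') => [H|[//|H]].
      by case: (@Hinj y' y) => //; apply: Hmin.
    by case: (@Hinj y y') => //; apply: Hmin.
  move=> a Ha; apply: NNPP => Nn; apply: Fx; exists a; apply/HR; split=> // y Hy E.
  by apply: Nn; exists y; rewrite ap_lam.
- have NF x : is_ordinal x -> ~ full x by move=> Ox Fx; apply: N; exists x.
  (* If the enumeration never exhausted [A], sending each element to the least stage that reaches it
     would put every ordinal into an image of [A]. *)
  have [x [Ox Hx]] := ord_not_set (img A (fun a => least (fun x => h x = a))).
  case: Hx; apply/in_img; first by rewrite /least; dfn.
  have /HR [HxA _] := Hstep x Ox (NNPP _ (NF x Ox)).
  exists (h x); split=> //; symmetry.
  have [||Ol [El [Hl _]]] := @leastP (fun z => h z = h x) x _ Ox; first dfn; first by [].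
  case: (ord_trich Ol Ox) => [H|[//|H]]; first by case: (Hinj _ _ Ox (NF x Ox) H).
  by case: (mem_irrefl (Hl _ H)).
Qed.

Lemma card_ord A : exists x, is_ordinal x /\ card_le A x /\ card_le x A.
Proof.
have [x [f [Ox [Hf [Hi Hs]]]]] := well_order A; exists x; split=> //; split.
- apply: (@card_le_rel _ A x (fun a y => ap f y = a)); first dfn.
    by [].
  by move=> a a' y _ _ _ <- <-.
- by apply/card_leE; exists f.
Qed.

End Ordinals.

Section Inaccessible_definable.
Context {M : zfc_model}.

Lemma Dt_least (Q : M -> (nat -> M) -> Prop) :
  Dfn (fun e => Q (e 0) (fun n => e (S n))) -> Dt (fun e => least (fun x => Q x e)).
Proof.
move=> HQ; rewrite /least.
apply: (@Dt_the _ (fun x e => is_ordinal x /\ Q x e /\ forall y, y ∈ x -> ~ Q y e)).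
apply: Dfn_and; first dfn; apply: Dfn_and => //.
apply: (@Dfn_all _ (fun y e => y ∈ e 0 -> ~ Q y (fun n => e (S n)))).
apply: Dfn_imp; first dfn; apply: Dfn_not.
exact: (Dfn_remap (fun n => match n with 0 => 0 | S m => S (S m) end) HQ).
Qed.

Lemma Dfn_inaccessible (a : (nat -> M) -> M) : Dt a -> Dfn (fun e => inaccessible (a e)).
Proof.
apply: Dfn_sub1; rewrite /inaccessible /uncountable_cardinal /is_cardinal /is_omega /is_limit
  /is_regular /is_strong_limit /is_power; dfn.
Qed.

End Inaccessible_definable.

Ltac dfn_reg3 := first [simple apply Dt_least | simple apply Dfn_inaccessible | dfn_reg2].
Ltac dfn_reg ::= dfn_reg3.

(** * Sets of size less than a cardinal *)

Section Small.
Context {M : zfc_model}.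
Implicit Types (x y z A B f g : M) (F : M -> M) (Q : M -> Prop).

Lemma the_none Q : (forall z, ~ Q z) -> the Q = emp.
Proof.
move=> H; apply: ext => z; split=> [|/in_emp //].
have HH : exists y : M, forall x, x ∈ y <-> exists z, (Q z /\ forall z', Q z' -> z' = z) /\ x ∈ z.
  by exists emp => x; split=> [/in_emp //|[w [[/H]]]].
by move=> /(comprP HH) [w [[/H]]].
Qed.

Lemma is_powerE (P x : M) : is_power P x <-> P = pow x.
Proof.
split=> [H|->]; last by move=> w; apply: in_pow.
by apply: ext => w; rewrite in_pow; apply: H.
Qed.

Lemma card_le_pow_self A : card_le A (pow A).
Proof.
apply: (@card_le_rel _ _ _ (fun x y => y = upair x x)); first dfn.
- move=> x Hx; exists (upair x x); split=> //; apply/in_pow => y /in_upair.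
  by case=> ->.
- move=> x x' y _ _ _ -> E.
  by have /in_upair [] : x ∈ upair x' x' by rewrite -E; apply/in_upair; left.
Qed.

Lemma card_le_pow A B : card_le A B -> card_le (pow A) (pow B).
Proof.
move=> /card_leE [f [Hf Hi]].
have HD : Dt (fun e => ap f (e 0)) by dfn.
apply: (@card_le_rel _ _ _ (fun X Y => Y = img X (fun x => ap f x))); first dfn.
- move=> X /in_pow HX; exists (img X (fun x => ap f x)); split=> //.
  by apply/in_pow => y /in_img [] // x [/HX Hx ->]; apply: (map_ap Hf).
- move=> X X' Y /in_pow HX /in_pow HX' _ -> E.
  have aux Z Z' : Z ⊆ A -> Z' ⊆ A -> img Z (fun x => ap f x) = img Z' (fun x => ap f x) -> Z ⊆ Z'.
    move=> HZ HZ' EZ x Hx; have : ap f x ∈ img Z (fun x => ap f x) by apply/in_img; [|exists x].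
    rewrite EZ => /in_img [] // x' [Hx' /Hi -> //]; [exact: HZ|exact: HZ'].
  by apply: sub_antisym; apply: aux.
Qed.

Lemma ord_emp_mem x : is_ordinal x -> ~ is_empty x -> emp ∈ x.
Proof.
move=> Ox Hx; apply: ord_psub => //; [exact: ord_emp|by move=> y /in_emp|].
by move=> E; apply: Hx; rewrite -E => y /in_emp.
Qed.

Lemma limit_succ x y : is_limit x -> y ∈ x -> succ y ∈ x.
Proof.
move=> [Ox [_ H]] Hy; have [z [Hz Hyz]] := H _ Hy.
have Oy := ord_el Ox Hy; have Oz := ord_el Ox Hz.
apply: (@ord_le_lt _ _ z) => //; first exact: ord_succ.
move=> w /in_succ [Hw|-> //]; exact: ord_trans Oz Hyz Hw.
Qed.

Lemma omega_cases (w n : M) : is_omega w -> n ∈ w -> n = emp \/ exists m, m ∈ w /\ n = succ m.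
Proof.
move=> [[Ow _] Hw] Hn; have On := ord_el Ow Hn.
case: (classic (is_empty n)) => [He|Hne].
  by left; apply: ext => z; split=> [/He|/in_emp].
right; have [m [Hm Hmn]] : exists m, m ∈ n /\ forall z, z ∈ n -> ~ m ∈ z.
  apply: NNPP => N; apply: (Hw n) => //; split; [exact: On|split=> // y Hy].
  by apply: NNPP => N'; apply: N; exists y; split=> // z Hz Hyz; apply: N'; exists z.
exists m; split; first exact: ord_trans Ow Hn Hm.
apply: sub_antisym => z; rewrite in_succ.
- move=> Hz; case: (ord_trich (ord_el On Hz) (ord_el On Hm)) => [|[|/(Hmn _ Hz)]]; tauto.
- by case=> [Hz|-> //]; apply: ord_trans On Hm Hz.
Qed.

(** [card_lt x k] without its negative half, equivalent to it when [k] is a cardinal ([sm_iff]).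
    This form passes along injections and, for ground model sets, to the extension. *)
Definition sm (k x : M) : Prop := exists e, e ∈ k /\ card_le x e.

Lemma sm_iff k x : is_cardinal k -> card_lt x k <-> sm k x.
Proof.
move=> [Ok Hk]; split.
- move=> [_ Hn]; have [e [Oe [H1 H2]]] := card_ord x; exists e; split=> //.
  case: (ord_lt_or_le Oe Ok) => // /card_le_sub H; case: Hn.
  exact: card_le_trans H H2.
- move=> [e [He H]]; have [H1 H2] := Hk _ He; split; first exact: card_le_trans H H1.
  by move=> H3; apply: H2; apply: card_le_trans H3 H.
Qed.

Lemma sm_le k x y : card_le y x -> sm k x -> sm k y.
Proof. by move=> H [e [He H']]; exists e; split=> //; apply: card_le_trans H H'. Qed.

Lemma sm_sub k x y : y ⊆ x -> sm k x -> sm k y.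
Proof. by move=> /card_le_sub; apply: sm_le. Qed.

Lemma sm_img k x F : Dt (fun e => F (e 0)) -> sm k x -> sm k (img x F).
Proof. by move=> HF; apply: sm_le; apply: card_le_img. Qed.

Lemma sm_el k x : x ∈ k -> sm k x.
Proof. by move=> H; exists x; split=> //; apply: card_le_sub. Qed.

Lemma sm_trans k k' x : is_ordinal k' -> k ∈ k' -> sm k x -> sm k' x.
Proof. by move=> Ok Hk [e [He H]]; exists e; split=> //; apply: ord_trans Hk He. Qed.

Section Regular.
Variable k : M.
Hypotheses (Uk : uncountable_cardinal k) (Rk : is_regular k).

Lemma k_card : is_cardinal k. Proof. by case: Uk. Qed.
Lemma k_ord : is_ordinal k. Proof. by case: k_card. Qed.

Lemma k_emp : emp ∈ k.
Proof.
have [_ [w [_ Hw]]] := Uk; apply: ord_emp_mem; [exact: k_ord|].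
by move=> H; apply: (H w).
Qed.

Lemma k_one : succ emp ∈ k.
Proof.
have [_ [w [[Lw _] Hw]]] := Uk; have [Ow [Nw _]] := Lw.
apply: ord_trans Hw _; first exact: k_ord.
by apply: limit_succ => //; apply: ord_emp_mem.
Qed.

Lemma sm_bound x F : Dt (fun e => F (e 0)) -> sm k x -> (forall a, a ∈ x -> F a ∈ k) ->
  exists b, b ∈ k /\ forall a, a ∈ x -> F a ∈ b.
Proof.
move=> HF [e [He /card_leE [f [Hf Hi]]]] H.
(* Regularity speaks of maps on ordinals, so [F] is transported along the injection of [x] into [e].
   Off its range [h] is [emp], which also lies in [k]. *)
pose (h n := the (fun z => exists a, a ∈ x /\ ap f a = n /\ z = F a)).
have Hh : Dt (fun e => h (e 0)) by rewrite /h; dfn.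
have Ea a : a ∈ x -> h (ap f a) = F a.
  move=> Ha; apply: theP; first by exists a.
  by move=> z' [a' [Ha' [E ->]]]; rewrite (Hi _ _ Ha' Ha E).
have Hmap : is_map (lam e h) e k.
  apply: lam_map => // n Hn; case: (classic (exists a, a ∈ x /\ ap f a = n)) => [[a [Ha <-]]|N].
    by rewrite Ea //; apply: H.
  rewrite /h the_none; first by move=> z [a [Ha [E _]]]; apply: N; exists a.
  exact: k_emp.
have [b [Hb Hbb]] := Rk He Hmap; exists b; split=> // a Ha.
by apply: (Hbb (ap f a)); apply/appE/in_lam2 => //; split; [apply: (map_ap Hf)|rewrite Ea].
Qed.

(** Regularity applied to a constant function on 1 gives a bound in [k] strictly above [a], so [k]
    is a limit. *)
Lemma k_succ a : a ∈ k -> succ a ∈ k.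
Proof.
move=> Ha; have [|||b [Hb H]] := @sm_bound (succ emp) (fun _ => a).
- dfn.
- exact: sm_el k_one.
- by [].
have Hab : a ∈ b by apply: (H emp); apply/in_succ; right.
have Ob := ord_el k_ord Hb.
apply: (@ord_le_lt _ _ b) => //; [exact: ord_succ (ord_el k_ord Ha)|exact: k_ord|].
move=> w /in_succ [Hw|-> //]; exact: ord_trans Ob Hab Hw.
Qed.

Lemma sm_upair x y : sm k (upair x y).
Proof.
exists (succ (succ emp)); split; first exact: k_succ k_one.
apply: (@card_le_rel _ _ _ (fun z w => (z = x /\ w = emp) \/ (z = y /\ w = succ emp))); first dfn.
- move=> z /in_upair [->|->]; [exists emp|exists (succ emp)]; split; try tauto.
    by apply/in_succ; left; apply/in_succ; right.
  by apply/in_succ; right.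
- have N : emp <> succ (emp : M) by move=> E; have : emp ∈ succ (emp : M) by [apply/in_succ; right]; rewrite -E => /in_emp.
  move=> z z' w _ _ _ [[-> E]|[-> E]] [[-> E']|[-> E']] //; case: N; congruence.
Qed.

Lemma k_max a b : a ∈ k -> b ∈ k -> exists c, c ∈ k /\ a ⊆ c /\ b ⊆ c.
Proof.
move=> Ha Hb; case: (ord_lt_or_le (ord_el k_ord Ha) (ord_el k_ord Hb)) => H.
  by exists b; split=> //; split=> //; apply: ord_sub (ord_el k_ord Hb) H.
by exists a; split=> //; split.
Qed.

Section StrongLimit.
Hypothesis Sk : is_strong_limit k.

Lemma sm_pow x : sm k x -> sm k (pow x).
Proof.
move=> [e [He H]]; apply: sm_le (card_le_pow H) _.
by apply/sm_iff; [exact: k_card|apply: Sk He _; apply/is_powerE].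
Qed.

Lemma sm_prod x y : sm k x -> sm k y -> sm k (prod x y).
Proof.
move=> [e [He /card_leE [f [Hf If]]]] [e' [He' /card_leE [g [Hg Ig]]]].
have [c [Hc [Hec He'c]]] := k_max He He'.
(* Kuratowski pairs of elements of [c] are elements of [pow (pow c)], so the strong limit property
   bounds the product. *)
have Hs : sm k (pow (pow c)) by do 2 apply: sm_pow; apply: sm_el.
apply: sm_le Hs.
apply: (@card_le_rel _ _ _ (fun z w => exists a b, a ∈ x /\ b ∈ y /\ z = opair a b /\ w = opair (ap f a) (ap g b))); first dfn.
- move=> z /in_prod [a [b [Ha [Hb ->]]]]; exists (opair (ap f a) (ap g b)); split; last by exists a, b.
  have H1 : ap f a ∈ c by apply: Hec; apply: (map_ap Hf).
  have H2 : ap g b ∈ c by apply: He'c; apply: (map_ap Hg).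
  apply/in_pow => w /in_upair [->|->]; apply/in_pow => v /in_upair [->|->] //.
- move=> z z' w _ _ _ [a [b [Ha [Hb [-> ->]]]]] [a' [b' [Ha' [Hb' [-> /opair_inj [E E']]]]]].
  by rewrite (If _ _ Ha Ha' E) (Ig _ _ Hb Hb' E').
Qed.

Lemma sm_bigU A : sm k A -> (forall a, a ∈ A -> sm k a) -> sm k (bigU A).
Proof.
move=> HA H; pose (E := fun a : M => least (fun e : M => card_le a e)).
have HE : Dt (fun e => E (e 0)) by rewrite /E; dfn.
have [|b [Hb Hbb]] := sm_bound HE HA.
  move=> a /H [e [He Hae]]; have Oe := ord_el k_ord He.
  have [|//|O [_ [Hs _]]] := @leastP _ (fun e => card_le a e) e _ Oe; first dfn.
  exact: (ord_le_lt O Oe k_ord Hs He).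
have Ob := ord_el k_ord Hb.
have Hab a : a ∈ A -> card_le a b.
  move=> Ha; have [e [He Hae]] := H _ Ha.
  have [|//|O [Hle [Hs _]]] := @leastP _ (fun e => card_le a e) e _ (ord_el k_ord He); first dfn.
  by apply: card_le_trans Hle _; apply: card_le_sub; apply: ord_sub (Hbb _ Ha).
(* By regularity one [b] bounds the sizes of all members. With injections into [b] chosen
   simultaneously, a point of the union is coded by a member containing it and its index there. *)
have [||phi [Hp Hpp]] := @choice _ A (pow (prod (bigU A) b)) (fun a f => is_map f a b /\
    forall x x', x ∈ a -> x' ∈ a -> ap f x = ap f x' -> x = x'); first dfn.
  move=> a Ha; have /card_leE [f [Hf Hi]] := Hab _ Ha; exists f; split=> //.
  apply/in_pow => z; rewrite (map_lam Hf) => /in_lam []; first dfn.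
  move=> x [Hx ->]; apply/in_prod2; split; last exact: (map_ap Hf).
  by apply/in_bigU; exists a.
apply: (@sm_le _ (prod A b)); last by apply: sm_prod => //; apply: sm_el.
apply: (@card_le_rel _ _ _ (fun z w => exists a, a ∈ A /\ z ∈ a /\ w = opair a (ap (ap phi a) z))); first dfn.
- move=> z /in_bigU [a [Ha Hz]]; exists (opair a (ap (ap phi a) z)); split; last by exists a.
  apply/in_prod2; split=> //; apply: (map_ap (A := a)) => //; by case: (Hpp _ Ha).
- move=> z z' w _ _ _ [a [Ha [Hz ->]]] [a' [Ha' [Hz' /opair_inj [Ea Ez]]]]; subst a'.
  by have [_ Hi] := Hpp _ Ha; apply: Hi.
Qed.

Lemma sm_cup x y : sm k x -> sm k y -> sm k (cup x y).
Proof.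
move=> Hx Hy; apply: sm_bigU; first exact: sm_upair.
by move=> z /in_upair [->|->].
Qed.

End StrongLimit.
End Regular.

(** The last hypothesis does double duty: it gives the strong limit property and, since [a] injects
    into [pow a], also that [g] is a cardinal. *)
Lemma inaccessible_intro (g w : M) : is_ordinal g -> is_omega w -> w ∈ g -> is_regular g ->
  (forall a, a ∈ g -> ~ card_le g (pow a)) -> inaccessible g.
Proof.
move=> Og Ow Hw Rg Hp.
have Cg : is_cardinal g.
  split=> // a Ha; split; first by apply: card_le_sub; apply: ord_sub.
  by move=> H; apply: (Hp _ Ha); apply: card_le_trans H (card_le_pow_self _).
split; first by split=> //; exists w.
split=> // a P Ha /is_powerE ->; apply/sm_iff => //.
have [e [Oe [H1 H2]]] := card_ord (pow a); exists e; split=> //.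
case: (ord_lt_or_le Oe Og) => // /card_le_sub H; case: (Hp _ Ha).
exact: card_le_trans H H2.
Qed.

End Small.

(** * Fine measures *)

Section Almost_every.
Context {M : zfc_model} (Y U : M).

Definition ae (Q : M -> Prop) : Prop := sep Y Q ∈ U.

Lemma Dfn_ae (Q : M -> (nat -> M) -> Prop) :
  Dfn (fun e => Q (e 0) (fun n => e (S n))) -> Dfn (fun e => ae (fun x => Q x e)).
Proof.
by move=> HQ; apply: Dfn_mem; [apply: Dt_sep => //|]; exact: Dt_const.
Qed.

End Almost_every.

Ltac dfn_reg4 := first [simple apply Dfn_ae | dfn_reg3].
Ltac dfn_reg ::= dfn_reg4.

Section Measure.
Context {M : zfc_model} (k th Y U : M).
Hypotheses (Uk : uncountable_cardinal k) (Rk : is_regular k)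
  (kth : k ⊆ th) (HY : is_Pkl Y k th)
  (HU : is_ultrafilter U Y) (HC : is_complete k U)
  (HF : forall a X : M, a ∈ th -> (forall x : M, x ∈ X <-> x ∈ Y /\ a ∈ x) -> X ∈ U).
Implicit Types (x y z A B f g : M) (P Q : M -> Prop).
Notation ae := (ae Y U).

Let Ok : is_ordinal k := k_ord Uk.
Let Ck : is_cardinal k := k_card Uk.

Lemma ae_mono P Q : Dfn (fun e => P (e 0)) -> Dfn (fun e => Q (e 0)) ->
  ae P -> (forall y, y ∈ Y -> P y -> Q y) -> ae Q.
Proof.
move=> HP HQ H HPQ; apply: (uf_up HU H) => y /in_sep []; try by [].
by move=> Hy Hp; apply/in_sep => //; split=> //; apply: HPQ.
Qed.

Lemma ae_full Q : Dfn (fun e => Q (e 0)) -> (forall y, y ∈ Y -> Q y) -> ae Q.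
Proof.
move=> HQ H; apply: (uf_up HU (uf_full HU)) => y; last by move=> /in_sep [].
by move=> Hy; apply/in_sep => //; split=> //; apply: H.
Qed.

Lemma ae_and P Q : Dfn (fun e => P (e 0)) -> Dfn (fun e => Q (e 0)) ->
  ae P -> ae Q -> ae (fun y => P y /\ Q y).
Proof.
move=> HP HQ H1 H2; apply: (uf_inter HU H1 H2) => y.
rewrite !in_sep //; first dfn; tauto.
Qed.

Lemma ae_em Q : Dfn (fun e => Q (e 0)) -> ae Q \/ ae (fun y => ~ Q y).
Proof.
move=> HQ; apply: (uf_ultra HU) => y; first by move=> /in_sep [].
rewrite !in_sep //; first dfn; tauto.
Qed.

Lemma ae_ex Q : Dfn (fun e => Q (e 0)) -> ae Q -> exists y, y ∈ Y /\ Q y.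
Proof.
move=> HQ H; apply: NNPP => N; apply: (uf_proper HU H) => y /in_sep [] // Hy Qy.
by apply: N; exists y.
Qed.

Lemma ae_all S (Q : M -> M -> Prop) : Dfn (fun e => Q (e 0) (e 1)) -> sm k S ->
  (forall s, s ∈ S -> ae (Q s)) -> ae (fun y => forall s, s ∈ S -> Q s y).
Proof.
(* [is_complete] speaks of nonempty families only, hence the separate case of empty [S]. *)
move=> HQ HS H; case: (classic (exists s, s ∈ S)) => [[s0 Hs0]|N]; last first.
  by apply: ae_full; first dfn; move=> y _ s Hs; case: N; exists s.
have HD : Dt (fun e => sep Y (Q (e 0))) by dfn.
have HD1 s : Dfn (fun e => Q s (e 0)) by dfn.
apply: (HC (A := img S (fun s => sep Y (Q s)))).
- by move=> X /in_img [] // s [/H Hs ->].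
- by move=> He; apply: (He (sep Y (Q s0))); apply/in_img => //; exists s0.
- by apply/sm_iff => //; apply: sm_img.
- move=> x; rewrite in_sep; first dfn; split.
    by move=> [Hx Hq] X /in_img [] // s [Hs ->]; apply/in_sep => //; split=> //; apply: Hq.
  move=> Hx.
  have Hs s : s ∈ S -> x ∈ Y /\ Q s x.
    by move=> Hs; apply/in_sep => //; apply: Hx; apply/in_img => //; exists s.
  by split; [case: (Hs _ Hs0)|move=> s /Hs []].
Qed.

Lemma ae_fine a : a ∈ th -> ae (fun y => a ∈ y).
Proof. by move=> Ha; apply: (HF Ha) => x; apply: in_sep; dfn. Qed.

Lemma ae_const S (F : M -> M) : Dt (fun e => F (e 0)) -> sm k S ->
  ae (fun y => F y ∈ S) -> exists s, s ∈ S /\ ae (fun y => F y = s).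
Proof.
move=> HD HS H; apply: NNPP => N.
have H' : ae (fun y => forall s, s ∈ S -> F y <> s).
  apply: (@ae_all S (fun s y => F y <> s)) => //; first dfn.
  move=> s Hs; case: (@ae_em (fun y => F y = s)); [dfn| |by []].
  by move=> Hq; case: N; exists s.
have [|||y [Hy [H1 H2]]] := ae_ex _ (ae_and _ _ H H'); try dfn.
exact: (H2 (F y)).
Qed.

Lemma ae_uniq (F : M -> M) s s' : Dt (fun e => F (e 0)) ->
  ae (fun y => F y = s) -> ae (fun y => F y = s') -> s = s'.
Proof.
by move=> HD H H'; have [|||y [_ [<- <-]]] := ae_ex _ (ae_and _ _ H H'); try dfn.
Qed.

(** Membership in [F y] is decided separately for each element of [a]. Applying [ae_const] to
    [pow a] would presuppose that [pow a] is small, which is what [measure_pow] derives from this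
    lemma. *)
Lemma ae_const_sub a (F : M -> M) : Dt (fun e => F (e 0)) -> sm k a ->
  ae (fun y => F y ⊆ a) -> exists X, X ⊆ a /\ ae (fun y => F y = X).
Proof.
move=> HD Ha H; pose (X := sep a (fun z => ae (fun y => z ∈ F y))).
have HX z : z ∈ X <-> z ∈ a /\ ae (fun y => z ∈ F y) by apply: in_sep; dfn.
exists X; split; first by move=> z /HX [].
have H1 : ae (fun y => forall z, z ∈ a -> (z ∈ F y <-> z ∈ X)).
  apply: (@ae_all a (fun z y => z ∈ F y <-> z ∈ X)) => //; first dfn.
  move=> z Hz; case: (@ae_em (fun y => z ∈ F y)); first dfn.
    by move=> Hq; apply: ae_mono (Hq) _; [dfn|dfn|move=> y _ Hzy; rewrite HX; tauto].
  move=> Hq; have Nz : ~ z ∈ X.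
    move=> /HX [_ Hq']; have [|||y [_ [? ?]]] := ae_ex _ (ae_and _ _ Hq Hq'); try dfn; tauto.
  by apply: ae_mono Hq _; [dfn|dfn|move=> y _ Hzy; tauto].
apply: ae_mono (ae_and _ _ H H1) _; try dfn.
move=> y _ [Hs He]; apply: ext => z; split=> [Hz|Hz]; first by apply/He => //; apply: Hs.
by apply/He => //; move/HX: Hz => [].
Qed.

(** Since [y] has size less than [k], it misses an ordinal below [k]; fineness pushes the least such
    ordinal past any given bound. This supplies the first unbounded function into [k]. *)
Definition rho y : M := least (fun a => ~ a ∈ y).

Lemma Dt_rho : Dt (fun e => rho (e 0)).
Proof. rewrite /rho; dfn. Qed.

Lemma rhoP y : y ∈ Y -> rho y ∈ k /\ ~ rho y ∈ y.
Proof.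
move=> /HY [_ [_ Hc]].
have [a [Ha Hay]] : exists a, a ∈ k /\ ~ a ∈ y.
  apply: NNPP => N; apply: Hc; apply: card_le_sub => a Ha.
  by apply: NNPP => Nn; apply: N; exists a.
have Oa := ord_el Ok Ha.
have [|O [H1 [H2 _]]] := @leastP _ (fun a => ~ a ∈ y) a _ Oa Hay; first dfn.
by split=> //; apply: ord_le_lt H2 Ha.
Qed.

Lemma ae_rho a : a ∈ k -> ae (fun y => a ∈ rho y).
Proof.
move=> Ha; have HR := Dt_rho.
have H : ae (fun y => forall b, b ∈ succ a -> b ∈ y).
  apply: (@ae_all (succ a) (fun b y => b ∈ y)); first dfn.
    by apply: sm_el; apply: k_succ.
  move=> b Hb; apply: ae_fine; apply: kth; apply: (ord_trans Ok _ Hb); exact: k_succ.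
apply: ae_mono H _; try dfn.
move=> y /rhoP [H1 H2] H3; have Oa := ord_el Ok Ha; have Or := ord_el Ok H1.
case: (ord_trich Oa Or) => [//|[E|H]]; case: H2; apply: H3; apply/in_succ; auto.
Qed.

(** Given an injection [f], the subset [f (rho y)] of [a] is constant almost everywhere; hence so is
    [rho], although it is unbounded. *)
Lemma measure_pow a : a ∈ k -> ~ card_le k (pow a).
Proof.
move=> Ha /card_leE [f [Hf Hi]]; have HR := Dt_rho.
have [|||X [_ HX]] := @ae_const_sub a (fun y => ap f (rho y)); first dfn.
- exact: sm_el.
- apply: ae_full; first dfn; move=> y /rhoP [H _]; apply/in_pow; exact: (map_ap Hf).
have [|y0 [Hy0 E0]] := ae_ex _ HX; first dfn.
have [H0 _] := rhoP Hy0.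
have [|||y [Hy [E H]]] := ae_ex _ (ae_and _ _ HX (ae_rho H0)); try dfn.
have [H1 _] := rhoP Hy.
rewrite -E in E0; rewrite (Hi _ _ H0 H1 E0) in H; exact: (mem_irrefl H).
Qed.

Lemma measure_inaccessible : inaccessible k.
Proof.
have [_ [w [Ow Hw]]] := Uk.
by apply: (inaccessible_intro Ok Ow Hw Rk); apply: measure_pow.
Qed.

(** In the ultrapower, [h] represents an ordinal below the image of [k] that exceeds the image of
    every ordinal below [k]. A minimal such [h] plays the role of [k] itself. *)
Definition unbdd h : Prop := is_map h Y k /\ forall a, a ∈ k -> ae (fun y => a ∈ ap h y).

(* The order [ae (h y ∈ g y)] on functions is well-founded because [U] is
   countably complete: a descending sequence of functions would descend at a
   single point [y]. *)
Lemma normal_function_ex : exists g, unbdd g /\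
  forall h, unbdd h -> ~ ae (fun y => ap h y ∈ ap g y).
Proof.
have HR := Dt_rho.
apply: NNPP => N.
pose (H := sep (pow (prod Y k)) unbdd).
have HH h : h ∈ H <-> unbdd h.
  rewrite in_sep; first by rewrite /unbdd; dfn.
  split=> [[] //|Hh]; split=> //; apply/in_pow => z; have [Hm _] := Hh.
  rewrite (map_lam Hm) => /in_lam []; first dfn.
  by move=> y [Hy ->]; apply/in_prod2; split=> //; apply: (map_ap Hm).
have [||c [Hc Hcc]] := @choice _ H H (fun g h => ae (fun y => ap h y ∈ ap g y)); first dfn.
  move=> g /HH Hg; apply: NNPP => Nh; apply: N; exists g; split=> // h Hh Hhg.
  by apply: Nh; exists h; split=> //; apply/HH.
pose (h0 := lam Y rho).
have Hh0 : h0 ∈ H.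
  apply/HH; split; first by apply: lam_map => // y /rhoP [].
  move=> a Ha; apply: ae_mono (ae_rho Ha) _; try dfn.
  by move=> y Hy; rewrite ap_lam.
(* For a successor ordinal [x], [bigU x] is its predecessor, so the recursion iterates [c] from
   [h0]; only finite stages are used. *)
pose (G x r := the (fun z => (x = emp /\ z = h0) \/ (x <> emp /\ z = ap c (ap r (bigU x))))).
have HG : Dt (fun e => G (e 0) (e 1)) by rewrite /G; dfn.
pose (s := trec G).
have Hs : Dt (fun e => s (e 0)) by apply: Dt_trec => //; dfn.
have s0 : s emp = h0.
  rewrite /s trecE //; first exact: ord_emp.
  apply: theP; first by left.
  by move=> z [[_ ->]|[]].
have sS n : is_ordinal n -> s (succ n) = ap c (s n).
  move=> On; rewrite /s trecE //; first exact: ord_succ.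
  have En : bigU (succ n) = n.
    apply: ext => z; rewrite in_bigU; split.
      by move=> [y [/in_succ [Hy|->] Hz]] //; apply: ord_trans On Hy Hz.
    by move=> Hz; exists n; split=> //; apply/in_succ; right.
  have Nn : succ n <> emp by move=> E; apply: (@in_emp _ n); rewrite -E; apply/in_succ; right.
  apply: theP; first by right; rewrite En ap_lam //; apply/in_succ; right.
  by move=> z [[] //|[_ ->]]; rewrite En ap_lam //; apply/in_succ; right.
have [_ [w [Ow Hw]]] := Uk; have Oww := ord_el Ok Hw.
have sH : forall n, is_ordinal n -> n ∈ w -> s n ∈ H.
  apply: ord_ind; first dfn.
  move=> n On IH Hn; case: (omega_cases Ow Hn) => [->|[m [Hm E]]]; first by rewrite s0.
  have Om := ord_el Oww Hm.
  by rewrite E sS //; apply: (map_ap Hc); apply: IH => //; rewrite E; apply/in_succ; right.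
have Hall : ae (fun y => forall n, n ∈ w -> ap (s (succ n)) y ∈ ap (s n) y).
  apply: (@ae_all w (fun n y => ap (s (succ n)) y ∈ ap (s n) y)); first dfn.
    exact: sm_el.
  move=> n Hn; have On := ord_el Oww Hn; rewrite sS //; apply: Hcc; exact: sH.
have [|y [Hy Hd]] := ae_ex _ Hall; first dfn.
have We : emp ∈ w by apply: ord_emp_mem => //; case: Ow => -[_ []].
have HD : Dt (fun e => ap (s (e 0)) y) by dfn.
have [|z [/in_img [] // n [Hn ->] Hz]] := @foundation _ (img w (fun n => ap (s n) y)) (ap (s emp) y).
  by apply/in_img => //; exists emp.
apply: (Hz (ap (s (succ n)) y)); last exact: Hd.
apply/in_img => //; exists (succ n); split=> //; apply: limit_succ => //; by case: Ow.
Qed.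

(** * Normality and reflection at the least unbounded function *)

Section Normal.
Variable g : M.
Hypotheses (Hg : unbdd g) (Hmin : forall h, unbdd h -> ~ ae (fun y => ap h y ∈ ap g y)).

(** By minimality of [g], a function below [g] almost everywhere is not unbounded. So it is bounded
    below [k] on a set of measure one, and completeness makes it constant. *)
Lemma ae_normal (F : M -> M) : Dt (fun e => F (e 0)) -> ae (fun y => F y ∈ ap g y) ->
  exists a, a ∈ k /\ ae (fun y => F y = a).
Proof.
move=> HD H; have [Mg Bg] := Hg.
(* [unbdd] asks for a map into [k] at every point; where [F y] is not below [g y] the value is reset
   to [emp]. *)
pose (F' y := the (fun z => F y ∈ ap g y /\ z = F y)).
have HD' : Dt (fun e => F' (e 0)) by rewrite /F'; dfn.
have E y : F y ∈ ap g y -> F' y = F y by move=> Hy; apply: theP => // z [].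
pose (h := lam Y F').
have Mh : is_map h Y k.
  apply: lam_map => // y Hy; case: (classic (F y ∈ ap g y)) => Hf.
    rewrite E //; apply: ord_trans Hf => //; exact: (map_ap Mg).
  by rewrite /F' the_none; [move=> z []|apply: k_emp].
have [a [Ha Na]] : exists a, a ∈ k /\ ~ ae (fun y => a ∈ ap h y).
  apply: NNPP => N; apply: (Hmin (h := h)).
    by split=> // a Ha; apply: NNPP => Nn; apply: N; exists a.
  by apply: ae_mono H _; try dfn; move=> y Hy Hf; rewrite ap_lam // E.
have Hsm : sm k (succ a) by apply: sm_el; apply: k_succ.
have [|s [Hs Hss]] := ae_const HD Hsm; last first.
  exists s; split=> //; apply: (ord_trans Ok _ Hs); exact: k_succ.
have [|//|Ha'] := @ae_em (fun y => a ∈ ap h y); first dfn.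
apply: ae_mono (ae_and _ _ H Ha') _; try dfn.
move=> y Hy [Hf]; rewrite ap_lam // E // => Hn.
have Of : is_ordinal (F y).
  by apply: ord_el Hf; apply: (ord_el Ok); apply: (map_ap Mg).
case: (ord_trich Of (ord_el Ok Ha)) => [|[|//]]; rewrite in_succ; tauto.
Qed.

(** Otherwise [g y] fails regularity or the strong limit property almost everywhere. In the first
    case a cofinal map chosen at [y] has, by normality, a constant domain and constant values, which
    regularity of [k] bounds by some [b]; but [b] lies in [g y] almost everywhere. In the second
    case the constant values of the chosen injections inject [k] into [pow a], against
    [measure_pow]. *)
Lemma ae_inaccessible : ae (fun y => inaccessible (ap g y)).
Proof.
have [Mg Bg] := Hg.
case: (@ae_em (fun y => inaccessible (ap g y))) => [|//|N]; first dfn.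
have [_ [w [Ow Hw]]] := Uk.
have Og y : y ∈ Y -> is_ordinal (ap g y) by move=> Hy; apply: (ord_el Ok); apply: (map_ap Mg).
pose (m1 y := exists a f, a ∈ ap g y /\ is_map f a (ap g y) /\
   forall b, b ∈ ap g y -> exists x, x ∈ a /\ ~ ap f x ∈ b).
pose (m2 y := exists a, a ∈ ap g y /\ card_le (ap g y) (pow a)).
have D1 : Dfn (fun e => m1 (e 0)) by rewrite /m1; dfn.
have D2 : Dfn (fun e => m2 (e 0)) by rewrite /m2; dfn.
have gk y z : y ∈ Y -> z ∈ ap g y -> z ∈ k.
  by move=> Hy Hz; apply: ord_trans Hz => //; apply: (map_ap Mg).
have H12 : ae (fun y => m1 y \/ m2 y).
  apply: ae_mono (ae_and _ _ N (Bg _ Hw)) _; try dfn.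
  move=> y Hy [Ni Hwy]; apply: NNPP => Nm; apply: Ni.
  apply: (inaccessible_intro (Og _ Hy) Ow Hwy).
    move=> a f Ha Hf; apply: NNPP => Nb; apply: Nm; left; exists a, f; split=> //; split=> // b Hb.
    apply: NNPP => Nx; apply: Nb; exists b; split=> // x z /appE /(map_val Hf) [Hx ->].
    by apply: NNPP => Nz; apply: Nx; exists x.
  by move=> a Ha Hc; apply: Nm; right; exists a.
have [H|H] : ae m1 \/ ae m2.
  case: (@ae_em m1) => [//|H1|H1]; first by left.
  by right; apply: ae_mono (ae_and _ _ H12 H1) _; try dfn; move=> y _ []; tauto.
- have [||phi [_ Hphi]] := @choice _ (sep Y m1) (prod k (pow (prod k k))) (fun y z => exists a f,
     z = opair a f /\ a ∈ ap g y /\ is_map f a (ap g y) /\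
     forall b, b ∈ ap g y -> exists x, x ∈ a /\ ~ ap f x ∈ b); first dfn.
    move=> y /in_sep [] // Hy [a [f [Ha [Hf Hb]]]]; exists (opair a f); split; last by exists a, f.
    apply/in_prod2; split; first exact: gk Ha.
    apply/in_pow => z; rewrite (map_lam Hf) => /in_lam []; first dfn.
    move=> x [Hx ->]; apply/in_prod2; split; last by apply: gk (map_ap Hf Hx).
    by apply: gk (Hy) _; apply: ord_trans (Og _ Hy) Ha Hx.
  pose (A y := the (fun a => exists f, ap phi y = opair a f)).
  pose (f y := the (fun f => exists a, ap phi y = opair a f)).
  have DA : Dt (fun e => A (e 0)) by rewrite /A; dfn.
  have Df : Dt (fun e => f (e 0)) by rewrite /f; dfn.
  have HAf : ae (fun y => A y ∈ ap g y /\ is_map (f y) (A y) (ap g y) /\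
     forall b, b ∈ ap g y -> exists x, x ∈ A y /\ ~ ap (f y) x ∈ b).
    apply: ae_mono H _; try dfn.
    move=> y Hy Hm; have [|a [f0 [E HH]]] := Hphi y; first by apply/in_sep.
    have -> : A y = a by apply: theP; [exists f0|move=> a' [f']; rewrite E => /opair_inj []].
    have -> // : f y = f0 by apply: theP; [exists a|move=> f' [a']; rewrite E => /opair_inj []].
  have [||a [Ha Ea]] := @ae_normal A _; first dfn.
    by apply: ae_mono HAf _; try dfn; move=> y _ [].
  have Hc x : x ∈ a -> exists c, c ∈ k /\ ae (fun y => ap (f y) x = c).
    move=> Hx; apply: ae_normal; first dfn.
    apply: ae_mono (ae_and _ _ HAf Ea) _; try dfn.
    by move=> y _ [[_ [Hf _]] E]; apply: (map_ap Hf); rewrite E.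
  pose (c x := the (fun c => ae (fun y => ap (f y) x = c))).
  have Dc : Dt (fun e => c (e 0)) by rewrite /c; dfn.
  have Hcc x : x ∈ a -> c x ∈ k /\ ae (fun y => ap (f y) x = c x).
    move=> /Hc [d [Hd Ed]]; have -> // : c x = d.
    by apply: theP => // d' Ed'; apply: ae_uniq Ed' Ed; dfn.
  have [|b [Hb Hbb]] := sm_bound Uk Rk Dc (sm_el Ha); first by move=> x /Hcc [].
  have Hall : ae (fun y => forall x, x ∈ a -> ap (f y) x = c x).
    apply: (@ae_all a (fun x y => ap (f y) x = c x)); first dfn; first exact: sm_el.
    by move=> x /Hcc [].
  have [|||||||y [Hy [[H1 H2] [H3 H4]]]] := ae_ex _ (ae_and _ _ (ae_and _ _ HAf Ea) (ae_and _ _ Hall (Bg _ Hb))); try dfn.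
  have [_ [_ H5]] := H1; have [x [Hx Hn]] := H5 _ H4.
  by rewrite H2 in Hx; case: Hn; rewrite H3 //; apply: Hbb.
- have [||phi [_ Hphi]] := @choice _ (sep Y m2) (prod k (pow (prod k (pow k)))) (fun y z => exists a f,
     z = opair a f /\ a ∈ ap g y /\ is_map f (ap g y) (pow a) /\
     forall x x', x ∈ ap g y -> x' ∈ ap g y -> ap f x = ap f x' -> x = x'); first dfn.
    move=> y /in_sep [] // Hy [a [Ha /card_leE [f [Hf Hi]]]]; exists (opair a f); split; last by exists a, f.
    apply/in_prod2; split; first exact: gk Ha.
    apply/in_pow => z; rewrite (map_lam Hf) => /in_lam []; first dfn.
    move=> x [Hx ->]; apply/in_prod2; split; first by apply: gk Hx.
    have /in_pow Hs := map_ap Hf Hx; apply/in_pow => v /Hs Hv.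
    by apply: gk (Hy) _; apply: ord_trans (Og _ Hy) Ha Hv.
  pose (A y := the (fun a => exists f, ap phi y = opair a f)).
  pose (f y := the (fun f => exists a, ap phi y = opair a f)).
  have DA : Dt (fun e => A (e 0)) by rewrite /A; dfn.
  have Df : Dt (fun e => f (e 0)) by rewrite /f; dfn.
  have HAf : ae (fun y => A y ∈ ap g y /\ is_map (f y) (ap g y) (pow (A y)) /\
     forall x x', x ∈ ap g y -> x' ∈ ap g y -> ap (f y) x = ap (f y) x' -> x = x').
    apply: ae_mono H _; try dfn.
    move=> y Hy Hm; have [|a [f0 [E HH]]] := Hphi y; first by apply/in_sep.
    have -> : A y = a by apply: theP; [exists f0|move=> a' [f']; rewrite E => /opair_inj []].
    have -> // : f y = f0 by apply: theP; [exists a|move=> f' [a']; rewrite E => /opair_inj []].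
  have [||a [Ha Ea]] := @ae_normal A _; first dfn.
    by apply: ae_mono HAf _; try dfn; move=> y _ [].
  have Hc x : x ∈ k -> exists X, X ⊆ a /\ ae (fun y => ap (f y) x = X).
    move=> Hx; apply: ae_const_sub; [dfn|exact: sm_el|].
    apply: ae_mono (ae_and _ _ (ae_and _ _ HAf Ea) (Bg _ Hx)) _; try dfn.
    move=> y _ [[[_ [Hf _]] E] Hxy]; apply/in_pow; rewrite -E; exact: (map_ap Hf).
  apply: (False_ind _ (measure_pow Ha _)).
  apply: (@card_le_rel _ _ _ (fun x X => ae (fun y => ap (f y) x = X))); first dfn.
    by move=> x /Hc [X [HX HE]]; exists X; split=> //; apply/in_pow.
  move=> x x' X Hx Hx' _ H1 H2.
  have [|||||||||y [Hy [[[_ [_ Hi]] [E1 E2]] [B1 B2]]]] := ae_ex _ (ae_and _ _ (ae_and _ _ HAf (ae_and _ _ H1 H2)) (ae_and _ _ (Bg _ Hx) (Bg _ Hx'))); try dfn.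
  by apply: Hi => //; rewrite E1 E2.
Qed.

End Normal.
End Measure.

(** * The fast function forcing *)

Section Closure.
Context {M : zfc_model}.
Implicit Types (x y z A B f g t : M) (F : M -> M) (Q : M -> Prop).

(** The requirements are met one at a time along a well-order of [I]. The chains that arise have
    size at most that of [I], so their unions stay in [T], and upward persistence of [H] preserves
    what was achieved. *)
Lemma closure_lemma (T I t0 : M) (H : M -> M -> Prop) : Dfn (fun e => H (e 0) (e 1)) ->
  t0 ∈ T ->
  (forall S : M, S ⊆ T -> ~ is_empty S -> card_le S I ->
     (forall t t', t ∈ S -> t' ∈ S -> t ⊆ t' \/ t' ⊆ t) -> bigU S ∈ T) ->
  (forall t i, t ∈ T -> i ∈ I -> exists t', t' ∈ T /\ t ⊆ t' /\ H i t') ->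
  (forall i t t', t ∈ T -> t' ∈ T -> t ⊆ t' -> H i t -> H i t') ->
  exists t, t ∈ T /\ forall i, i ∈ I -> H i t.
Proof.
move=> HD Ht0 HS Hd Hup.
have [x [f [Ox [Hf [Hi Hs]]]]] := well_order I.
have [||c [Hc Hcc]] := @choice _ (prod T I) T (fun z t' => exists t i, z = opair t i /\ t ⊆ t' /\ H i t'); first dfn.
  move=> z /in_prod [t [i [Ht [Hii ->]]]]; have [t' [Ht' [H1 H2]]] := Hd _ _ Ht Hii.
  by exists t'; split=> //; exists t, i.
have {}Hcc t i : t ∈ T -> i ∈ I -> ap c (opair t i) ∈ T /\ t ⊆ ap c (opair t i) /\ H i (ap c (opair t i)).
  move=> Ht Hii; have Hp : opair t i ∈ prod T I by apply/in_prod2.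
  split; first exact: (map_ap Hc).
  by have [t' [i' [/opair_inj [<- <-]]]] := Hcc _ Hp.
(* Joining [t0] matters at stage 0, where the union of the earlier stages is empty. *)
pose (G z r := ap c (opair (cup t0 (bigU (img z (fun w => ap r w)))) (ap f z))).
have HG : Dt (fun e => G (e 0) (e 1)) by rewrite /G; dfn.
pose (s := trec G).
have Ds : Dt (fun e => s (e 0)) by apply: Dt_trec => //; dfn.
pose (P z := cup t0 (bigU (img z s))).
have DP : Dt (fun e => P (e 0)) by rewrite /P; dfn.
have inP z v : v ∈ P z <-> v ∈ t0 \/ exists w, w ∈ z /\ v ∈ s w.
  rewrite in_cup in_bigU; split=> -[H1|H1]; auto; right.
    by have [u [/in_img [] // w [Hw ->] Hv]] := H1; exists w.
  by have [w [Hw Hv]] := H1; exists (s w); split=> //; apply/in_img => //; exists w.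
have sE z : is_ordinal z -> s z = ap c (opair (P z) (ap f z)).
  move=> Oz; rewrite [LHS](trecE HG Oz).
  have Es : img z (fun w => ap (lam z s) w) = img z s.
    apply: ext => v; rewrite !in_img //; first dfn.
    by split=> -[w [Hw ->]]; exists w; rewrite ap_lam.
  by rewrite /P -Es.
have PT z : is_ordinal z -> z ⊆ x ->
    (forall w, w ∈ z -> s w ∈ T /\ P w ⊆ s w) -> P z ∈ T.
  move=> Oz Hzx IH; case: (classic (exists w, w ∈ z)) => [[w0 Hw0]|N]; last first.
    suff -> : P z = t0 by [].
    by apply: ext => v; rewrite inP; split=> [[//|[w [Hw _]]]|]; [case: N; exists w|left].
  have -> : P z = bigU (img z s).
    apply: ext => v; rewrite /P in_cup; split=> [[Hv|//]|]; last by right.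
    apply/in_bigU; exists (s w0); split; first by apply/in_img => //; exists w0.
    by apply: (proj2 (IH _ Hw0)); apply/inP; left.
  apply: HS.
  - by move=> v /in_img [] // w [/IH [Hw _] ->].
  - by move=> He; apply: (He (s w0)); apply/in_img => //; exists w0.
  - apply: card_le_trans (card_le_img _ Ds) _; apply: card_le_trans (card_le_sub Hzx) _.
    by apply/card_leE; exists f.
  - have mono w w' : w ∈ z -> w' ∈ z -> w ∈ w' -> s w ⊆ s w'.
      move=> Hw Hw' Hww v Hv; apply: (proj2 (IH _ Hw')); apply/inP; right; by exists w.
    move=> t t' /in_img [] // w [Hw ->] /in_img [] // w' [Hw' ->].
    case: (ord_trich (ord_el Oz Hw) (ord_el Oz Hw')) => [Hww|[->|Hww]].
    + by left; apply: mono.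
    + by left.
    + by right; apply: mono.
have sT : forall z, is_ordinal z -> z ∈ x -> s z ∈ T /\ P z ⊆ s z /\ H (ap f z) (s z).
  apply: ord_ind; first dfn.
  move=> z Oz IH Hz; rewrite sE //; apply: Hcc; last exact: (map_ap Hf).
  apply: PT => //; first exact: ord_sub.
  move=> w Hw; by have [H1 [H2 _]] := IH w Hw (ord_trans Ox Hz Hw).
have HPx : P x ∈ T.
  apply: PT => // w Hw; by have [H1 [H2 _]] := sT w (ord_el Ox Hw) Hw.
exists (P x); split=> // i Hii; have [z [Hz <-]] := Hs _ Hii.
have [H1 [_ H2]] := sT z (ord_el Ox Hz) Hz.
apply: (Hup _ _ _ H1 HPx _ H2) => v Hv; apply/inP; right; by exists z.
Qed.

End Closure.

(** * Conditions: bounds, factoring at an inaccessible, closure of tails *)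

Section Conditions.
Context {M : zfc_model}.
Implicit Types (x y z A B f g t p q r k a b c : M).

Definition dom p : M := compr (fun a => exists b, opair a b ∈ p).
Definition rst p g : M := sep p (fun z => exists a b, a ∈ g /\ z = opair a b).

Lemma in_dom p a : a ∈ dom p <-> exists b, opair a b ∈ p.
Proof.
apply: (comprP (Q := fun a => exists b, opair a b ∈ p)).
exists (sep (bigU (bigU p)) (fun a => exists b, opair a b ∈ p)) => x.
rewrite in_sep; first dfn.
split=> [[] //|Hx]; split=> //; have [b Hb] := Hx.
apply/in_bigU; exists (upair x b); split; last by apply/in_upair; left.
by apply/in_bigU; exists (opair x b); split=> //; apply/in_upair; right.
Qed.

Lemma in_rst p g z : z ∈ rst p g <-> z ∈ p /\ exists a b, a ∈ g /\ z = opair a b.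
Proof. by apply: in_sep; dfn. Qed.

Lemma is_domE d p : is_dom d p <-> d = dom p.
Proof.
split=> [H|->]; first (apply: ext => a; rewrite in_dom H);
 [|move=> a; rewrite in_dom]; by split=> -[b Hb]; exists b; apply/appE.
Qed.

Lemma is_restrictionE r p g : is_restriction r p g <-> r = rst p g.
Proof.
have H z : (z ∈ p /\ exists a b, a ∈ g /\ is_opair z a b) <-> z ∈ rst p g.
  rewrite in_rst; split=> -[Hz [a [b [Ha /is_opairE Hb]]]]; split=> //; exists a, b; split=> //.
by split=> [Hr|-> z]; [apply: ext => z; rewrite Hr H|rewrite H].
Qed.

(** The conditions, with "of size less than [k]" in the form [sm k]. *)
Record fc k p : Prop := Fc {
  fc_pair : forall z, z ∈ p -> exists a b, z = opair a b;
  fc_fun : forall a b c, opair a b ∈ p -> opair a c ∈ p -> b = c;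
  fc_val : forall a b, opair a b ∈ p -> a ∈ k /\ b ∈ k /\ inaccessible a;
  fc_sm : sm k p;
  fc_cl : forall g c a b, opair g c ∈ p -> a ∈ g -> opair a b ∈ p -> b ∈ g;
  fc_rst : forall g c, opair g c ∈ p -> sm g (rst p g)
}.

Lemma inacc_card g : inaccessible g -> is_cardinal g.
Proof. by case=> -[]. Qed.

Lemma inacc_ord g : inaccessible g -> is_ordinal g.
Proof. by move=> /inacc_card []. Qed.

Lemma fcE k p : is_cardinal k -> fast_condition k p <-> fc k p.
Proof.
move=> Ck; split.
- move=> [Hf Hr [d [/is_domE -> [Hc Hd]]] Hcl Hs]; split.
  + by move=> z /(fun_pair Hf).
  + by move=> a b c Hb Hc'; have [_ H] := Hf; apply: (H a); apply/appE.
  + move=> a b Hab; have [|Ha Hi] := Hd a; first by apply/in_dom; exists b.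
    by split=> //; split=> //; apply: (Hr a); apply/appE.
  + move/sm_iff: Hc => /(_ Ck); apply: sm_le.
    apply: (@card_le_rel _ _ _ (fun z a => exists b, z = opair a b)); first dfn.
      move=> z Hz; have [a [b E]] := fun_pair Hf Hz; subst z.
      by exists a; split; [apply/in_dom; exists b|exists b].
    move=> z z' a Hz Hz' _ [b E] [b' E']; subst z z'; congr (opair _ _).
    by have [_ H] := Hf; apply: (H a); apply/appE.
  + move=> g c a b Hg Ha Hab; apply: (Hcl g _ a) => //; last by apply/appE.
    by exists c; apply/appE.
  + move=> g c Hg; have [|r [/is_restrictionE -> Hr']] := Hs g; first by exists c; apply/appE.
    have [|_ Hi] := Hd g; first by apply/in_dom; exists c.
    by apply/sm_iff => //; apply: inacc_card.
- move=> [H1 H2 H3 H4 H5 H6]; split.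
  + split; first by move=> z /H1 [a [b ->]]; exists a, b; apply/is_opairE.
    by move=> a b c /appE Hb /appE Hc; apply: H2 Hb Hc.
  + by move=> a b /appE /H3 [_ []].
  + exists (dom p); split; first exact/is_domE; split.
      apply/sm_iff => //; apply: sm_le H4.
      apply: (@card_le_rel _ _ _ (fun a z => exists b, z = opair a b)); first dfn.
        by move=> a /in_dom [b Hb]; exists (opair a b); split=> //; exists b.
      by move=> a a' z _ _ _ [b ->] [b' /opair_inj []].
    by move=> g /in_dom [b /H3 [? []]].
  + move=> g [c /appE Hg] a b Ha /appE Hab; exact: H5 Hg Ha Hab.
  + move=> g [c /appE Hg]; exists (rst p g); split; first exact/is_restrictionE.
    by have [_ [_ Hi]] := H3 _ _ Hg; apply/sm_iff; [apply: inacc_card|apply: H6 Hg].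
Qed.

Lemma Dfn_fc : Dfn (fun e => @fast_condition M (e 0) (e 1)).
Proof.
have H : Dfn (fun e => is_function (e 1) /\ (forall a b : M, app (e 1) a b -> b ∈ e 0) /\
  (exists d : M, is_dom d (e 1) /\ card_lt d (e 0) /\
    forall g : M, g ∈ d -> g ∈ e 0 /\ inaccessible g) /\
  (forall g : M, (exists c : M, app (e 1) g c) ->
    forall a b : M, a ∈ g -> app (e 1) a b -> b ∈ g) /\
  (forall g : M, (exists c : M, app (e 1) g c) ->
    exists r : M, is_restriction r (e 1) g /\ card_lt r g)).
  by rewrite /is_dom /is_restriction; dfn.
apply: Dfn_ext H => e; split; first by move=> [? [? [? [? ?]]]].
by case.
Qed.

Definition Fs k : M := sep (pow (prod k k)) (fun p => fast_condition k p).

Lemma in_Fs0 k p : p ∈ Fs k <-> fast_condition k p.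
Proof.
have HD := Dfn_fc; rewrite in_sep; first dfn.
split=> [[] //|H]; split=> //; apply/in_pow => z Hz; have [Hf Hr [d [/is_domE Ed [_ Hd]]] _ _] := H.
have [a [b E]] := fun_pair Hf Hz; subst z; apply/in_prod2; split.
  by apply: (proj1 (Hd a _)); rewrite Ed; apply/in_dom; exists b.
by apply: (Hr a); apply/appE.
Qed.

Lemma in_Fs k p : is_cardinal k -> p ∈ Fs k <-> fc k p.
Proof. by move=> Ck; rewrite in_Fs0 fcE. Qed.

Lemma fc_sub k p q : q ⊆ p -> fc k p -> fc k q.
Proof.
move=> Hs [H1 H2 H3 H4 H5 H6]; split.
- by move=> z /Hs /H1.
- by move=> a b c /Hs Hb /Hs; apply: H2 Hb.
- by move=> a b /Hs /H3.
- exact: sm_sub H4.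
- by move=> g c a b /Hs Hg Ha /Hs Hab; apply: H5 Hg Ha Hab.
- move=> g c /Hs Hg; apply: sm_sub (H6 _ _ Hg) => z /in_rst [/Hs Hz Hab].
  by apply/in_rst.
Qed.

Lemma fc_up k g p : is_ordinal k -> g ∈ k -> fc g p -> fc k p.
Proof.
move=> Ok Hg [H1 H2 H3 H4 H5 H6]; split=> //; last exact: sm_trans Hg H4.
by move=> a b /H3 [Ha [Hb Hi]]; split; [|split]; [apply: ord_trans Hg Ha|apply: ord_trans Hg Hb|].
Qed.

Lemma fc_bdd k p : uncountable_cardinal k -> is_regular k -> fc k p ->
  exists b, b ∈ k /\ p ⊆ prod b b.
Proof.
move=> Uk Rk Hp; have Ok := k_ord Uk.
pose (F1 z := the (fun a => exists b, z = opair a b)).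
pose (F2 z := the (fun b => exists a, z = opair a b)).
have D1 : Dt (fun e => F1 (e 0)) by rewrite /F1; dfn.
have D2 : Dt (fun e => F2 (e 0)) by rewrite /F2; dfn.
have E1 a b : F1 (opair a b) = a by apply: theP; [exists b|move=> a' [b' /opair_inj []]].
have E2 a b : F2 (opair a b) = b by apply: theP; [exists a|move=> b' [a' /opair_inj []]].
have [|b1 [Hb1 H1]] := sm_bound Uk Rk D1 (fc_sm Hp).
  by move=> z Hz; have [a [b E]] := fc_pair Hp Hz; subst z; rewrite E1; case: (fc_val Hp Hz).
have [|b2 [Hb2 H2]] := sm_bound Uk Rk D2 (fc_sm Hp).
  by move=> z Hz; have [a [b E]] := fc_pair Hp Hz; subst z; rewrite E2; case: (fc_val Hp Hz) => _ [].
have [b [Hb [Hs1 Hs2]]] := k_max Uk Hb1 Hb2; exists b; split=> // z Hz.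
have [a [c E]] := fc_pair Hp Hz; subst z; apply/in_prod2; split.
  by apply: Hs1; rewrite -(E1 a c); apply: H1.
by apply: Hs2; rewrite -(E2 a c); apply: H2.
Qed.

(** The range and the size of [p] are both bounded below [k]. As [g y] exceeds each such bound, a
    fixed condition belongs to the forcing at [g y] for almost every [y]. *)
Lemma fc_low k p : uncountable_cardinal k -> is_regular k -> fc k p ->
  exists b, b ∈ k /\ forall g, is_ordinal g -> b ∈ g -> fc g p.
Proof.
move=> Uk Rk Hp; have Ok := k_ord Uk.
have [b [Hb Hbp]] := fc_bdd Uk Rk Hp; have [e [He Hep]] := fc_sm Hp.
have [c [Hc [Hbc Hec]]] := k_max Uk Hb He; exists c; split=> // g Og Hcg.
have [H1 H2 H3 H4 H5 H6] := Hp; split=> //.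
  move=> a d Had; have [_ [_ Hi]] := H3 _ _ Had.
  have /in_prod2 [Ha Hd] := Hbp _ Had.
  by split; [|split] => //; apply: ord_trans Hcg _ => //; apply: Hbc.
exists e; split=> //; apply: ord_le_lt Hec Hcg => //; [exact: ord_el Ok He|exact: ord_el Ok Hc].
Qed.

Section Factor.
Variables k g : M.
Hypotheses (Uk : uncountable_cardinal k) (Rk : is_regular k) (Sk : is_strong_limit k)
  (Hg : g ∈ k) (Ig : inaccessible g).
Let Ok : is_ordinal k := k_ord Uk.
Let Ck : is_cardinal k := k_card Uk.
Let Og : is_ordinal g := inacc_ord Ig.

(** The point [g] itself may lie in the domain; the tails do contain a pair [opair g a]. *)
Definition above t : Prop := forall a b, opair a b ∈ t -> ~ a ∈ g.

Lemma above_sub t a b : fc k t -> above t -> opair a b ∈ t -> g ⊆ a.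
Proof.
move=> Ht Hat Ha; have /inacc_ord Oa := proj2 (proj2 (fc_val Ht Ha)).
by case: (ord_lt_or_le Oa Og) => // H; case: (Hat _ _ Ha H).
Qed.

(** At a domain point [h] of [t] one has [g ⊆ h], so the values of [p] lie in [h] and [p] is small
    relative to [h]. At a domain point of [p] nothing of [t] is visible. *)
Lemma fc_glue p t : fc g p -> fc k t -> above t -> fc k (cup p t).
Proof.
move=> Hp Ht Hat; have Hpk := fc_up Ok Hg Hp; split.
- by move=> z /in_cup [/(fc_pair Hp)|/(fc_pair Ht)].
- move=> a b c /in_cup [Hb|Hb] /in_cup [Hc|Hc].
  + exact: (fc_fun Hp Hb Hc).
  + by case: (Hat _ _ Hc); case: (fc_val Hp Hb).
  + by case: (Hat _ _ Hb); case: (fc_val Hp Hc).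
  + exact: (fc_fun Ht Hb Hc).
- by move=> a b /in_cup [/(fc_val Hpk)|/(fc_val Ht)].
- exact: (sm_cup Uk Rk Sk (fc_sm Hpk) (fc_sm Ht)).
- move=> h c a b /in_cup [Hh|Hh] Ha /in_cup [Hb|Hb].
  + exact: (fc_cl Hp Hh Ha Hb).
  + case: (Hat _ _ Hb); apply: ord_trans Og _ Ha; by case: (fc_val Hp Hh).
  + apply: (above_sub Ht Hat Hh); by case: (fc_val Hp Hb) => _ [].
  + exact: (fc_cl Ht Hh Ha Hb).
- move=> h c /in_cup [Hh|Hh].
  + apply: sm_sub (fc_rst Hp Hh) => z /in_rst [/in_cup [Hz|Hz] Hab]; first by apply/in_rst.
    have [a [b [Ha E]]] := Hab; subst z; case: (Hat _ _ Hz).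
    apply: ord_trans Og _ Ha; by case: (fc_val Hp Hh).
  + have Ih := proj2 (proj2 (fc_val Ht Hh)); have [Uh [Rh Sh]] := Ih.
    apply: (@sm_sub _ _ (cup p (rst t h))).
      move=> z /in_rst [/in_cup [Hz|Hz] Hab]; apply/in_cup; [by left|right].
      by apply/in_rst.
    apply: (sm_cup Uh Rh Sh); last exact: (fc_rst Ht Hh).
    have [e [He Hep]] := fc_sm Hp; exists e; split=> //; exact: (above_sub Ht Hat Hh).
Qed.

(** When [g] is in the domain of [r], the closure and smallness clauses at [g] are what the forcing
    at [g] demands of the restriction. *)
Lemma fc_lower r a : fc k r -> opair g a ∈ r -> fc g (rst r g).
Proof.
move=> Hr Ha.
have [H1 H2 H3 _ H5 H6] : fc k (rst r g) by apply: fc_sub Hr => z /in_rst [].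
split=> //; last exact: (fc_rst Hr Ha).
move=> b c Hbc; have [_ [_ Hi]] := H3 _ _ Hbc; move: Hbc => /in_rst [Hbc [b' [c' [Hb /opair_inj [E _]]]]].
by subst b'; split=> //; split=> //; apply: (fc_cl Hr Ha Hb Hbc).
Qed.

Definition upper r : M := sep r (fun z => ~ z ∈ rst r g).

Lemma in_upper r z : z ∈ upper r <-> z ∈ r /\ ~ z ∈ rst r g.
Proof. by apply: in_sep; rewrite /rst; dfn. Qed.

Lemma fc_upper r : fc k r -> fc k (upper r).
Proof. by apply: fc_sub => z /in_upper []. Qed.

Lemma above_upper r : above (upper r).
Proof. by move=> a b /in_upper [Hr Hn] Ha; apply: Hn; apply/in_rst; split=> //; exists a, b. Qed.

Lemma lower_upper r : cup (rst r g) (upper r) = r.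
Proof.
apply: ext => z; rewrite in_cup in_upper; split; last by have := classic (z ∈ rst r g); tauto.
by case=> [/in_rst []|[]].
Qed.

Lemma upper_in r a : opair g a ∈ r -> opair g a ∈ upper r.
Proof.
move=> H; apply/in_upper; split=> // /in_rst [_ [b [c [Hb /opair_inj [E _]]]]].
by subst b; apply: (mem_irrefl Hb).
Qed.

(* Everything in [dom t] beyond [g] exceeds [t g = a], which makes the
   conditions above [g] closed under chains of length at most [a]. *)
Lemma fc_chain S a : a ∈ k -> card_le S a -> ~ is_empty S ->
  (forall t t', t ∈ S -> t' ∈ S -> t ⊆ t' \/ t' ⊆ t) ->
  (forall t, t ∈ S -> fc k t /\ opair g a ∈ t /\ above t) ->
  fc k (bigU S) /\ opair g a ∈ bigU S /\ above (bigU S).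
Proof.
move=> Ha HSa Hne Hch HS.
have Hab : above (bigU S).
  by move=> b c /in_bigU [t [Ht Hb]]; have [_ [_ H]] := HS _ Ht; apply: H Hb.
have Hin : opair g a ∈ bigU S.
  have [t Ht] : exists t, t ∈ S by apply: NNPP => N; apply: Hne => t Ht; apply: N; exists t.
  by apply/in_bigU; exists t; split=> //; case: (HS _ Ht) => _ [].
have two z z' : z ∈ bigU S -> z' ∈ bigU S -> exists t, t ∈ S /\ z ∈ t /\ z' ∈ t.
  move=> /in_bigU [t [Ht Hz]] /in_bigU [t' [Ht' Hz']].
  by case: (Hch _ _ Ht Ht') => H; [exists t'|exists t]; split=> //; split=> //; apply: H.
split; last by split.
split.
- by move=> z /in_bigU [t [/HS [Ht _] /(fc_pair Ht)]].
- by move=> b c d Hc Hd; have [t [/HS [Ht _] [H1 H2]]] := two _ _ Hc Hd; apply: (fc_fun Ht H1 H2).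
- by move=> b c /in_bigU [t [/HS [Ht _] /(fc_val Ht)]].
- apply: (sm_bigU Uk Rk Sk); first by exists a.
  by move=> t /HS [Ht _]; apply: fc_sm Ht.
- move=> h c b d Hh Hb Hd; have [t [/HS [Ht _] [H1 H2]]] := two _ _ Hh Hd; exact: (fc_cl Ht H1 Hb H2).
- move=> h c Hh; have /in_bigU [t0 [Ht0 Hh0]] := Hh; have [Ft0 [Gt0 At0]] := HS _ Ht0.
  have Ih := proj2 (proj2 (fc_val Ft0 Hh0)); have [Uh [Rh Sh]] := Ih.
  have Oh := inacc_ord Ih.
  case: (ord_trich Oh Og) => [Hhg|[E|Hgh]]; first by case: (At0 _ _ Hh0).
    subst h; exists emp; split; first exact: k_emp.
    apply: card_le_sub => z /in_rst [Hz [b [d [Hb E]]]]; subst z; by case: (Hab _ _ Hz).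
  have Hah : a ∈ h := fc_cl Ft0 Hh0 Hgh Gt0.
  have HD : Dt (fun e => rst (e 0) h) by rewrite /rst; dfn.
  apply: (@sm_sub _ _ (bigU (img S (fun t => rst t h)))).
    move=> z /in_rst [/in_bigU [t [Ht Hz]] Hbd]; apply/in_bigU; exists (rst t h); split.
      by apply/in_img => //; exists t.
    by apply/in_rst.
  apply: (sm_bigU Uh Rh Sh); first by apply: sm_img => //; exists a.
  move=> w /in_img [] // t [Ht ->]; have [Ft _] := HS _ Ht.
  (* A smaller [t] may not have [h] in its domain, so its smallness below [h] is borrowed from
     [t0]. *)
  case: (Hch _ _ Ht Ht0) => Hs.
    apply: sm_sub (fc_rst Ft0 Hh0) => z /in_rst [/Hs Hz Hb]; by apply/in_rst.
  by apply: (fc_rst Ft (c := c)); apply: Hs.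
Qed.

Lemma fc_one a : a ∈ k -> fc k (upair (opair g a) (opair g a)) /\ above (upair (opair g a) (opair g a)).
Proof.
move=> Ha; pose (u := opair g a).
have Hu b c : opair b c ∈ upair u u -> b = g /\ c = a by move=> /in_upair [] /opair_inj.
have Hab : above (upair u u) by move=> b c /Hu [-> _]; apply: mem_irrefl.
split=> //; split.
- by move=> z /in_upair [->|->]; exists g, a.
- by move=> b c d /Hu [_ ->] /Hu [_ ->].
- by move=> b c /Hu [-> ->].
- exact: sm_upair.
- by move=> h c b d /Hu [-> _] Hb /Hu [E _]; subst b; case: (mem_irrefl Hb).
- move=> h c /Hu [-> _]; exists emp; split; first by apply: k_emp; case: Ig.
  apply: card_le_sub => z /in_rst [Hz [b [d [Hb E]]]]; subst z; by case: (Hab _ _ Hz).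
Qed.

Lemma sm_Fs : sm k (Fs g).
Proof.
apply: (@sm_sub _ _ (pow (prod g g))); first by move=> p /in_sep [] //; have := Dfn_fc => H; dfn.
by apply: (sm_pow Uk Sk); apply: (sm_prod Uk Sk); apply: sm_el.
Qed.

(** For a pair of a requirement [n] and a condition [p] at [g], extend [p ∪ t] to achieve [D n] and
    split the result at [g]: the lower part becomes [p'], the upper part the next tail. The forcing
    at [g] is small, so there are fewer than [k] pairs to treat. *)
Lemma tail_ex (NN : M) (D : M -> M -> Prop) : Dfn (fun e => D (e 0) (e 1)) -> sm k NN ->
  (forall n r, n ∈ NN -> fc k r -> exists r', fc k r' /\ r ⊆ r' /\ D n r') ->
  (forall n r r', fc k r -> fc k r' -> r ⊆ r' -> D n r -> D n r') ->
  exists t, fc k t /\ above t /\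
    forall n p, n ∈ NN -> fc g p -> exists p', fc g p' /\ p ⊆ p' /\ D n (cup p' t).
Proof.
move=> HD HNN Hd Hup; have HDf := Dfn_fc; have Cg := inacc_card Ig.
(* The bound on the number of pairs is taken as the value at [g], so the tails are closed under
   chains as long as the construction needs. *)
have [a [Ha Hca]] : sm k (prod NN (Fs g)) by apply: (sm_prod Uk Sk) => //; apply: sm_Fs.
pose (T := sep (Fs k) (fun t => opair g a ∈ t /\ forall b c, opair b c ∈ t -> ~ b ∈ g)).
have HT t : t ∈ T <-> fc k t /\ opair g a ∈ t /\ above t.
  by rewrite in_sep; [dfn|rewrite in_Fs].
pose (H i t := exists n p, i = opair n p /\ exists p', p' ∈ Fs g /\ p ⊆ p' /\ D n (cup p' t)).
have [|||||t [Ht HHt]] := @closure_lemma _ T (prod NN (Fs g)) (upair (opair g a) (opair g a)) H.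
- by rewrite /H /Fs; dfn.
- by apply/HT; have [H1 H2] := fc_one Ha; split=> //; split=> //; apply/in_upair; left.
- move=> S HST Hne HSc Hch; apply/HT; apply: fc_chain => //; first exact: card_le_trans HSc Hca.
  by move=> t /HST /HT.
- move=> t i /HT [Ft [Gt At]] /in_prod [n [p [Hn [/in_Fs Fp ->]]]].
  have {}Fp := Fp Cg.
  have [r [Fr [Hr Dr]]] := Hd _ _ Hn (fc_glue Fp Ft At).
  have Gr : opair g a ∈ r by apply: Hr; apply/in_cup; right.
  exists (upper r); split; last split.
  + apply/HT; split; first exact: fc_upper; split; [exact: upper_in|exact: above_upper].
  + move=> z Hz; apply/in_upper; split; first by apply: Hr; apply/in_cup; right.
    by move=> /in_rst [_ [b [c [Hb E]]]]; subst z; apply: (At _ _ Hz).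
  + exists n, p; split=> //; exists (rst r g); split; [|split].
    * by apply/in_Fs => //; apply: fc_lower Gr.
    * move=> z Hz; apply/in_rst; split; first by apply: Hr; apply/in_cup; left.
      have [b [c E]] := fc_pair Fp Hz; subst z; exists b, c; split=> //; by case: (fc_val Fp Hz).
    * by rewrite lower_upper.
- move=> i t t' /HT [Ft [_ At]] /HT [Ft' [_ At']] Htt [n [p [-> [p' [Fp' [Hpp HDn]]]]]].
  exists n, p; split=> //; exists p'; split=> //; split=> //.
  move/in_Fs: Fp' => /(_ Cg) Fp'.
  apply: Hup HDn; [exact: fc_glue|exact: fc_glue|].
  by move=> z; rewrite !in_cup; have := Htt z; tauto.
have /HT [Ft [_ At]] := Ht; exists t; split=> //; split=> // n p Hn Fp.
have [|n' [p0 [/opair_inj [<- <-] [p' [/in_Fs Fp' [Hpp HDn]]]]]] := HHt (opair n p).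
  by apply/in_prod2; split=> //; apply/in_Fs.
by exists p'; split=> //; apply: Fp'.
Qed.

End Factor.
End Conditions.

(** * Deciding names for relations on the ground model *)

Section Decide.
Context {M : zfc_model}.
Implicit Types (n r x z : M).

(** [r] forces [z] into the set named by [n], in the strong sense that [n]
    itself provides the witness. *)
Definition forc n r z : Prop := exists q, q ⊆ r /\ opair q z ∈ n.

(** The second alternative secures density for an arbitrary [n], even one that names no total
    relation; [big_cover] later excludes it at the seed. *)
Definition decides (F n r x : M) : Prop :=
  (exists s, forc n r (opair x s)) \/
  (forall r' s, r' ∈ F -> r ⊆ r' -> ~ forc n r' (opair x s)).

Lemma Dfn_forc : Dfn (fun e => forc (e 0) (e 1) (e 2)).
Proof. rewrite /forc; dfn. Qed.

Lemma forc_mono n r r' z : r ⊆ r' -> forc n r z -> forc n r' z.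
Proof. by move=> H [q [Hq Hn]]; exists q; split=> // w /Hq /H. Qed.

Lemma decides_mono F n r r' x : r ⊆ r' -> decides F n r x -> decides F n r' x.
Proof.
move=> Hr [[s Hs]|H]; first by left; exists s; apply: forc_mono Hs.
by right=> r'' s Hr'' Hs; apply: H => // w /Hr /Hs.
Qed.

Lemma decides_dense F n r x : r ∈ F -> exists r', r' ∈ F /\ r ⊆ r' /\ decides F n r' x.
Proof.
move=> Hr; case: (classic (exists r' s, r' ∈ F /\ r ⊆ r' /\ forc n r' (opair x s))).
  by move=> [r' [s [H1 [H2 H3]]]]; exists r'; split=> //; split=> //; left; exists s.
move=> N; exists r; split=> //; split=> //; right=> r' s H1 H2 H3.
by apply: N; exists r', s.
Qed.

Lemma Dfn_decides (a b c : (nat -> M) -> M) F : Dt a -> Dt b -> Dt c ->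
  Dfn (fun e => decides F (a e) (b e) (c e)).
Proof. have H := Dfn_forc; apply: Dfn_sub3; rewrite /decides; dfn. Qed.

End Decide.

Ltac dfn_reg5 := first [simple apply Dfn_decides | dfn_reg4].
Ltac dfn_reg ::= dfn_reg5.

(** * The seed and the tails in the ground model *)

Section Ground.
Context {M : zfc_model}.

(* In the ultrapower by [nu], [t] represents a condition above [kappa] in the
   image of the forcing that decides the image of every name, evaluated at the
   seed [pi], modulo the generic filter below [kappa]. *)
Lemma ground_measure (k l P mu0 : M) : strongly_compact k ->
  is_Pkl P k l -> is_ultrafilter mu0 P -> is_complete k mu0 ->
  exists Y nu pi t : M,
    is_ultrafilter nu Y /\ is_complete k nu /\ is_map pi Y P /\
    (forall X, X ∈ mu0 -> ae Y nu (fun y => ap pi y ∈ X)) /\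
    (forall p, p ∈ Fs k -> ae Y nu (fun y => cup p (ap t y) ∈ Fs k)) /\
    (forall n p, n ⊆ prod (Fs k) (prod P k) -> p ∈ Fs k -> exists p', p' ∈ Fs k /\ p ⊆ p' /\
       ae Y nu (fun y => decides (Fs k) n (cup p' (ap t y)) (ap pi y))).
Proof.
move=> [Uk [Rk SC]] HP Hmu Hcmu.
have Ok := k_ord Uk; have Ck := k_card Uk.
have HDf := @Dfn_fc M.
(* [N] holds all candidate names for relations between [P] and ordinals below [k]. An injection of
   [N ∪ mu0] into [th] lets [y] code the elements whose index it contains. *)
pose (F := Fs k); pose (N := pow (prod F (prod P k))); pose (A := cup N mu0).
have [th0 [Oth0 [Hth0 _]]] := card_ord A.
pose (th := cup th0 k).
have Oth : is_ordinal th by apply: ord_bigU => x /in_upair [->|->].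
have kth : k ⊆ th by move=> x Hx; apply/in_cup; right.
have /card_leE [e [He Ie]] : card_le A th.
  by apply: card_le_trans Hth0 _; apply: card_le_sub => x Hx; apply/in_cup; left.
have [nu [Y [HY [Hnu [Hcnu Hfnu]]]]] := SC th Oth kth.
have [_ [_ Sk]] := measure_inaccessible Uk Rk kth HY Hnu Hcnu Hfnu.
have smY y : y ∈ Y -> sm k y by move=> /HY [_ /sm_iff]; apply.
have smS y B : B ⊆ A -> y ∈ Y -> sm k (sep B (fun n => ap e n ∈ y)).
  move=> HB Hy; apply: sm_le (smY _ Hy).
  apply: (@card_le_rel _ _ _ (fun n z => z = ap e n)); first dfn.
    by move=> n /in_sep; case; [dfn|move=> _ Hn; exists (ap e n)].
  have HA n : n ∈ sep B (fun n => ap e n ∈ y) -> n ∈ A by move=> /in_sep; case; [dfn|move=> /HB].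
  by move=> n n' z /HA Hn /HA Hn' _ -> E; apply: Ie.
have [||pi [Hpi Hpi2]] := @choice _ Y P (fun y x => forall X, X ∈ mu0 -> ap e X ∈ y -> x ∈ X); first dfn.
  move=> y Hy; pose (Ay := sep mu0 (fun X => ap e X ∈ y)).
  have HAy X : X ∈ Ay <-> X ∈ mu0 /\ ap e X ∈ y by apply: in_sep; dfn.
  (* Completeness needs a nonempty family; if [y] codes no element of [mu0], any point of [P]
     serves. *)
  case: (classic (is_empty Ay)) => [Em|Ne].
    have /not_all_ex_not [x /NNPP Hx] := uf_proper Hmu (uf_full Hmu).
    by exists x; split=> // X HX HeX; case: (Em X); apply/HAy.
  pose (Z := sep P (fun x => forall X, X ∈ Ay -> x ∈ X)).
  have HZ x : x ∈ Z <-> x ∈ P /\ forall X, X ∈ Ay -> x ∈ X by apply: in_sep; dfn.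
  have HZmu : Z ∈ mu0.
    apply: (Hcmu Ay) => //; first by move=> X /HAy [].
      apply/sm_iff => //; apply: smS => // X HX; by apply/in_cup; right.
    move=> x; rewrite HZ; split=> [[] //|H]; split=> //.
    have /not_all_ex_not [X /NNPP HX] := Ne.
    by apply: (uf_sub Hmu (X := X)); [move/HAy: HX => []|apply: H].
  have /not_all_ex_not [x /NNPP /HZ [Hx HxX]] := uf_proper Hmu HZmu.
  by exists x; split=> // X HX HeX; apply: HxX; apply/HAy.
have aeA n : n ∈ A -> ae Y nu (fun y => ap e n ∈ y).
  by move=> Hn; apply: (ae_fine Hfnu); apply: (map_ap He).
have [g [Hg Hmin]] := normal_function_ex Uk Rk kth HY Hnu Hcnu Hfnu.
have [Mg Bg] := Hg.
have Hin := ae_inaccessible Uk Rk kth HY Hnu Hcnu Hfnu Hg Hmin.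
pose (Y1 := sep Y (fun y => inaccessible (ap g y))).
have HY1 y : y ∈ Y1 <-> y ∈ Y /\ inaccessible (ap g y) by apply: in_sep; dfn.
have [||t [Ht Ht2]] := @choice _ Y1 F (fun y t => (forall a b, opair a b ∈ t -> ~ a ∈ ap g y) /\
    forall n, n ∈ N -> ap e n ∈ y -> forall p, p ∈ Fs (ap g y) -> exists p', p' ∈ Fs (ap g y) /\
      p ⊆ p' /\ decides F n (cup p' t) (ap pi y)).
- by rewrite /F /Fs; dfn.
- move=> y /HY1 [Hy Ig].
  have [|||| t [Ft [At Ht]]] := @tail_ex _ k (ap g y) Uk Rk Sk (map_ap Mg Hy) Ig
      (sep N (fun n => ap e n ∈ y)) (fun n r => decides F n r (ap pi y)).
  + by dfn.
  + by apply: smS => // n Hn; apply/in_cup; left.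
  + move=> n r _ /in_Fs Fr; have [r' [Fr' [Hr Hd]]] := decides_dense n (ap pi y) (Fr Ck).
    by exists r'; split=> //; apply/in_Fs.
  + by move=> n r r' _ _; apply: decides_mono.
  + exists t; split; first by apply/in_Fs.
    split=> // n Hn Hen p /in_Fs Fp.
    have [|p' [Fp' [Hp Hd]]] := Ht n p _ (Fp (inacc_card Ig)).
      by apply/in_sep; [dfn|].
    by exists p'; split=> //; apply/in_Fs => //; apply: inacc_card.
have aelow p : p ∈ F -> ae Y nu (fun y => inaccessible (ap g y) /\ fast_condition (ap g y) p).
  move=> /in_Fs Fp; have [b [Hb Hbb]] := fc_low Uk Rk (Fp Ck).
  apply: (ae_mono Hnu) (ae_and Hnu _ _ Hin (Bg _ Hb)) _; try dfn.
  move=> y Hy [Ig Hbg]; split=> //; apply/fcE; first exact: inacc_card.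
  by apply: Hbb => //; apply: inacc_ord.
have glue y p : y ∈ Y -> inaccessible (ap g y) -> fc (ap g y) p -> fc k (cup p (ap t y)).
  move=> Hy Ig Fp; have Hy1 : y ∈ Y1 by apply/HY1.
  have [At _] := Ht2 _ Hy1; have /in_Fs Ft := map_ap Ht Hy1.
  exact: (fc_glue Uk Rk Sk (map_ap Mg Hy) Ig Fp (Ft Ck)).
exists Y, nu, pi, t; split=> //; split=> //; split=> //; split; [|split].
- move=> X HX; apply: (ae_mono Hnu) (aeA X _) _; try dfn; first by apply/in_cup; right.
  by move=> y Hy HeX; apply: Hpi2.
- move=> p Fp; apply: (ae_mono Hnu) (aelow _ Fp) _; try dfn.
  move=> y Hy [Ig /fcE Hp]; apply/in_Fs => //; apply: glue => //; exact: (Hp (inacc_card Ig)).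
- move=> n p Hn Fp.
  have HnN : n ∈ N by apply/in_pow.
  pose (good y p' := p' ∈ Fs (ap g y) /\ p ⊆ p' /\ decides F n (cup p' (ap t y)) (ap pi y)).
  have Dg : Dfn (fun e => good (e 0) (e 1)) by rewrite /good /Fs; dfn.
  have aeg : ae Y nu (fun y => inaccessible (ap g y) /\ exists p', good y p').
    apply: (ae_mono Hnu) (ae_and Hnu _ _ (aelow _ Fp) (aeA n _)) _; try dfn; first by apply/in_cup; left.
    move=> y Hy [[Ig Fpy] Hen]; split=> //; have Hy1 : y ∈ Y1 by apply/HY1.
    by have [_ H] := Ht2 _ Hy1; apply: H => //; apply/in_Fs0.
  have [||phi [Hphi Hphi2]] := @choice _ (sep Y (fun y => inaccessible (ap g y) /\ exists p', good y p')) F good; first dfn.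
    move=> y /in_sep; case; first dfn.
    move=> Hy [Ig [p' Hp']]; exists p'; split=> //; apply/in_Fs => //.
    have [/in_Fs Fp' _] := Hp'; exact: (fc_up Ok (map_ap Mg Hy) (Fp' (inacc_card Ig))).
  have aephi : ae Y nu (fun y => inaccessible (ap g y) /\ good y (ap phi y)).
    apply: (ae_mono Hnu) (aeg) _; try dfn.
    by move=> y Hy [Ig Hp']; split=> //; apply: Hphi2; apply/in_sep; [dfn|].
  (* The forcing at [g y] need not be small uniformly in [y], so [ap phi y] is stabilized in two
     steps: its bound lies below [g y] and is constant by normality, and then it is a subset of one
     small set. *)
  pose (b y := least (fun b => ap phi y ⊆ prod b b)).
  have Db : Dt (fun e => b (e 0)) by rewrite /b; dfn.
  have Hb : ae Y nu (fun y => b y ∈ ap g y /\ ap phi y ⊆ prod (b y) (b y)).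
    apply: (ae_mono Hnu) (aephi) _; try dfn.
    move=> y Hy [Ig [/in_Fs Fp' _]]; have {}Fp' := Fp' (inacc_card Ig).
    have [Ug [Rg _]] := Ig; have [c [Hc Hcc]] := fc_bdd Ug Rg Fp'.
    have Oc := ord_el (inacc_ord Ig) Hc.
    have [|Ob [Hb1 [Hb2 _]]] := @leastP _ (fun b => ap phi y ⊆ prod b b) c _ Oc Hcc; first dfn.
    by split=> //; apply: ord_le_lt Hb2 Hc => //; apply: inacc_ord.
  have [||b0 [Hb0 Eb]] := @ae_normal _ k Y nu Uk Rk Hnu Hcnu g Hg Hmin b; first dfn.
    by apply: (ae_mono Hnu) (Hb) _; try dfn; move=> y _ [].
  have [|||p' [_ Ep']] := @ae_const_sub _ k Y nu Uk Hnu Hcnu (prod b0 b0) (fun y => ap phi y); first dfn.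
  + by apply: (sm_prod Uk Sk); apply: sm_el.
  + apply: (ae_mono Hnu) (ae_and Hnu _ _ Hb Eb) _; try dfn.
    by move=> y _ [[_ H] E]; rewrite -E.
  have HH := ae_and Hnu _ _ aephi Ep'.
  have {}HH : ae Y nu (fun y => inaccessible (ap g y) /\ good y p').
    apply: (ae_mono Hnu) (HH _ _) _; try dfn.
    by move=> y _ [H E]; rewrite -E.
  exists p'; have [|y [Hy [Ig [Fp' [Hpp _]]]]] := ae_ex Hnu _ HH; first dfn.
  split; last split=> //.
    move/in_Fs: Fp' => /(_ (inacc_card Ig)) Fp'; apply/in_Fs => //; exact: (fc_up Ok (map_ap Mg Hy) Fp').
  by apply: (ae_mono Hnu) (HH) _; try dfn; move=> z _ [_ [_ []]].
Qed.

End Ground.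

(** * The forcing relation for "the value of [u] is [b]" *)

Section Forcing_relation.
Context {M : zfc_model}.
Implicit Types (x y z p q r u v b c S T B F w : M).

(** [t x] collects what is reached from [s] by descending along membership through stages below [x];
    at a limit length nothing new is reached by one more descent. *)
Lemma transitive_ex w s : is_limit w -> exists T, s ∈ T /\ is_transitive T.
Proof.
move=> Lw; have [Ow [Nw _]] := Lw.
pose (G x r := cup (upair s s) (bigU (img x (fun y => bigU (ap r y))))).
have HG : Dt (fun e => G (e 0) (e 1)) by rewrite /G; dfn.
pose (t := trec G).
have Dtt : Dt (fun e => t (e 0)) by apply: Dt_trec => //; dfn.
have tE x z : is_ordinal x -> z ∈ t x <-> z = s \/ exists y, y ∈ x /\ exists v, v ∈ t y /\ z ∈ v.
  move=> Ox; rewrite [t x](trecE HG Ox) in_cup in_upair in_bigU.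
  have HD : Dt (fun e => bigU (ap (lam x (trec G)) (e 0))) by rewrite -/t; dfn.
  split.
    move=> [?|[a [/in_img [] // y [Hy ->]]]]; first by left; tauto.
    rewrite ap_lam // => /in_bigU Hz; right; by exists y.
  move=> [?|[y [Hy Hz]]]; first by tauto.
  right; exists (bigU (t y)); split; last by apply/in_bigU.
  by apply/in_img => //; exists y; rewrite ap_lam.
exists (bigU (img w t)); split.
  apply/in_bigU; exists (t emp); split.
    by apply/in_img => //; exists emp; split=> //; apply: ord_emp_mem.
  by apply/tE; [exact: ord_emp|left].
move=> z /in_bigU [a [/in_img [] // y [Hy ->] Hz]] v Hv.
have Hs := limit_succ Lw Hy.
apply/in_bigU; exists (t (succ y)); split; first by apply/in_img => //; exists (succ y).
apply/tE; first exact: ord_el Ow Hs.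
right; exists y; split; [by apply/in_succ; right|by exists z].
Qed.

Lemma transitive_fst T v q u : is_transitive T -> u ∈ T -> opair v q ∈ u -> v ∈ T.
Proof.
move=> HT Hu Hv; have H1 := HT _ Hu _ Hv.
have H2 : upair v v ∈ T by apply: (HT _ H1); apply/in_upair; left.
by apply: (HT _ H2); apply/in_upair; left.
Qed.

(** The union of all post-fixed subsets of [U], hence the greatest fixed point. The arguments about
    forcing use only containment in [U] and the fixed-point equation. *)
Lemma knaster_tarski (U : M) (Phi : M -> M -> Prop) : Dfn (fun e => Phi (e 0) (e 1)) ->
  (forall S S' z, S ⊆ S' -> Phi S z -> Phi S' z) ->
  exists R, R ⊆ U /\ forall z, z ∈ U -> (z ∈ R <-> Phi R z).
Proof.
move=> HD Hm; pose (R := sep U (fun z => exists S, z ∈ S /\ S ⊆ U /\ forall u, u ∈ S -> Phi S u)).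
have HR z : z ∈ R <-> z ∈ U /\ exists S, z ∈ S /\ S ⊆ U /\ forall u, u ∈ S -> Phi S u by apply: in_sep; dfn.
have R1 z : z ∈ R -> Phi R z.
  move=> /HR [Hz [S [HzS [HS HPhi]]]]; apply: Hm (HPhi _ HzS) => u Hu.
  by apply/HR; split; [apply: HS|exists S].
exists R; split; first by move=> z /HR [].
move=> z Hz; split=> [/R1 //|HPhi]; apply/HR; split=> //.
exists (cup R (upair z z)); have Hs : R ⊆ cup R (upair z z) by move=> u Hu; apply/in_cup; left.
split; first by apply/in_cup; right; apply/in_upair; left.
split=> u /in_cup [Hu|/in_upair Hu].
- by move/HR: Hu => [].
- by have -> : u = z by tauto.
- by apply: Hm Hs _; apply: R1.
- have -> : u = z by tauto.
  exact: Hm Hs _.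
Qed.

(** The two inclusions between the value of [u] and [b], each required densely below [p]. *)
Definition eq_step F S p u b : Prop :=
  (forall v q r, opair v q ∈ u -> q ∈ F -> r ∈ F -> p ⊆ r -> q ⊆ r ->
     exists r' c, r' ∈ F /\ r ⊆ r' /\ c ∈ b /\ opair r' (opair v c) ∈ S) /\
  (forall c r, c ∈ b -> r ∈ F -> p ⊆ r ->
     exists r' v q, r' ∈ F /\ r ⊆ r' /\ opair v q ∈ u /\ q ∈ F /\ q ⊆ r' /\
       opair r' (opair v c) ∈ S).

(** [opair p (opair u b) ∈ R] means that [p] forces the value of the name [u]
    to be [b]. The usual recursive clauses are monotone in [R], so a fixed
    point exists by Knaster-Tarski. *)
Definition eq_forcing F T B R : Prop := forall p u b, p ∈ F -> u ∈ T -> b ∈ B ->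
  (opair p (opair u b) ∈ R <-> eq_step F R p u b).

Lemma eq_forcing_ex F T B : exists R, R ⊆ prod F (prod T B) /\ eq_forcing F T B R.
Proof.
pose (Phi S z := exists p u b, z = opair p (opair u b) /\ eq_step F S p u b).
have [||R [HR HRR]] := @knaster_tarski (prod F (prod T B)) Phi.
- by rewrite /Phi /eq_step; dfn.
- move=> S S' z HS [p [u [b [-> [H1 H2]]]]]; exists p, u, b; split=> //; split.
    move=> v q r Hv Hq Hr Hp Hqr; have [r' [c [? [? [? Hc]]]]] := H1 _ _ _ Hv Hq Hr Hp Hqr.
    by exists r', c; do 3 split=> //; apply: HS.
  move=> c r Hc Hr Hp; have [r' [v [q [? [? [? [? [? Hv]]]]]]]] := H2 _ _ Hc Hr Hp.
  by exists r', v, q; do 5 split=> //; apply: HS.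
exists R; split=> // p u b Hp Hu Hb; rewrite HRR; first by rewrite !in_prod2.
split=> [[p' [u' [b' [/opair_inj [-> /opair_inj [-> ->]]]]]] //|H].
by exists p, u, b.
Qed.

Section Props.
Variables F T B R : M.
Hypotheses (HT : is_transitive T) (HB : is_transitive B)
  (HRs : R ⊆ prod F (prod T B)) (HR : eq_forcing F T B R).

Lemma eqr_mem p u b : opair p (opair u b) ∈ R -> p ∈ F /\ u ∈ T /\ b ∈ B.
Proof. by move=> /HRs /in_prod2 [? /in_prod2 []]. Qed.

Lemma eqr_mono p p' u b : p' ∈ F -> p ⊆ p' ->
  opair p (opair u b) ∈ R -> opair p' (opair u b) ∈ R.
Proof.
move=> Hp' Hs H; have [Hp [Hu Hb]] := eqr_mem H.
have [H1 H2] := proj1 (HR Hp Hu Hb) H; apply/HR => //; split.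
  by move=> v q r Hv Hq Hr Hpr Hqr; apply: (H1 v q r) => // z /Hs /Hpr.
by move=> c r Hc Hr Hpr; apply: H2 => // z /Hs /Hpr.
Qed.

(** Induction on [b]: an element of one candidate is forced, by an extension of [p], to be the value
    of some [v]; a further extension gives [v] a value in the other candidate, and the two values
    agree by minimality. *)
Lemma eqr_uniq p u b b' : opair p (opair u b) ∈ R -> opair p (opair u b') ∈ R -> b = b'.
Proof.
move=> H H'; have [Hp [Hu Hb]] := eqr_mem H; apply: NNPP => Hne.
have [||{H H' Hp Hu Hb Hne p u b'}{}b [_ [[b' [p [u [H [H' Hne]]]]] Hmin]]] :=
  @min_elt _ B b (fun b => exists b' p u, opair p (opair u b) ∈ R /\ opair p (opair u b') ∈ R /\ b <> b') _ Hb.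
- dfn.
- by exists b', p, u.
have [Hp [Hu Hb]] := eqr_mem H; have [_ [_ Hb']] := eqr_mem H'.
have [H1 H2] := proj1 (HR Hp Hu Hb) H; have [H1' H2'] := proj1 (HR Hp Hu Hb') H'.
have IH q v c c' : c ∈ b -> opair q (opair v c) ∈ R -> opair q (opair v c') ∈ R -> c = c'.
  move=> Hc R1 R2; apply: NNPP => N; have [_ [_ HcB]] := eqr_mem R1.
  by apply: (Hmin _ HcB Hc); exists c', q, v.
apply: Hne; apply: sub_antisym => c Hc.
- have [r [v [q [Fr [pr [Hv [Fq [Hqr Rr]]]]]]]] := H2 c p Hc Hp (fun _ h => h).
  have [r' [c' [Fr' [Hrr [Hc' Rr']]]]] := H1' v q r Hv Fq Fr pr Hqr.
  by rewrite (IH r' v c c' Hc (eqr_mono Fr' Hrr Rr) Rr').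
- have [r [v [q [Fr [pr [Hv [Fq [Hqr Rr]]]]]]]] := H2' c p Hc Hp (fun _ h => h).
  have [r' [c' [Fr' [Hrr [Hc' Rr']]]]] := H1 v q r Hv Fq Fr pr Hqr.
  by rewrite -(IH r' v c' c Hc' Rr' (eqr_mono Fr' Hrr Rr)).
Qed.

(** This and [eqr_fail2] are the failures of the two clauses of [eq_step] witnessed at [p] itself,
    which therefore persist in the generic filter. *)
Definition eqr_fail1 p u b : Prop := exists v q, opair v q ∈ u /\ q ∈ F /\ q ⊆ p /\
  forall r' c, r' ∈ F -> p ⊆ r' -> c ∈ b -> ~ opair r' (opair v c) ∈ R.

Definition eqr_fail2 p u b : Prop := exists c, c ∈ b /\
  forall r' v q, r' ∈ F -> p ⊆ r' -> opair v q ∈ u -> q ∈ F -> q ⊆ r' ->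
    ~ opair r' (opair v c) ∈ R.

Lemma eqr_dense p u b : p ∈ F -> u ∈ T -> b ∈ B -> exists r, r ∈ F /\ p ⊆ r /\
  (opair r (opair u b) ∈ R \/ eqr_fail1 r u b \/ eqr_fail2 r u b).
Proof.
move=> Hp Hu Hb; apply: NNPP => N.
have N' r : r ∈ F -> p ⊆ r -> ~ eqr_fail1 r u b /\ ~ eqr_fail2 r u b.
  by move=> Hr Hpr; split=> Hf; apply: N; exists r; tauto.
apply: N; exists p; split=> //; split=> //; left; apply/HR => //; split.
- move=> v q r Hv Hq Hr Hpr Hqr; apply: NNPP => Nn; have [Nf _] := N' _ Hr Hpr.
  apply: Nf; exists v, q; do 3 split=> //; move=> r' c Hr' Hrr Hc HcR; apply: Nn; by exists r', c.
- move=> c r Hc Hr Hpr; apply: NNPP => Nn; have [_ Nf] := N' _ Hr Hpr.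
  apply: Nf; exists c; split=> // r' v q Hr' Hrr Hv Hq Hqr HR'; apply: Nn; by exists r', v, q.
Qed.

End Props.
End Forcing_relation.

(** * Generic extensions *)

Section Extension.
Context {V W : zfc_model} (i : V -> W).
Hypotheses (i_mem : forall x y : V, i x ∈ i y <-> x ∈ y)
  (i_trans : forall (x : W) (y : V), x ∈ i y -> exists z : V, x = i z).

Lemma in_i (x : W) (y : V) : x ∈ i y <-> exists z, z ∈ y /\ x = i z.
Proof.
split=> [H|[z [Hz ->]]]; last exact/i_mem.
by have [z E] := i_trans H; subst x; exists z; split=> //; apply/i_mem.
Qed.

Lemma i_inj x y : i x = i y -> x = y.
Proof. by move=> E; apply: ext => z; rewrite -!i_mem E. Qed.

Lemma i_sub x y : i x ⊆ i y <-> x ⊆ y.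
Proof.
split=> H z; first by rewrite -!i_mem; apply: H.
by move=> /in_i [w [/H Hw ->]]; apply/i_mem.
Qed.

Lemma i_upair x y : i (upair x y) = upair (i x) (i y).
Proof.
apply: ext => z; rewrite in_i in_upair; split.
  by move=> [w [/in_upair [->|->] ->]]; tauto.
by case=> ->; [exists x|exists y]; split=> //; apply/in_upair; tauto.
Qed.

Lemma i_opair x y : i (opair x y) = opair (i x) (i y).
Proof. by rewrite /opair !i_upair. Qed.

Lemma in_i_opair (a b : W) (f : V) : opair a b ∈ i f <-> exists x y, a = i x /\ b = i y /\ opair x y ∈ f.
Proof.
split; last by move=> [x [y [-> [-> H]]]]; rewrite -i_opair; apply/i_mem.
move=> H; have [z E] := i_trans H.
have H1 : upair a b ∈ i z by rewrite -E; apply/in_upair; right.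
have [z1 E1] := i_trans H1.
have [x Ex] : exists x, a = i x by apply: (@i_trans _ z1); rewrite -E1; apply/in_upair; left.
have [y Ey] : exists y, b = i y by apply: (@i_trans _ z1); rewrite -E1; apply/in_upair; right.
by exists x, y; split=> //; split=> //; apply/i_mem; rewrite i_opair -Ex -Ey.
Qed.

Lemma i_ord x : is_ordinal (i x) <-> is_ordinal x.
Proof.
split=> -[H1 H2]; split.
- by move=> y Hy; apply/i_sub; apply: H1; apply/i_mem.
- move=> y z /i_mem Hy /i_mem Hz; case: (H2 _ _ Hy Hz) => [/i_mem|[/i_inj|/i_mem]]; tauto.
- by move=> y /in_i [z [/H1 Hz ->]]; apply/i_sub.
- move=> y z /in_i [a [Ha ->]] /in_i [b [Hb ->]]; rewrite !i_mem.
  by case: (H2 _ _ Ha Hb) => [|[->|]]; tauto.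
Qed.

Lemma i_empty x : is_empty (i x) <-> is_empty x.
Proof.
by split=> H z; [rewrite -i_mem; apply: H|move=> /in_i [y [/H]]].
Qed.

Lemma i_limit x : is_limit (i x) <-> is_limit x.
Proof.
rewrite /is_limit i_ord i_empty; split=> -[H1 [H2 H3]]; split=> //; split=> //.
- by move=> y /i_mem /H3 [z [/in_i [z' [Hz ->]] /i_mem Hy]]; exists z'.
- by move=> y /in_i [y' [/H3 [z [Hz Hy]] ->]]; exists (i z); rewrite !i_mem.
Qed.

Lemma i_omega x : is_omega x -> is_omega (i x).
Proof.
by move=> [H1 H2]; split; [apply/i_limit|move=> n /in_i [m [/H2 Hm ->]] /i_limit].
Qed.

(** * The generic filter *)

Variables (F : V) (G : W).
Hypotheses (G_filter : is_filter (i F) G)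
  (G_gen : forall D : V, is_dense F D -> exists p : W, p ∈ G /\ p ∈ i D).

Lemma G_el x : x ∈ G -> exists p, p ∈ F /\ x = i p.
Proof. by case: G_filter => H _ /H /in_i. Qed.

Lemma G_mem p : i p ∈ G -> p ∈ F.
Proof. by case: G_filter => H _ /H /i_mem. Qed.

Lemma G_down p q : p ∈ F -> p ⊆ q -> i q ∈ G -> i p ∈ G.
Proof. by case: G_filter => _ [_ [H _]] Hp Hpq Hq; apply: (H _ (i q)) => //; [apply/i_mem|apply/i_sub]. Qed.

Lemma G_dir p q : i p ∈ G -> i q ∈ G -> exists r, r ∈ F /\ i r ∈ G /\ p ⊆ r /\ q ⊆ r.
Proof.
case: G_filter => _ [_ [_ H]] Hp Hq; have [x [Hx [H1 H2]]] := H _ _ Hp Hq.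
have [r [Hr E]] := G_el Hx; subst x; exists r; split=> //; split=> //.
by split; apply/i_sub.
Qed.

Lemma generic (Q : V -> Prop) : Dfn (fun e => Q (e 0)) ->
  (forall p, p ∈ F -> exists q, q ∈ F /\ p ⊆ q /\ Q q) -> exists p, i p ∈ G /\ Q p.
Proof.
move=> HD H; have [|x [Hx /in_i [p [/in_sep [] // Hp Qp E]]]] := G_gen (D := sep F Q).
  split; first by move=> p /in_sep [].
  by move=> p /H [q [Hq [Hpq HQ]]]; exists q; split=> //; apply/in_sep.
by subst x; exists p.
Qed.

Lemma generic_or (Q : V -> Prop) : Dfn (fun e => Q (e 0)) ->
  exists p, i p ∈ G /\ (Q p \/ forall r, r ∈ F -> p ⊆ r -> ~ Q r).
Proof.
move=> HD; apply: (generic (Q := fun p => Q p \/ forall r, r ∈ F -> p ⊆ r -> ~ Q r)); first dfn.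
move=> p Hp; case: (classic (exists r, r ∈ F /\ p ⊆ r /\ Q r)) => [[r [Hr [Hpr HQ]]]|N].
  by exists r; tauto.
exists p; split=> //; split=> //; right=> r Hr Hpr HQ; apply: N; by exists r.
Qed.

Lemma generic_below (Q : V -> Prop) p : Dfn (fun e => Q (e 0)) -> i p ∈ G ->
  (forall r, r ∈ F -> p ⊆ r -> exists q, q ∈ F /\ r ⊆ q /\ Q q) -> exists q, i q ∈ G /\ Q q.
Proof.
move=> HD Hp H; have [q [Hq [HQ|N]]] := generic_or HD; first by exists q.
have [r [Fr [_ [Hpr Hqr]]]] := G_dir Hp Hq; have [q' [Fq' [Hrq HQ]]] := H _ Fr Hpr.
by case: (N q') => // z /Hqr /Hrq.
Qed.

(** * The truth lemma for values in the ground model *)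

Section Truth.
Variables T B R : V.
Hypotheses (HT : is_transitive T) (HB : is_transitive B)
  (HRs : R ⊆ prod F (prod T B)) (HR : eq_forcing F T B R).
Variable h : W.
Hypotheses (Hh : is_function h)
  (Hdom : forall u y : W, opair u y ∈ h -> forall v p : W, p ∈ G -> opair v p ∈ u -> exists z, opair v z ∈ h)
  (Hval : forall u y : W, opair u y ∈ h ->
     forall z, z ∈ y <-> exists v p : W, p ∈ G /\ opair v p ∈ u /\ opair v z ∈ h).

Lemma i_forced u b : (exists p, p ∈ G /\ opair p (opair (i u) (i b)) ∈ i R) <->
  exists p, i p ∈ G /\ opair p (opair u b) ∈ R.
Proof.
split.
- move=> [x [Hx]]; have [p [_ E]] := G_el Hx; subst x.
  by rewrite -!i_opair => /i_mem H; exists p.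
- by move=> [p [Hp H]]; exists (i p); split=> //; rewrite -!i_opair; apply/i_mem.
Qed.

Lemma truth b u : b ∈ B -> u ∈ T -> (exists y, opair (i u) y ∈ h) ->
  (opair (i u) (i b) ∈ h <-> exists p, i p ∈ G /\ opair p (opair u b) ∈ R).
Proof.
move=> Hb Hu Hd; apply: NNPP => N.
(* The induction on [b] takes place in [W], since the claim mentions [G] and [h]. It is therefore
   phrased with [i B], [i T] and [i R], and [i_forced] translates back. *)
have [||x [/in_i [{N Hd Hu Hb u}c [Hb E]] [[u' [Hu' [Hd N]]] Hmin]]] :=
  @min_elt _ (i B) (i b) (fun x => exists u, u ∈ i T /\ (exists y, opair u y ∈ h) /\
     ~ (opair u x ∈ h <-> exists p, p ∈ G /\ opair p (opair u x) ∈ i R)) _ (proj2 (i_mem _ _) Hb).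
- dfn.
- by exists (i u); split; [apply/i_mem|split=> //; rewrite i_forced].
subst x; rename c into b0; clear b; rename b0 into b.
have [u [Hu E]] := proj1 (in_i _ _) Hu'; subst u'; apply: N; rewrite i_forced.
have IH c v : c ∈ b -> v ∈ T -> (exists y, opair (i v) y ∈ h) ->
    (opair (i v) (i c) ∈ h <-> exists p, i p ∈ G /\ opair p (opair v c) ∈ R).
  move=> Hc Hv Hdv; apply: NNPP => N.
  apply: (Hmin (i c)); [by apply/i_mem; apply: HB Hc|exact/i_mem|].
  by exists (i v); split; [apply/i_mem|split=> //; rewrite i_forced].
have Tv v q : opair v q ∈ u -> v ∈ T by apply: transitive_fst.
split; last first.
- move=> [p [Gp Rp]]; have Fp := G_mem Gp; have [y Hy] := Hd.
  have [H1 H2] := proj1 (HR Fp Hu Hb) Rp.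
  suff <- : y = i b by [].
  apply: ext => z; rewrite (Hval Hy); split.
  + move=> [v' [q' [Gq [Hv Hz]]]]; have [v [q [Ev [Eq Hvq]]]] := proj1 (in_i_opair _ _ _) Hv; subst v' q'.
    have [r0 [Fr0 [Gr0 [Hpr Hqr]]]] := G_dir Gp Gq.
    have [||q' [Gq' [c [Hc Rc]]]] := @generic_below (fun r => exists c, c ∈ b /\ opair r (opair v c) ∈ R) r0 _ Gr0; first dfn.
      move=> r Fr Hr; have [||r' [c [Fr' [Hrr [Hc Rc]]]]] := H1 v q r Hvq (G_mem Gq) Fr.
      * by move=> w /Hpr /Hr.
      * by move=> w /Hqr /Hr.
      by exists r'; split=> //; split=> //; exists c.
    have Hc2 : opair (i v) (i c) ∈ h by apply/IH => //; [exact: Tv Hvq|exists z|exists q'].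
    have -> : z = i c by case: Hh => _ H; apply: (H (i v)); apply/appE.
    exact/i_mem.
  + move=> /in_i [c [Hc ->]].
    have [||r [Gr [v [q [Hvq [Fq [Hqr Rr]]]]]]] := @generic_below (fun r => exists v q, opair v q ∈ u /\ q ∈ F /\ q ⊆ r /\
       opair r (opair v c) ∈ R) p _ Gp; first dfn.
      move=> r Fr Hr; have [r' [v [q [Fr' [Hrr [Hv [Fq [Hq Rr]]]]]]]] := H2 c r Hc Fr Hr.
      by exists r'; split=> //; split=> //; exists v, q.
    have Gq := G_down Fq Hqr Gr.
    have Hvq' : opair (i v) (i q) ∈ i u by rewrite -i_opair; apply/i_mem.
    exists (i v), (i q); split=> //; split=> //; apply/IH => //; [exact: Tv Hvq|exact: Hdom Hy _ _ Gq Hvq'|].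
    by exists r.
- move=> Hy.
  have [||p [Gp [Rp|[Fl|Fl]]]] := @generic (fun p => opair p (opair u b) ∈ R \/ eqr_fail1 F R p u b \/ eqr_fail2 F R p u b).
  + by rewrite /eqr_fail1 /eqr_fail2; dfn.
  + by move=> p Fp; apply: (eqr_dense HR).
  + by exists p.
  + have [v [q [Hvq [Fq [Hqp Hn]]]]] := Fl; have Gq := G_down Fq Hqp Gp.
    have Hvq' : opair (i v) (i q) ∈ i u by rewrite -i_opair; apply/i_mem.
    have [z Hz] := Hdom Hy Gq Hvq'.
    have : z ∈ i b by apply/(Hval Hy); exists (i v), (i q).
    move=> /in_i [c [Hc E]]; subst z.
    have [p' [Gp' Rp']] : exists p, i p ∈ G /\ opair p (opair v c) ∈ R.
      by apply/IH => //; [exact: Tv Hvq|exists (i c)].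
    have [r [Fr [Gr [Hpr Hpr']]]] := G_dir Gp Gp'.
    by case: (Hn r c) => //; apply: (eqr_mono HRs HR Fr Hpr').
  + have [c [Hc Hn]] := Fl.
    have /(Hval Hy) [v' [q' [Gq [Hv Hz]]]] : i c ∈ i b by apply/i_mem.
    have [v [q [Ev [Eq Hvq]]]] := proj1 (in_i_opair _ _ _) Hv; subst v' q'.
    have [p' [Gp' Rp']] : exists p, i p ∈ G /\ opair p (opair v c) ∈ R.
      by apply/IH => //; [exact: Tv Hvq|exists (i c)].
    have [r [Fr [Gr [Hpr Hpr']]]] := G_dir Gp Gp'.
    have [r' [Fr' [Gr' [Hrr Hqr]]]] := G_dir Gr Gq.
    case: (Hn r' v q Fr' _ Hvq (G_mem Gq) Hqr); first by move=> w /Hpr /Hrr.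
    by apply: (eqr_mono HRs HR Fr' _ Rp') => w /Hpr' /Hrr.
Qed.

End Truth.

(** * Names for subsets of ground model sets; ordinals of the extension *)

Variable w : V.
Hypotheses (Lw : is_limit w) (G_names : forall x : W, exists s : V, name_value G (i s) x).

(** The name and [T] are fixed before [B], because [ordinal_ground] chooses [B] by a cardinality
    that depends on [T]. *)
Lemma name_forcing (x : W) : exists s T, is_transitive T /\ s ∈ T /\
  forall B, is_transitive B -> exists R, R ⊆ prod F (prod T B) /\ eq_forcing F T B R /\
  forall b, b ∈ B -> (i b ∈ x <-> exists v q p, opair v q ∈ s /\ i q ∈ G /\ i p ∈ G /\
    opair p (opair v b) ∈ R).
Proof.
have [s [h [Hh [/appE Hx Hrec]]]] := G_names x.
have [T [Hs HT]] := transitive_ex s Lw.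
exists s, T; split=> //; split=> // B HB.
have [R [HRs HR]] := eq_forcing_ex F T B.
have Hdom : forall u y : W, opair u y ∈ h -> forall v p : W, p ∈ G -> opair v p ∈ u -> exists z, opair v z ∈ h.
  move=> u y /appE /Hrec [H _] v p Hp /appE Hv; have [z /appE Hz] := H _ _ Hp Hv; by exists z.
have Hval : forall u y : W, opair u y ∈ h ->
     forall z, z ∈ y <-> exists v p : W, p ∈ G /\ opair v p ∈ u /\ opair v z ∈ h.
  move=> u y /appE /Hrec [_ H] z; rewrite H; split=> -[v [p [Hp [Hv Hz]]]]; exists v, p; split=> //;
    by split; apply/appE.
exists R; do 2 split=> //.
move=> b Hb; rewrite (Hval _ _ Hx); split.
- move=> [v' [q' [Gq [Hv Hz]]]]; have [v [q [Ev [Eq Hvq]]]] := proj1 (in_i_opair _ _ _) Hv; subst v' q'.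
  have Tv := transitive_fst HT Hs Hvq.
  have [|p [Gp Rp]] := proj1 (truth HT HB HRs HR Hh Hdom Hval Hb Tv _) Hz; first by exists (i b).
  by exists v, q, p.
- move=> [v [q [p [Hvq [Gq [Gp Rp]]]]]]; have Tv := transitive_fst HT Hs Hvq.
  have Hvq' : opair (i v) (i q) ∈ i s by rewrite -i_opair; apply/i_mem.
  exists (i v), (i q); split=> //; split=> //.
  by apply/(truth HT HB HRs HR Hh Hdom Hval Hb Tv); [apply: Hdom Hx _ _ Gq Hvq'|exists p].
Qed.

(** A pair in [n] consists of [b] and a condition that both puts some [v] into the name and forces
    the value of [v] to be [b]. Directedness of [G] merges the two conditions involved. *)
Lemma subset_name (B : V) (x : W) : exists n, n ⊆ prod F B /\
  forall b, b ∈ B -> (i b ∈ x <-> exists p, i p ∈ G /\ opair p b ∈ n).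
Proof.
have [B' [HBB' HB']] := transitive_ex B Lw.
have [s [T [HT [Hs HTR]]]] := name_forcing x.
have [R [HRs [HR H]]] := HTR _ HB'.
pose (Q z := exists p b v q, z = opair p b /\ opair v q ∈ s /\ q ∈ F /\ q ⊆ p /\ opair p (opair v b) ∈ R).
exists (sep (prod F B) Q); have Hn z : z ∈ sep (prod F B) Q <-> z ∈ prod F B /\ Q z by apply: in_sep; rewrite /Q; dfn.
split; first by move=> z /Hn [].
move=> b Hb; rewrite H; first exact: HB' HBB' _ Hb.
split.
- move=> [v [q [p [Hvq [Gq [Gp Rp]]]]]]; have [r [Fr [Gr [Hqr Hpr]]]] := G_dir Gq Gp.
  exists r; split=> //; apply/Hn; split; first exact/in_prod2.
  exists r, b, v, q; do 2 split=> //; split; first exact: G_mem.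
  by split=> //; apply: (eqr_mono HRs HR Fr Hpr).
- move=> [p [Gp /Hn [_ [p' [b' [v [q [/opair_inj [<- <-] [Hvq [Fq [Hqp Rp]]]]]]]]]]].
  by exists v, q, p; split=> //; split=> //; apply: G_down Hqp Gp.
Qed.

(* Otherwise [i b] would be covered by the values of the names in [T], and
   [eq_forcing] would give an injection of [b] into [F × T]. *)
Lemma ordinal_ground (a : W) : is_ordinal a -> exists b, a = i b.
Proof.
move=> Oa; apply: NNPP => N.
have Hall b : is_ordinal b -> i b ∈ a.
  move=> Ob; have Oib : is_ordinal (i b) by apply/i_ord.
  case: (ord_trich Oib Oa) => [//|[E|/i_trans //]]; by case: N; exists b.
have [s [T [HT [Hs HTR]]]] := name_forcing a.
have [b [Ob [Hb _]]] := card_ord (pow (prod F T)).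
have [R [HRs [HR H]]] := HTR b (proj1 Ob).
apply: (@cantor _ (prod F T)); apply: card_le_trans Hb _.
apply: (@card_le_rel _ _ _ (fun c z => exists p v, z = opair p v /\ opair p (opair v c) ∈ R)); first dfn.
- move=> c Hc; have Hca : i c ∈ a by apply: (ord_trans Oa (Hall _ Ob)); apply/i_mem.
  have [v [q [p [_ [_ [_ Rp]]]]]] := proj1 (H _ Hc) Hca.
  exists (opair p v); split; last by exists p, v.
  by have [Fp [Tv _]] := eqr_mem HRs Rp; apply/in_prod2.
- move=> c c' z _ _ _ [p [v [-> Rp]]] [p' [v' [/opair_inj [<- <-] Rp']]].
  exact: (eqr_uniq HRs HR Rp Rp').
Qed.

Lemma i_card_le x y : card_le x y -> card_le (i x) (i y).
Proof.
move=> /card_leE [f [Hf Hi]].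
apply: (@card_le_rel _ _ _ (fun a b => opair a b ∈ i f)); first dfn.
- move=> a /in_i [b [Hb ->]]; exists (i (ap f b)); rewrite -i_opair !i_mem.
  by split; [apply: (map_ap Hf)|apply: (map_app Hf)].
- move=> a a' b _ _ _ /in_i_opair [c [d [-> [-> H]]]] /in_i_opair [c' [d' [-> [/i_inj E H']]]].
  subst d'; have [Hc Ed] := map_val Hf H; have [Hc' Ed'] := map_val Hf H'.
  by rewrite (Hi c c' Hc Hc' _) // -Ed -Ed'.
Qed.

Variable k : V.
Hypotheses (EF : F = Fs k) (SC : strongly_compact k).

Let Uk : uncountable_cardinal k := proj1 SC.
Let Rk : is_regular k := proj1 (proj2 SC).
Let Ok : is_ordinal k := k_ord Uk.

(** * Sets of measure one in the extension *)

Section Big.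
Variables l P mu0 Y nu pi t : V.
Hypotheses (HP : is_Pkl P k l) (Hmu : is_ultrafilter mu0 P)
  (Hnu : is_ultrafilter nu Y) (Hcnu : is_complete k nu) (Hpi : is_map pi Y P)
  (Hseed : forall X, X ∈ mu0 -> ae Y nu (fun y => ap pi y ∈ X))
  (Hcond : forall p, p ∈ F -> ae Y nu (fun y => cup p (ap t y) ∈ F))
  (Hdec : forall n p, n ⊆ prod F (prod P k) -> p ∈ F -> exists p', p' ∈ F /\ p ⊆ p' /\
       ae Y nu (fun y => decides F n (cup p' (ap t y)) (ap pi y))).

Definition bigv (n p : V) : Prop := ae Y nu (fun y => forc n (cup p (ap t y)) (ap pi y)).

(** Only the trace on the ground model [P] is described, because the extended measure concentrates
    there. *)
Definition named (n : V) (X : W) : Prop :=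
  forall x, x ∈ P -> (i x ∈ X <-> exists q, i q ∈ G /\ opair q x ∈ n).

(** In ultrapower terms: the seed [pi] belongs to the image of [X]. *)
Definition big (X : W) : Prop :=
  exists n p, n ⊆ prod F P /\ i p ∈ G /\ bigv n p /\ named n X.

Lemma cup_mono (p p' s : V) : p ⊆ p' -> cup p s ⊆ cup p' s.
Proof. by move=> H z; rewrite !in_cup; have := H z; tauto. Qed.

Lemma big_trace (X X' : W) : (forall x, x ∈ P -> (i x ∈ X <-> i x ∈ X')) -> big X -> big X'.
Proof.
move=> H [n [p [Hn [Gp [Hb HX]]]]]; exists n, p; do 3 split=> //.
by move=> x Hx; rewrite -H // HX.
Qed.

(** Otherwise some [p0] in [G] has no extension forcing a common point. But for almost every [y] the
    condition [s ∪ t y], with [s] in [G] beyond [p0], puts [pi y] into both sets; it need not be in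
    [G] to contradict this. *)
Lemma big_meet (X X' : W) : big X -> big X' -> exists x, x ∈ P /\ i x ∈ X /\ i x ∈ X'.
Proof.
move=> [n [p [Hn [Gp [Hb HX]]]]] [n' [p' [Hn' [Gp' [Hb' HX']]]]].
have Df := @Dfn_forc V.
have [|p0 [Gp0 [[x [Hx [[q [Hq Nq]] [q' [Hq' Nq']]]]]|N]]] :=
  @generic_or (fun r => exists x, x ∈ P /\ forc n r x /\ forc n' r x); first dfn.
- exists x; split=> //; rewrite HX // HX' //; split; [exists q|exists q']; split=> //.
    by apply: G_down Hq Gp0; have /in_prod2 [] := Hn _ Nq.
  by apply: G_down Hq' Gp0; have /in_prod2 [] := Hn' _ Nq'.
- have [r [Fr [Gr [H1 H2]]]] := G_dir Gp Gp'; have [s [Fs' [Gs [H3 H4]]]] := G_dir Gr Gp0.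
  have DF : Dfn (fun e => forc n (cup p (ap t (e 0))) (ap pi (e 0))) by dfn.
  have DF' : Dfn (fun e => forc n' (cup p' (ap t (e 0))) (ap pi (e 0))) by dfn.
  have [|||||y [Hy [[B1 B2] B3]]] := ae_ex Hnu _ (ae_and Hnu _ _ (ae_and Hnu _ _ Hb Hb') (Hcond Fs')); try dfn.
  case: (N _ B3); first by move=> z Hz; apply/in_cup; left; apply: H4.
  exists (ap pi y); split; first exact: (map_ap Hpi).
  by split; [apply: forc_mono B1|apply: forc_mono B2]; apply: cup_mono => z; [move=> /H1 /H3|move=> /H2 /H3].
Qed.

Lemma big_ground (X0 : V) : X0 ∈ mu0 -> big (i X0).
Proof.
move=> HX0; have Df := @Dfn_forc V.
have /not_all_ex_not [x /NNPP Gx] : ~ is_empty G by case: G_filter => _ [].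
have [p [Fp E]] := G_el Gx; subst x.
exists (prod F X0), p; split; last split=> //; last split.
- by move=> z /in_prod [q [x [Fq [Hx ->]]]]; apply/in_prod2; split=> //; apply: uf_sub Hmu _ HX0 _ Hx.
- apply: (ae_mono Hnu) (Hseed HX0) _; try dfn.
  by move=> y Hy Hx; exists p; split; [move=> z Hz; apply/in_cup; left|apply/in_prod2].
- move=> x Hx; rewrite i_mem; split; first by move=> H; exists p; split=> //; apply/in_prod2.
  by move=> [q [_ /in_prod2 []]].
Qed.

(** [Z] colours [P] with fewer than [k] colours. The colour that [p ∪ t y] forces at the seed [pi y]
    is a ground model function of [y] with values in [d], hence constant almost everywhere. Nothing
    about [i k] in [W] is presupposed, so regularity can be derived from this. *)
Lemma big_cover (d : V) (Z : W) : d ∈ k ->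
  (forall x, x ∈ P -> exists s, s ∈ d /\ opair (i x) (i s) ∈ Z) ->
  exists s, s ∈ d /\ forall X : W, (forall x, x ∈ P -> (i x ∈ X <-> opair (i x) (i s) ∈ Z)) -> big X.
Proof.
move=> Hd HZ; have Df := @Dfn_forc V; have Od := ord_el Ok Hd.
have [n [Hn HnZ]] := subset_name (prod P d) Z.
have {}HnZ x s : x ∈ P -> s ∈ d -> (opair (i x) (i s) ∈ Z <-> exists q, i q ∈ G /\ opair q (opair x s) ∈ n).
  by move=> Hx Hs; rewrite -i_opair HnZ //; apply/in_prod2.
have nd q x s : opair q (opair x s) ∈ n -> q ∈ F /\ x ∈ P /\ s ∈ d by move=> /Hn /in_prod2 [? /in_prod2 []].
(* The property of [r] is to force some point to have no colour. No member of [G] has it, since [Z]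
   covers [P]; so no extension of [p0] has it, in particular not [p ∪ t y] for almost every [y]. *)
have [|p0 [Gp0 [[x [Hx H]]|H]]] := @generic_or (fun r => exists x, x ∈ P /\
    forall s r', s ∈ d -> r' ∈ F -> r ⊆ r' -> ~ forc n r' (opair x s)); first dfn.
  have [s [Hs HxZ]] := HZ _ Hx; have [q [Gq Nq]] := proj1 (HnZ _ _ Hx Hs) HxZ.
  have [r [Fr [Gr [H1 H2]]]] := G_dir Gp0 Gq.
  by case: (H s r) => //; exists q.
have Hnk : n ⊆ prod F (prod P k).
  move=> z /Hn /in_prod [q [b [Fq [/in_prod [x [s [Hx [Hs ->]]]] ->]]]].
  by rewrite !in_prod2; do 2 split=> //; apply: ord_trans Ok Hd Hs.
have [||p1 [Gp1 Hp1]] := @generic (fun p => ae Y nu (fun y => decides F n (cup p (ap t y)) (ap pi y))).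
- dfn.
- by move=> p Fp; apply: Hdec.
have [p [Fp [Gp [H0 H1]]]] := G_dir Gp0 Gp1.
have Hs : ae Y nu (fun y => exists s, s ∈ d /\ forc n (cup p (ap t y)) (opair (ap pi y) s)).
  apply: (ae_mono Hnu) (ae_and Hnu _ _ Hp1 (Hcond Fp)) _; try dfn.
  move=> y Hy [Hd1 Fc]; case: (decides_mono (cup_mono (s := ap t y) H1) Hd1) => [[s Hs]|Hno].
    by exists s; split=> //; have [q [_ /nd [_ []]]] := Hs.
  have Hx : ap pi y ∈ P by apply: (map_ap Hpi).
  apply: NNPP => _; apply: (H (cup p (ap t y)) Fc); first by move=> z /H0 Hz; apply/in_cup; left.
  by exists (ap pi y); split=> // s r' _ Fr' Hr'; apply: Hno.
(* [Z] may give a point several colours; the least forced one is taken. *)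
pose (f y := least (fun s => forc n (cup p (ap t y)) (opair (ap pi y) s))).
have Dtf : Dt (fun e => f (e 0)) by rewrite /f; dfn.
have Hf : ae Y nu (fun y => f y ∈ d /\ forc n (cup p (ap t y)) (opair (ap pi y) (f y))).
  apply: (ae_mono Hnu) (Hs) _; try dfn.
  move=> y Hy [s [Hsd Fs']]; have Os := ord_el Od Hsd.
  have [|Ol [Hl [Hls _]]] := @leastP _ (fun s => forc n (cup p (ap t y)) (opair (ap pi y) s)) s _ Os Fs'; first dfn.
  by split=> //; apply: ord_le_lt Hls Hsd.
have [|s [Hsd Es]] := @ae_const _ k Y nu Uk Hnu Hcnu d f Dtf (sm_el Hd).
  by apply: (ae_mono Hnu) (Hf) _; try dfn; move=> y _ [].
exists s; split=> // X HX.
pose (ns := sep (prod F P) (fun z => exists q x, z = opair q x /\ opair q (opair x s) ∈ n)).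
have Hns q x : opair q x ∈ ns <-> opair q (opair x s) ∈ n.
  rewrite in_sep; first dfn; split.
    by move=> [_ [q' [x' [/opair_inj [<- <-]]]]].
  by move=> H2; have [Fq [Hx _]] := nd _ _ _ H2; split; [apply/in_prod2|exists q, x].
exists ns, p; split; first by move=> z /in_sep; case; first dfn.
split=> //; split.
  apply: (ae_mono Hnu) (ae_and Hnu _ _ Hf Es) _; try dfn.
  by move=> y _ [[_ [q [Hq Nq]]] E]; exists q; split=> //; apply/Hns; rewrite -E.
move=> x Hx; rewrite HX // HnZ //.
by split=> -[q [Gq /Hns Nq]]; exists q; split=> //; apply/Hns.
Qed.

Section Fine_trace.
Hypothesis Hfine : forall a X : V, a ∈ l -> (forall x : V, x ∈ X <-> x ∈ P /\ a ∈ x) -> X ∈ mu0.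

Lemma big_fine (a : V) (X : W) : a ∈ l -> (forall x, x ∈ P -> (i x ∈ X <-> a ∈ x)) -> big X.
Proof.
move=> Ha HX; pose (X0 := sep P (fun x => a ∈ x)).
have HX0 x : x ∈ X0 <-> x ∈ P /\ a ∈ x by apply: in_sep; dfn.
apply: big_trace (big_ground (Hfine Ha HX0)) => x Hx.
by rewrite i_mem HX0 HX; tauto.
Qed.

(** Each [x] in the ground model [P] is bounded in [k], so a cofinal [f] has a value outside [x]. By
    [big_cover] one argument [s] works for a set of measure one, but fineness says that almost every
    [x] contains [f s]. *)
Lemma ext_regular : k = l -> is_regular (i k).
Proof.
move=> El a f /in_i [d [Hd ->]] Hf; apply: NNPP => N.
pose (Z := sep (prod (i P) (i d)) (fun z => exists x s, z = opair x s /\ ~ ap f s ∈ x)).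
have HZ x s : opair x s ∈ Z <-> x ∈ i P /\ s ∈ i d /\ ~ ap f s ∈ x.
  rewrite in_sep; first dfn; rewrite in_prod2; split.
    by move=> [[Hx Hs] [x' [s' [/opair_inj [<- <-]]]]].
  by move=> [Hx [Hs Hn]]; split=> //; exists x, s.
have [x Hx|s [Hs HX]] := @big_cover d Z Hd.
  have [Hxl Hxk] := proj1 (HP x) Hx.
  have [|||b [Hb Hxb]] := @sm_bound _ k Uk Rk x (fun a => a); first dfn.
  - by apply/sm_iff => //; apply: k_card.
  - by move=> a0 /Hxl; rewrite El.
  have [s' [Hs' Hsb]] : exists s, s ∈ i d /\ ~ ap f s ∈ i b.
    apply: NNPP => Nn; apply: N; exists (i b); split; first exact/i_mem.
    move=> s0 y /appE /(map_val Hf) [Hs0 ->]; apply: NNPP => Nb; apply: Nn; by exists s0.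
  have [s [Hs E]] := proj1 (in_i _ _) Hs'; subst s'; exists s; split=> //.
  apply/HZ; split; first exact/i_mem; split=> // /in_i [v [Hv Ev]]; apply: Hsb.
  by rewrite Ev; apply/i_mem; apply: Hxb.
have /in_i [al [Hal Eal]] : ap f (i s) ∈ i k by apply: (map_ap Hf); apply/i_mem.
pose (X1 := sep (i P) (fun x => ~ i al ∈ x)); pose (X2 := sep (i P) (fun x => i al ∈ x)).
have H1 x : x ∈ X1 <-> x ∈ i P /\ ~ i al ∈ x by apply: in_sep; dfn.
have H2 x : x ∈ X2 <-> x ∈ i P /\ i al ∈ x by apply: in_sep; dfn.
have B1 : big X1.
  by apply: HX => x Hx; rewrite H1 HZ Eal !i_mem; tauto.
have B2 : big X2.
  by apply: (@big_fine al); [rewrite -El|move=> x Hx; rewrite H2 !i_mem; tauto].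
by have [x [Hx [/H1 [_ N1] /H2 []]]] := big_meet B1 B2.
Qed.

End Fine_trace.

(** * The extended ultrafilter *)

Hypothesis (UW : uncountable_cardinal (i k)) (RW : is_regular (i k)).

Lemma big_cover_family (A : W) : sm (i k) A ->
  (forall x, x ∈ P -> exists X, X ∈ A /\ i x ∈ X) -> exists X, X ∈ A /\ big X.
Proof.
move=> [e [/in_i [d [Hd ->]] /card_leE [f [Hf Hi]]]] Hcov.
pose (Z := sep (prod (i P) (i d)) (fun z => exists x X, X ∈ A /\ z = opair x (ap f X) /\ x ∈ X)).
have HZ x s : opair x s ∈ Z <-> x ∈ i P /\ exists X, X ∈ A /\ s = ap f X /\ x ∈ X.
  rewrite in_sep; first dfn; rewrite in_prod2; split.
    by move=> [[Hx Hs] [x' [X [HX [/opair_inj [<- ->] HxX]]]]]; split=> //; exists X.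
  move=> [Hx [X [HX [-> HxX]]]]; split; last by exists x, X.
  by split=> //; apply: (map_ap Hf).
have [x Hx|s [Hs HX]] := @big_cover d Z Hd.
  have [X [HX HxX]] := Hcov _ Hx; have /in_i [s [Hs E]] := map_ap Hf HX.
  by exists s; split=> //; apply/HZ; split; [apply/i_mem|exists X].
pose (X1 := sep (i P) (fun x => opair x (i s) ∈ Z)).
have HX1 x : x ∈ X1 <-> x ∈ i P /\ opair x (i s) ∈ Z by apply: in_sep; dfn.
have B1 : big X1 by apply: HX => x Hx; rewrite HX1 i_mem; tauto.
(* A set of measure one meets itself, so it has a point, and hence the index [s] comes from an
   actual member of [A]. *)
have [x [Hx [/HX1 [_ /HZ [_ [X [XA [Es HxX]]]]] _]]] := big_meet B1 B1.
exists X; split=> //; apply: HX => x' Hx'; rewrite HZ i_mem; split.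
  by move=> H; split=> //; exists X.
by move=> [_ [X' [XA' [Es' H]]]]; rewrite (Hi X X') // -Es -Es'.
Qed.

Definition PW : W := sep (pow (i l)) (fun x => card_lt x (i k)).

Lemma in_PW x : x ∈ PW <-> x ⊆ i l /\ card_lt x (i k).
Proof. by rewrite in_sep; [dfn|rewrite in_pow]. Qed.

Lemma P_PW x : x ∈ P -> i x ∈ PW.
Proof.
move=> /HP [H1 /sm_iff H2]; have [e [He Hxe]] := H2 (k_card Uk).
apply/in_PW; split; first exact/i_sub.
apply/sm_iff; first exact: k_card UW.
by exists (i e); split; [apply/i_mem|apply: i_card_le].
Qed.

(** [bigv] is computed in [V]. Collecting its instances into a set of [V] lets [W] speak of them
    through [i EV], so that [mu] is definable in [W]. *)
Definition EV : V := sep (prod (pow (prod F P)) F) (fun z => exists n p, z = opair n p /\ bigv n p).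

Lemma in_EV n p : opair n p ∈ EV <-> n ⊆ prod F P /\ p ∈ F /\ bigv n p.
Proof.
have Df := @Dfn_forc V.
rewrite in_sep; first by rewrite /bigv; dfn.
rewrite in_prod2 in_pow; split; first by move=> [[? ?] [n' [p' [/opair_inj [<- <-]]]]].
by move=> [? [? ?]]; split=> //; exists n, p.
Qed.

Definition mu : W := sep (pow PW) (fun X => exists n p, opair n p ∈ i EV /\ p ∈ G /\
  forall x, x ∈ i P -> (x ∈ X <-> exists q, q ∈ G /\ opair q x ∈ n)).

Lemma in_mu X : X ∈ mu <-> X ⊆ PW /\ big X.
Proof.
rewrite in_sep; first dfn; rewrite in_pow; split=> -[HX HB]; split=> //.
- have [n' [p' [/in_i_opair [n [p [En [Ep /in_EV [Hn [Fp Hb]]]]]] [Gp H]]]] := HB; subst n' p'.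
  exists n, p; do 3 split=> //; move=> x Hx; rewrite H; first exact/i_mem.
  split=> -[q [Gq Nq]].
    have [r [Fr E]] := G_el Gq; subst q; exists r; split=> //.
    by move: Nq; rewrite -i_opair i_mem.
  by exists (i q); rewrite -i_opair i_mem.
- have [n [p [Hn [Gp [Hb H]]]]] := HB; exists (i n), (i p); split; last split=> //.
    by rewrite -i_opair; apply/i_mem; apply/in_EV; split=> //; split=> //; apply: G_mem.
  move=> x' /in_i [x [Hx ->]]; rewrite H //; split=> -[q [Gq Nq]].
    by exists (i q); rewrite -i_opair i_mem.
  have [r [Fr E]] := G_el Gq; subst q; exists r; split=> //.
  by move: Nq; rewrite -i_opair i_mem.
Qed.

Lemma big_or (X X' : W) : (forall x, x ∈ P -> i x ∈ X \/ i x ∈ X') -> big X \/ big X'.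
Proof.
move=> H; have [||Z [/in_upair [->|->]]] := @big_cover_family (upair X X'); try tauto.
  exact: sm_upair.
by move=> x /H [Hx|Hx]; [exists X|exists X']; split=> //; apply/in_upair; tauto.
Qed.

(** [sm_cup] relies on the strong limit property, which has not been established for [i k]; adding
    one point only costs a successor. *)
Lemma sm_cons (A z : W) : sm (i k) A -> sm (i k) (cup (upair z z) A).
Proof.
move=> [e [He /card_leE [f [Hf Hi]]]]; exists (succ e); split; first exact: k_succ.
apply: (@card_le_rel _ _ _ (fun x s => (x ∈ A /\ s = ap f x) \/ (~ x ∈ A /\ s = e))); first dfn.
- move=> x _; case: (classic (x ∈ A)) => Hx; [exists (ap f x)|exists e]; rewrite in_succ; split; try tauto.
  by left; apply: (map_ap Hf).
- move=> x x' s /in_cup Hx /in_cup Hx' _ [[Ax E]|[Nx E]] [[Ax' E']|[Nx' E']].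
  + by apply: Hi => //; rewrite -E -E'.
  + by case: (@mem_irrefl _ e); rewrite -{1}E' E; apply: (map_ap Hf).
  + by case: (@mem_irrefl _ e); rewrite -{1}E E'; apply: (map_ap Hf).
  + move: Hx Hx'; rewrite !in_upair => Hx Hx'; have -> : x = z by tauto.
    by have -> : x' = z by tauto.
Qed.

(** The intersection and the complements of the members of [A] cover [P], so one of them has measure
    one. It is not a complement, since sets of measure one meet. *)
Lemma mu_complete : is_complete (i k) mu.
Proof.
move=> A Z HA Ne /sm_iff HAk HZ; have {}HAk := HAk (k_card UW).
have /not_all_ex_not [X0 /NNPP HX0] := Ne.
have HZs : Z ⊆ PW by move=> x /HZ Hx; have /in_mu [H _] := HA _ HX0; apply: H; apply: Hx.
apply/in_mu; split=> //.
pose (C X := sep PW (fun x => ~ x ∈ X)).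
have DC : Dt (fun e => C (e 0)) by rewrite /C; dfn.
have HC X x : x ∈ C X <-> x ∈ PW /\ ~ x ∈ X by apply: in_sep; dfn.
have [||X [/in_cup [/in_upair HX|/in_img []]]] := @big_cover_family (cup (upair Z Z) (img A C)).
- by apply: sm_cons; apply: sm_img.
- move=> x Hx; case: (classic (i x ∈ Z)) => HxZ.
    by exists Z; split=> //; apply/in_cup; left; apply/in_upair; left.
  have [X [HX Hn]] : exists X, X ∈ A /\ ~ i x ∈ X.
    by apply: NNPP => N; apply: HxZ; apply/HZ => X HX; apply: NNPP => Nx; apply: N; exists X.
  exists (C X); split; last by apply/HC; split=> //; apply: P_PW.
  by apply/in_cup; right; apply/in_img => //; exists X.
- by have -> : X = Z by tauto.
- by [].
- move=> X' [/HA /in_mu [_ B'] ->] B.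
  by have [x [_ [/HC [_ Hn] Hx]]] := big_meet B B'.
Qed.

Lemma mu_ultra : is_ultrafilter mu PW.
Proof.
have up X X' : X ∈ mu -> X ⊆ X' -> X' ⊆ PW -> X' ∈ mu.
  move=> /in_mu [HX B] Hs HX'; apply/in_mu; split=> //.
  pose (C := sep PW (fun x => ~ x ∈ X')).
  have HC x : x ∈ C <-> x ∈ PW /\ ~ x ∈ X' by apply: in_sep; dfn.
  have [x Hx|//|B'] := @big_or X' C.
    have := P_PW Hx; have := HC (i x); have := classic (i x ∈ X'); tauto.
  by have [x [_ [/Hs Hx /HC []]]] := big_meet B B'.
split=> //.
- by move=> X /in_mu [].
- apply/in_mu; split=> //; apply: big_trace (big_ground (uf_full Hmu)) => x Hx.
  by rewrite i_mem; have := P_PW Hx; tauto.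
- by move=> X /in_mu [_ B] He; have [x [_ [Hx _]]] := big_meet B B; apply: (He (i x)).
- move=> X X' Z HX HX' HZ; apply: (mu_complete (A := upair X X')).
  + by move=> z /in_upair [->|->].
  + by move=> He; apply: (He X); apply/in_upair; left.
  + by apply/sm_iff; [exact: k_card UW|exact: sm_upair].
  + move=> x; rewrite HZ; split; first by move=> [H1 H2] z /in_upair [->|->].
    by move=> H; split; apply: H; apply/in_upair; tauto.
- move=> X X' HX HX'; rewrite !in_mu.
  have Hs : X' ⊆ PW by move=> x /HX' [].
  have [x Hx|B|B] := @big_or X X'; try tauto.
  by have := P_PW Hx; have := HX' (i x); have := classic (i x ∈ X); tauto.
Qed.

Lemma mu_fine : (forall a X : V, a ∈ l -> (forall x : V, x ∈ X <-> x ∈ P /\ a ∈ x) -> X ∈ mu0) ->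
  fine_measure (i k) (i l) mu /\ i mu0 ⊆ mu.
Proof.
move=> Hfine; split.
- exists PW; split; first exact: in_PW; split; first exact: mu_ultra; split; first exact: mu_complete.
  move=> a' X /in_i [a [Ha ->]] HX; apply/in_mu; split; first by move=> x /HX [].
  apply: (big_fine Hfine Ha) => x Hx; rewrite HX i_mem; have := P_PW Hx; tauto.
- move=> X' /in_i [X [HX ->]]; apply/in_mu; split; last exact: big_ground.
  by move=> x' /in_i [x [Hx ->]]; apply: P_PW; apply: uf_sub Hmu _ HX _ Hx.
Qed.

End Big.

(** * Strong compactness in the extension *)

Lemma ground_data (l mu0 : V) : fine_measure k l mu0 -> exists P Y nu pi t : V,
  is_Pkl P k l /\ is_ultrafilter mu0 P /\
  (forall a X : V, a ∈ l -> (forall x : V, x ∈ X <-> x ∈ P /\ a ∈ x) -> X ∈ mu0) /\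
  is_ultrafilter nu Y /\ is_complete k nu /\ is_map pi Y P /\
  (forall X, X ∈ mu0 -> ae Y nu (fun y => ap pi y ∈ X)) /\
  (forall p, p ∈ F -> ae Y nu (fun y => cup p (ap t y) ∈ F)) /\
  (forall n p, n ⊆ prod F (prod P k) -> p ∈ F -> exists p', p' ∈ F /\ p ⊆ p' /\
       ae Y nu (fun y => decides F n (cup p' (ap t y)) (ap pi y))).
Proof.
move=> [P [HP [Hmu [Hc Hfine]]]].
have [Y [nu [pi [t H]]]] := ground_measure SC HP Hmu Hc.
by exists P, Y, nu, pi, t; rewrite EF.
Qed.

Lemma regular_i : is_regular (i k).
Proof.
have [_ [_ H]] := SC; have [mu0 Hmu0] := H k Ok (fun _ h => h).
have [P [Y [nu [pi [t [HP [Hmu [Hfine [Hnu [Hcnu [Hpi [Hs [Hco Hdec]]]]]]]]]]]]] := ground_data Hmu0.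
exact: (ext_regular HP Hmu Hnu Hcnu Hpi Hs Hco Hdec Hfine).
Qed.

(** Regularity also shows that [i k] is a cardinal: the inverse of an injection of [i k] into a
    smaller ordinal would be a cofinal map. *)
Lemma uncountable_i : uncountable_cardinal (i k).
Proof.
have Oik : is_ordinal (i k) by apply/i_ord.
have [_ [v [Ov Hv]]] := Uk.
split; last by exists (i v); split; [apply: i_omega|apply/i_mem].
split=> // a Ha; split; first by apply: card_le_sub; apply: ord_sub.
move=> /card_leE [f [Hf Hi]].
pose (h s := the (fun x => x ∈ i k /\ ap f x = s)).
have Dh : Dt (fun e => h (e 0)) by rewrite /h; dfn.
have hE x : x ∈ i k -> h (ap f x) = x.
  by move=> Hx; apply: theP => // x' [Hx' E]; apply: Hi.
have Mh : is_map (lam a h) a (i k).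
  apply: lam_map => // s Hs; case: (classic (exists x, x ∈ i k /\ ap f x = s)) => [[x [Hx <-]]|N].
    by rewrite hE.
  rewrite /h the_none; first by move=> x Hx; apply: N; exists x.
  by apply: ord_emp_mem => // He; apply: (He (i v)); apply/i_mem.
have [b [Hb H]] := regular_i Ha Mh.
apply: (@mem_irrefl _ b); apply: (H (ap f b)); apply/appE/in_lam2 => //.
by split; [apply: (map_ap Hf)|rewrite hE].
Qed.

Lemma measure_ext (l mu0 : V) : fine_measure k l mu0 ->
  exists mu : W, fine_measure (i k) (i l) mu /\ i mu0 ⊆ mu.
Proof.
move=> Hmu0.
have [P [Y [nu [pi [t [HP [Hmu [Hfine [Hnu [Hcnu [Hpi [Hs [Hco Hdec]]]]]]]]]]]]] := ground_data Hmu0.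
exists (mu l P Y nu pi t).
exact: (mu_fine HP Hmu Hnu Hcnu Hpi Hs Hco Hdec uncountable_i regular_i Hfine).
Qed.

Lemma strongly_compact_i : strongly_compact (i k).
Proof.
split; first exact: uncountable_i; split; first exact: regular_i.
(* Strong compactness in [W] quantifies over the ordinals of [W], all of which come from [V]. *)
move=> l' Ol' Hl'; have [l E] := ordinal_ground Ol'; subst l'.
have [_ [_ H]] := SC.
have [||mu0 Hmu0] := H l; [exact/i_ord|exact/i_sub|].
by have [m [Hm _]] := measure_ext Hmu0; exists m.
Qed.

End Extension.

Theorem theorem1p7 (V W : set_structure) (i : V -> W) (kappa : V) (f : W)
  (hV : ZFC V)
  (hkappa : strongly_compact kappa)
  (hf : fast_function_extension i kappa f) :
  strongly_compact (i kappa) /\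
  (forall lambda mu0 : V,
     is_ordinal lambda -> kappa ⊆ lambda -> fine_measure kappa lambda mu0 ->
     exists mu : W, fine_measure (i kappa) (i lambda) mu /\ i mu0 ⊆ mu).
Proof.
have [F [G [HF [[hW Hm Ht Hfil Hgen Hnam] _]]]] := hf.
pose (V' := ZfcModel hV); pose (W' := ZfcModel hW).
have EF : F = @Fs V' kappa.
  by apply: (@ext V') => p; rewrite (in_Fs0 (M := V') kappa p); apply: HF.
have [[_ [w [[Lw _] _]]] _] := hkappa.
split.
  exact: (@strongly_compact_i V' W' i Hm Ht F G Hfil Hgen w Lw Hnam kappa EF hkappa).
move=> l mu0 _ _ Hmu0.
exact: (@measure_ext V' W' i Hm Ht F G Hfil Hgen w Lw Hnam kappa EF hkappa l mu0 Hmu0).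
Qed.
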